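(* Let $N\ge1$, $\Delta\in\mathbb{R}$, $Y=\{y_1<\dots<y_N\}\subset\mathbb{Z}$, $x\in\mathbb{Z}$, $t\ge 0$. Then $\mathbb{P}_Y(X_1(t)\ge x)$ equals $$\int_{\mathcal{C}_R}\!\!\cdots\int_{\mathcal{C}_r}\frac{\prod_{j,k=1}^N(\xi_j+\zeta_k-2\Delta\xi_j\zeta_k)}{\prod_{j<k}(1+\xi_j\xi_k-2\Delta\xi_j)(1+\zeta_j\zeta_k-2\Delta\zeta_j)}\,D_N(\xi,\zeta)\prod_{j=1}^N(\xi_j\zeta_j)^{x-y_j-1}e^{-it(\varepsilon(\xi_j)-\varepsilon(\zeta_j))}\,d^N\zeta\,d^N\xi$$ $$=\int_{\mathcal{C}_R}\!\!\cdots\int_{\mathcal{C}_r}\frac{\Delta_N(\xi)\Delta_N(\zeta)}{\prod_{j<k}(1+\xi_j\xi_k-2\Delta\xi_j)(1+\zeta_j\zeta_k-2\Delta\zeta_j)}\,\frac{Q_N(\xi,\zeta)}{\prod_{j,k=1}^N(1-\xi_j\zeta_k)}\prod_{j=1}^N(\xi_j\zeta_j)^{x-y_j-1}e^{-it(\varepsilon(\xi_j)-\varepsilon(\zeta_j))}\,d^N\zeta\,d^N\xi,$$ where each $\xi_j$ is integrated over the circle $\mathcal{C}_R$ and each $\zeta_j$ over the circle $\mathcal{C}_r$, both centered at zero, with $r$ so small that $1+\zeta\zeta'-2\Delta\zeta\neq0$ whenever $|\zeta|,|\zeta'|\le r$, with $R$ so large that $1+\xi\xi'-2\Delta\xi\ne0$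 whenever $|\xi|,|\xi'|\ge R$, and with $Rr<1$.
   Context: Let $\mathcal{X}_N$ be the set of all $X=\{x_1<\dots<x_N\}\subset\mathbb{Z}$ and $\mathcal{H}_N=\ell^2(\mathcal{X}_N)$ with orthonormal basis $e_X(Y)=\delta_{X,Y}$. The XXZ spin-$\frac12$ Hamiltonian with anisotropy $\Delta\in\mathbb{R}$ is $H_{XXZ}=\sum_{j\in\mathbb{Z}}h_{j,j+1}$, where $h_{j,j+1}e_X=0$ if both or neither of $j,j+1$ belong to $X$, and $h_{j,j+1}e_X=-\Delta e_X+e_{X'}$ if exactly one of them belongs to $X$, with $X'$ obtained from $X$ by exchanging the occupation of $j$ and $j+1$. It is self-adjoint on $\mathcal{H}_N$. With $\Psi_N(t)=e^{-itH_{XXZ}}e_Y=\sum_X\psi_N(X;t)e_X$, the law of the left-most particle (up-spin) is $\mathbb{P}_Y(X_1(t)\ge x)=\sum_{X\in\mathcal{X}_N,\,x_1\ge x}|\psi_N(X;t)|^2$. $\varepsilon(\xi)=\xi+\xi^{-1}-2\Delta$. $d(u,v)=\dfrac{1}{(1-uv)(u+v-2\Delta uv)}$ and $D_N(\xi,\zeta)=\det\big(d(\xi_i,\zeta_j)\big)_{1\le i,j\le N}$. The Vandermonde product is $\Delta_N(\xi)=\prod_{1\le j<k\le N}(\xi_k-\xi_j)$ (not to be confused with the constant $\Delta$). $Q_N(\xi,\zeta)$ is the polynomial defined by $$\prod_{j,k=1}^N(\xi_j+\zeta_k-2\Delta\xi_j\zeta_k)\,D_N(\xi,\zeta)=\frac{\Delta_N(\xi)\Delta_N(\zeta)}{\prod_{j,k}(1-\xi_j\zeta_k)}Q_N(\xi,\zeta).$$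 The left side is understood after cancelling the factors $\xi_j+\zeta_k-2\Delta\xi_j\zeta_k$ against the denominators in $D_N$. Circles are positively oriented and every differential $d\xi,d\zeta$ incorporates the factor $(2\pi i)^{-1}$. *)

(* Defs.v *)
(* MathComp / MathComp-Analysis, over an arbitrary [K : realType]; the complex
   numbers are [K[i]] from mathcomp-real-closed. *)
From HB Require Import structures.
From mathcomp Require Import all_boot all_order all_algebra finmap.
From mathcomp Require Import all_classical all_reals all_analysis.
From mathcomp Require Import complex.
(* The notations of mpoly clash with those of MathComp-Analysis. *)
From mathcomp Require Import -(notations) mpoly.

Set Implicit Arguments.
Unset Strict Implicit.
Unset Printing Implicit Defensive.

Import Order.TTheory GRing.Theory Num.Theory.

Local Open Scope fset_scope.
Local Open Scope classical_set_scope.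
Local Open Scope complex_scope.
Local Open Scope ring_scope.

Definition config (N : nat) : Type := {X : {fset int} | #|` X| == N}.

(* [pos X j] is x_{j+1} when X = {x_1 < ... < x_N} and j < N. *)
Definition pos (N : nat) (X : config N) (j : nat) : int :=
  nth 0 (sort <=%R (val X : {fset int})) j.

Definition swap (j k : int) : int :=
  if k == j then j + 1 else if k == j + 1 then j else k.

Lemma swapK j : involutive (swap j).
Proof.
have jj1 : (j + 1 == j) = false by rewrite -subr_eq0 addrAC subrr add0r oner_eq0.
move=> k; rewrite {2}/swap.
have [->|kj] := eqVneq k j; first by rewrite /swap jj1 eqxx.
have [->|kj1] := eqVneq k (j + 1); first by rewrite /swap eqxx.
by rewrite /swap (negPf kj) (negPf kj1).
Qed.

Lemma card_exchange N (j : int) (X : config N) :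
  #|` [fset swap j k | k in val X]| == N.
Proof.
rewrite card_imfset /=; last exact: inv_inj (swapK j).
exact: (valP X).
Qed.

Definition exchange (N : nat) (j : int) (X : config N) : config N :=
  Sub [fset swap j k | k in val X] (card_exchange j X).

Lemma exchangeK N j : involutive (@exchange N j).
Proof.
move=> X; apply/val_inj/fsetP => k /=; apply/imfsetP/idP => /=.
  by move=> [l /imfsetP[m /= mX ->] ->]; rewrite swapK.
move=> kX; exists (swap j k); last by rewrite swapK.
by apply/imfsetP; exists k.
Qed.

Section Quantum.
Variable K : realType.
Local Notation C := K[i].

Definition sqnorm (z : C) : K := complex.Re z ^+ 2 + complex.Im z ^+ 2.

Definition ket (N : nat) (Y : config N) : config N -> C :=
  fun X => (X == Y)%:R.

Definition half_filled (N : nat) (j : int) (X : config N) : bool :=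
  (j \in val X) (+) (j + 1 \in val X).

(* h_{j,j+1} acting on an arbitrary vector f = \sum_X f(X) e_X; since
   X |-> X' is an involution, the coefficient of e_X' in f is carried to e_X.
   Lemma [hloc_ket] gives the action on basis vectors. *)
Definition hloc (N : nat) (Delta : K) (j : int) (f : config N -> C) :
    config N -> C :=
  fun X => if half_filled j X then - Delta%:C * f X + f (exchange j X) else 0.

Lemma half_filled_exchange N j (X : config N) :
  half_filled j (exchange j X) = half_filled j X.
Proof.
have mem k : (k \in val (exchange j X)) = (swap j k \in val X).
  by rewrite /= -{1}(swapK j k) mem_imfset //; exact: inv_inj (swapK j).
have jj1 : (j + 1 == j) = false by rewrite -subr_eq0 addrAC subrr add0r oner_eq0.
by rewrite /half_filled !mem /swap jj1 !eqxx addbC.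
Qed.

Lemma hloc_ket N Delta j (X : config N) :
  hloc Delta j (ket X) =
  if half_filled j X
  then (fun Z => - Delta%:C * ket X Z + ket (exchange j X) Z) else fun=> 0.
Proof.
apply/funext => Z; rewrite /hloc /ket.
have -> : (exchange j Z == X) = (Z == exchange j X).
  by apply/eqP/eqP => [<-|->]; rewrite exchangeK.
rewrite (fun_if (fun f => f Z)).
have [->//|ZX] := eqVneq Z X.
have [->|ZX'] := eqVneq Z (exchange j X); first by rewrite half_filled_exchange.
by rewrite mulr0 addr0 !if_same.
Qed.

(* For each X only finitely many j contribute, so this [\sum_(j \in _)], which
   ranges over the support of the summand, is the full sum over j. *)
Definition Hxxz (N : nat) (Delta : K) (f : config N -> C) : config N -> C :=
  fun X => \sum_(j \in [set: int]) hloc Delta j f X.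

Definition l2dist2 (N : nat) (f g : config N -> C) : \bar K :=
  \esum_(X in [set: config N]) (sqnorm (f X - g X))%:E.

Definition exp_partial (N : nat) (Delta t : K) (v : config N -> C) (n : nat) :
    config N -> C :=
  fun X => \sum_(k < n)
    (- 'i%C * t%:C) ^+ k / (k`!)%:R * iter k (Hxxz Delta) v X.

(* e^{-itH} v as the l^2-norm limit of the exponential series, which converges
   since H is bounded on l^2 (each X has at most 2N half-filled bonds). *)
Definition exp_mitH (N : nat) (Delta t : K) (v : config N -> C) :
    config N -> C :=
  xget (fun=> 0)
    [set f | l2dist2 (exp_partial Delta t v n) f @[n --> \oo] --> 0%E].

Definition psi (N : nat) (Delta : K) (Y X : config N) (t : K) : C :=
  exp_mitH Delta t (ket Y) X.

Definition prob_leftmost_ge (N : nat) (Delta : K) (Y : config N) (t : K)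
    (x : int) : \bar K :=
  \esum_(X in [set X : config N | x <= pos X 0]) (sqnorm (psi Delta Y X t))%:E.

End Quantum.

Section Contour.
Variable K : realType.
Local Notation C := K[i].

Definition cexp (z : C) : C :=
  (expR (complex.Re z))%:C * (cos (complex.Im z) +i* sin (complex.Im z)).

Definition cintegral (a b : K) (f : K -> C) : C :=
  (\int[lebesgue_measure]_(s in `[a, b]) complex.Re (f s)) +i*
  (\int[lebesgue_measure]_(s in `[a, b]) complex.Im (f s)).

(* Integral over the positively oriented circle |z| = r, with the factor
   (2 pi i)^-1 included: z = r e^{is}, dz = i r e^{is} ds. *)
Definition circle_int (r : K) (f : C -> C) : C :=
  (2 * pi%:C * 'i%C)^-1 *
  cintegral 0 (2 * pi)
    (fun s => f (r%:C * cexp ('i%C * s%:C)) *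
              ('i%C * r%:C * cexp ('i%C * s%:C))).

Fixpoint multi_circle_int (r : K) (n : nat) : (n.-tuple C -> C) -> C :=
  match n with
  | 0 => fun f => f [tuple]
  | m.+1 => fun f =>
      circle_int r (fun z => multi_circle_int r (fun v : m.-tuple C =>
        f [tuple of z :: v]))
  end.

End Contour.

Section BetheFunctions.
Variables (K : realType) (Delta : K).
Local Notation C := K[i].

Definition energy (z : C) : C := z + z^-1 - 2 * Delta%:C.

Definition dker (u v : C) : C :=
  ((1 - u * v) * (u + v - 2 * Delta%:C * u * v))^-1.

Definition DN (N : nat) (xi zeta : N.-tuple C) : C :=
  \det (\matrix_(i < N, j < N) dker (tnth xi i) (tnth zeta j)).

Definition vdm (N : nat) (xi : N.-tuple C) : C :=
  \prod_(j < N) \prod_(k < N | (j < k)%N) (tnth xi k - tnth xi j).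

Definition prod_mix (N : nat) (xi zeta : N.-tuple C) : C :=
  \prod_(j < N) \prod_(k < N)
    (tnth xi j + tnth zeta k - 2 * Delta%:C * tnth xi j * tnth zeta k).

Definition prod_one_minus (N : nat) (xi zeta : N.-tuple C) : C :=
  \prod_(j < N) \prod_(k < N) (1 - tnth xi j * tnth zeta k).

Definition scat_denom (N : nat) (xi zeta : N.-tuple C) : C :=
  \prod_(j < N) \prod_(k < N | (j < k)%N)
    ((1 + tnth xi j * tnth xi k - 2 * Delta%:C * tnth xi j) *
     (1 + tnth zeta j * tnth zeta k - 2 * Delta%:C * tnth zeta j)).

(* The first N variables of the polynomial are the xi's, the last N the zeta's. *)
Definition eval2 (N : nat) (Q : mpoly.mpoly (N + N) C) (xi zeta : N.-tuple C) :
    C :=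
  mpoly.meval (tnth (cat_tuple xi zeta)) Q.

(* Imposing the identity where no denominator vanishes (a Zariski-dense set) is
   the same as imposing it after cancellation, and determines Q. *)
Definition is_QN (N : nat) (Q : mpoly.mpoly (N + N) C) : Prop :=
  forall xi zeta : N.-tuple C,
    prod_mix xi zeta != 0 -> prod_one_minus xi zeta != 0 ->
    prod_mix xi zeta * DN xi zeta =
    vdm xi * vdm zeta / prod_one_minus xi zeta * eval2 Q xi zeta.

Definition QN (N : nat) : mpoly.mpoly (N + N) C :=
  xget (0 : mpoly.mpoly (N + N) C) [set Q | is_QN Q].

Definition wave_factor (N : nat) (Y : config N) (x : int) (t : K)
    (xi zeta : N.-tuple C) : C :=
  \prod_(j < N)
    ((tnth xi j * tnth zeta j) ^ (x - pos Y j - 1) *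
     cexp (- 'i%C * t%:C * (energy (tnth xi j) - energy (tnth zeta j)))).

Definition integrandD (N : nat) (Y : config N) (x : int) (t : K)
    (xi zeta : N.-tuple C) : C :=
  prod_mix xi zeta / scat_denom xi zeta * DN xi zeta *
  wave_factor Y x t xi zeta.

Definition integrandQ (N : nat) (Y : config N) (x : int) (t : K)
    (xi zeta : N.-tuple C) : C :=
  vdm xi * vdm zeta / scat_denom xi zeta *
  (eval2 (QN N) xi zeta / prod_one_minus xi zeta) *
  wave_factor Y x t xi zeta.

Definition double_contour (N : nat) (R r : K)
    (F : N.-tuple C -> N.-tuple C -> C) : C :=
  multi_circle_int R (fun xi => multi_circle_int r (fun zeta => F xi zeta)).

End BetheFunctions.

(* Main.v *)
From HB Require Import structures.
Require Import Defs.
From mathcomp Require Import all_boot all_order all_algebra fingroup perm finmap.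
From mathcomp Require Import all_classical all_reals all_analysis.
From mathcomp Require Import complex measurable_realfun.
From mathcomp Require Import -(notations) mpoly.
From mathcomp Require Import zify ring lra.

Set Implicit Arguments.
Unset Strict Implicit.
Unset Printing Implicit Defensive.
Import Order.TTheory GRing.Theory Num.Theory.
Import numFieldNormedType.Exports.
Local Open Scope classical_set_scope.
Local Open Scope complex_scope.
Local Open Scope ring_scope.

(** The proof follows the coordinate Bethe ansatz. Written in terms of the increasing
    positions of the particles, the Hamiltonian is a free Laplacian for functions that
    satisfy a boundary condition at neighbouring particles ([freeH_boundary]), and the
    antisymmetrised plane waves [Phi] satisfy this condition whatever their roots are
    ([Phi_boundary]). Integrating them over a torus against a plane wave in the initial
    positions and [exp (- i t E)] gives a solution of the evolution equation. At [t = 0]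
    it is the initial state: this is the orthogonality relation [bethe_orthogonality].
    It is deduced from a uniqueness statement, [kernel_delta]: the integral commutes with
    the Hamiltonian, is triangular, and factorises when the first particle is far from
    the others, and these properties characterise the identity.

    The contour formula for the wave function holds on every circle on which the
    scattering factors are analytic and invertible on one side, hence on the small and on
    the large circle of the statement ([psiE], [psi_conjE]). Taking the large one for the
    wave function and the small one for its conjugate makes all products
    [(\prod xi) * (\prod zeta)] smaller than 1 in modulus. Configurations with left-most
    particle at or beyond [x] are translates of the [z] with [0 <= z_1 < ... < z_N], and
    the sum over [z] of [Phi xi z * Phi zeta z] is summed one particle at a time as
    geometric series, with uniform convergence on the tori ([cone_sum_pairing]). The
    result, [pairing], is given by a recursion on [N]; the Izergin-Korepin determinant
    satisfies the same recursion by Lagrange interpolation ([ik_det_rec]), so that the two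
    agree ([pairing_det]). This is the first formula.

    The second one needs that the polynomial [Q] exists. The determinant, cleared of its
    denominators, vanishes when two [xi] or two [zeta] coincide, and is therefore divisible
    by the product of the two Vandermonde determinants ([exists_QN]).

    Two devices keep the analysis elementary. All functions on tori that occur are uniform
    limits of Laurent polynomials ([lap]), so that contour integrals reduce to reading off
    a coefficient, and analyticity on one side of the torus becomes a sign condition on
    the exponents. The determinantal integrands agree with such functions only at generic
    points, because the interpolation argument needs distinct roots and nonzero
    denominators; [multi_circle_int_generic] shows that the other points do not matter. *)

(** * Antisymmetrised plane waves *)

Definition shift n (x : 'I_n -> int) (i : 'I_n) (d : int) : 'I_n -> int :=
  fun k => if k == i then x k + d else x k.

Section PairProducts.
Variables (F : comNzRingType) (n : nat) (g : F -> F -> F).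

Definition pair_prod (w : 'I_n -> F) : F :=
  \prod_(j < n) \prod_(k < n | (j < k)%N) g (w j) (w k).

(** Removing one adjacent pair leaves a product that is invariant under exchanging the
    two entries of that pair; this is what makes the boundary conditions below hold by
    antisymmetry. *)
Definition pair_prod_but (i j : 'I_n) (w : 'I_n -> F) : F :=
  \prod_(p : 'I_n * 'I_n | (p.1 < p.2)%N && (p != (i, j))) g (w p.1) (w p.2).

Lemma pair_prodE w :
  pair_prod w = \prod_(p : 'I_n * 'I_n | (p.1 < p.2)%N) g (w p.1) (w p.2).
Proof. by rewrite /pair_prod pair_big_dep. Qed.

Lemma pair_prod_adjacent (i j : 'I_n) w : j = i.+1 :> nat ->
  pair_prod w = g (w i) (w j) * pair_prod_but i j w.
Proof. by move=> ji; rewrite pair_prodE (bigD1 (i, j)) //= ji ltnS. Qed.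

Lemma tperm_adjacent_lt (i j : 'I_n) (p : 'I_n * 'I_n) : j = i.+1 :> nat ->
  ((tperm i j p.1 < tperm i j p.2)%N && ((tperm i j p.1, tperm i j p.2) != (i, j)))
  = ((p.1 < p.2)%N && (p != (i, j))).
Proof.
case: p => [k l] /= ji; rewrite !xpair_eqE.
case: tpermP => [->|->|/eqP + /eqP +]; case: tpermP => [->|->|/eqP + /eqP +];
  by rewrite -?val_eqE /=; lia.
Qed.

Lemma pair_prod_but_tperm (i j : 'I_n) w : j = i.+1 :> nat ->
  pair_prod_but i j (w \o tperm i j) = pair_prod_but i j w.
Proof.
move=> ji; rewrite /pair_prod_but.
rewrite [RHS](reindex (fun p : 'I_n * 'I_n => (tperm i j p.1, tperm i j p.2))) /=.
  by apply: eq_bigl => p; rewrite tperm_adjacent_lt.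
by exists (fun p => (tperm i j p.1, tperm i j p.2)) => -[k l] _ /=; rewrite !tpermK.
Qed.

End PairProducts.

Lemma pair_prod_recl (F : comNzRingType) n (g : F -> F -> F) (w : 'I_n.+1 -> F) :
  pair_prod g w =
  (\prod_(j < n) g (w ord0) (w (lift ord0 j))) * pair_prod g (w \o lift ord0).
Proof.
rewrite /pair_prod big_ord_recl; congr (_ * _).
  by rewrite big_mkcond big_ord_recl /= mul1r.
apply: eq_bigr => i _.
by rewrite big_mkcond big_ord_recl /= mul1r -big_mkcond.
Qed.

(** The factor by which two Bethe roots scatter; up to sign, its ratio with the roots
    exchanged is the XXZ scattering matrix. *)
Definition scat (F : comNzRingType) (D a b : F) : F := 1 + a * b - 2 * D * a.

Section BetheAlgebra.
Variables (F : numFieldType) (D : F).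
Local Notation scat := (scat D).

(** Bethe's wave function for the roots [v], with the common denominator [pair_prod scat
    v] left out: it is then a Laurent polynomial in [v], antisymmetric in the roots. *)
Definition Phi n (v : 'I_n -> F) (x : 'I_n -> int) : F :=
  \sum_(s : 'S_n) (-1) ^+ s * pair_prod scat (v \o s) * \prod_(i < n) v (s i) ^ x i.

Lemma Phi_size0 (v : 'I_0 -> F) x : Phi v x = 1.
Proof.
rewrite /Phi (big_pred1 1%g) => [|s]; last by apply/esym/eqP/permP => -[].
by rewrite /pair_prod !big_ord0 odd_perm1 !mulr1.
Qed.

Lemma Phi_perm n (v : 'I_n -> F) x (t : 'S_n) : Phi (v \o t) x = (-1) ^+ t * Phi v x.
Proof.
rewrite /Phi big_distrr /= [RHS](reindex_inj (mulIg t)) /=; apply: eq_bigr => s _.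
have E : (-1) ^+ t * (-1) ^+ (s * t)%g = (-1) ^+ s :> F.
  by rewrite -signr_addb odd_permM addbC -addbA addbb addbF.
rewrite !mulrA E; congr (_ * _ * _).
- by apply: eq_bigr => i _; apply: eq_bigr => j _; rewrite /= !permM.
- by apply: eq_bigr => i _; rewrite /= permM.
Qed.

Definition Phi_term n (v : 'I_n -> F) (x : 'I_n -> int) (s : 'S_n) : F :=
  (-1) ^+ s * pair_prod scat (v \o s) * \prod_(i < n) v (s i) ^ x i.

(** Fixing which root goes to the first particle is a bijection with the permutations of
    the remaining roots, given by [lift_perm]; the sign it contributes is the parity of
    the position of that root. *)
Lemma Phi_head n (v : 'I_n.+1 -> F) x a :
  \sum_(s : 'S_n.+1 | s ord0 == a) Phi_term v x s =
  (-1) ^+ a * (\prod_(j < n) scat (v a) (v (lift a j)))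
    * v a ^ x ord0 * Phi (v \o lift a) (x \o lift ord0).
Proof.
rewrite /Phi_term /Phi big_distrr /=.
rewrite (reindex (lift_perm ord0 a)) /=; last first.
  pose ulsf i (s : 'S_n.+1) k := odflt k (unlift (s i) (s (lift i k))).
  have ulsfK i (s : 'S_n.+1) k : lift (s i) (ulsf i s k) = s (lift i k).
    rewrite /ulsf; have:= neq_lift i k.
    by rewrite -(can_eq (permK s)) => /unlift_some[] ? ? ->.
  have inj_ulsf: injective (ulsf ord0 _).
    move=> s; apply: can_inj (ulsf (s ord0) s^-1%g) _ => k'.
    by rewrite {1}/ulsf ulsfK !permK liftK.
  exists (fun s => perm (inj_ulsf s)) => [s _ | s].
    by apply/permP=> k'; rewrite permE /ulsf lift_perm_lift lift_perm_id liftK.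
  move/(s _ =P _) => si0; apply/permP=> k.
  by case: (unliftP ord0 k) => [k'|] ->; rewrite ?lift_perm_id // lift_perm_lift -si0 permE ulsfK.
apply: eq_big => [s|s _]; first by rewrite lift_perm_id eqxx.
rewrite pair_prod_recl big_ord_recl /= lift_perm_id odd_lift_perm /=.
have E k : lift_perm ord0 a s (lift ord0 k) = lift a (s k) by rewrite lift_perm_lift.
rewrite signr_addb signr_odd.
have -> : \prod_(j < n) scat (v a) (v (lift_perm ord0 a s (lift ord0 j))) =
    \prod_(j < n) scat (v a) (v (lift a j)).
  by rewrite [RHS](reindex_inj (@perm_inj _ s)); apply: eq_bigr => j _; rewrite E.
have -> : pair_prod scat ((v \o lift_perm ord0 a s) \o lift ord0) =
    pair_prod scat ((v \o lift a) \o s).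
  by do 2!apply: eq_bigr => ? _; rewrite /= !E.
under eq_bigr do rewrite E.
rewrite -!mulrA (mulrCA ((-1) ^+ s)); do 2!congr (_ * _).
by rewrite [RHS]mulrCA; congr (_ * _); rewrite mulrCA.
Qed.

Lemma Phi_rec n (v : 'I_n.+1 -> F) x :
  Phi v x = \sum_(a < n.+1) (-1) ^+ a * (\prod_(j < n) scat (v a) (v (lift a j)))
    * v a ^ x ord0 * Phi (v \o lift a) (x \o lift ord0).
Proof.
rewrite [LHS](partition_big (fun s : 'S_n.+1 => s ord0) predT) //=.
by apply: eq_bigr => a _; exact: Phi_head.
Qed.

(** The boundary condition that encodes the interaction. For each permutation the three
    terms combine into the factor [v (s i) + (v (s j))^-1 - 2 D], which is [scat] of the
    exchanged pair divided by [v (s j)]. Together with the factor [scat] of the pair,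
    and with the monomial, in which the division makes the exponents of the two roots
    equal, it is symmetric under the transposition of [i] and [j], while the sign
    changes; the permutations cancel in pairs. *)
Lemma Phi_boundary n (v : 'I_n -> F) (x : 'I_n -> int) (i j : 'I_n) :
    (forall k, v k != 0) -> j = i.+1 :> nat -> x j = x i + 1 ->
  Phi v (shift x i 1) + Phi v (shift x j (-1)) = 2 * D * Phi v x.
Proof.
move=> v0 ji xji.
have ij : i != j by rewrite -val_eqE /= ji; lia.
(* The contribution of one permutation; it changes sign when [s] is preceded by the
   transposition of the adjacent positions [i] and [j]. *)
pose T (s : 'S_n) := (-1) ^+ s * pair_prod scat (v \o s) * (\prod_(k < n) v (s k) ^ x k)
  * (v (s i) + (v (s j))^-1 - 2 * D).
have mono_shift (s : 'S_n) k d : \prod_(l < n) v (s l) ^ (shift x k d l) =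
    (\prod_(l < n) v (s l) ^ x l) * v (s k) ^ d.
  rewrite (bigD1 k) //= [in RHS](bigD1 k) //= /shift eqxx expfzDr // mulrAC.
  by congr (_ * _ * _); apply: eq_bigr => l /negPf ->.
have TN s : T (tperm i j * s)%g = - T s.
  rewrite /T odd_permM odd_tperm ij signr_addb !permM tpermL tpermR.
  rewrite !(pair_prod_adjacent _ _ ji) /= !permM tpermL tpermR.
  have -> : pair_prod_but scat i j (v \o (tperm i j * s)%g) =
            pair_prod_but scat i j (v \o s).
    rewrite -[RHS](pair_prod_but_tperm _ _ ji); apply: eq_bigr => p _.
    by rewrite /= !permM.
  have two (f : 'I_n -> F) :
      \prod_k f k = f i * (f j * \prod_(k | (k != i) && (k != j)) f k).
    by rewrite (bigD1 i) //= (bigD1 j) // eq_sym.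
  rewrite !two !permM tpermL tpermR xji !expfzDr // !expr1z.
  rewrite [X in _ * (_ * (_ * X)) * _](_ : _ = \prod_(k | (k != i) && (k != j)) v (s k) ^ x k).
    rewrite /scat; move: (\prod_(_ | _) _) (pair_prod_but _ _ _ _) (v (s i) ^ x i) (v (s j) ^ x i).
    move: (v (s i)) (v (s j)) (v0 (s i)) (v0 (s j)) => A B A0 B0 *.
    by move: ((-1) ^+ s) => e; rewrite expr1; field; rewrite A0 B0.
  by apply: eq_bigr => k /andP[ki kj]; rewrite permM tpermD // eq_sym.
have T0 : \sum_s T s = 0.
  have: \sum_s T s = - \sum_s T s.
    by rewrite {1}(reindex_inj (mulgI (tperm i j))) -sumrN; apply: eq_bigr.
  by move/eqP; rewrite -addr_eq0 -mulr2n mulrn_eq0 => /eqP.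
apply/eqP; rewrite -subr_eq0 -T0 /Phi -big_split big_distrr -sumrB /=; apply/eqP/eq_bigr => s _.
rewrite !mono_shift /T expr1z exprN1.
by move: ((-1) ^+ s) (pair_prod _ _) (\prod_(_ < n) _) => ? ? ?; ring.
Qed.

(** Each plane wave is an eigenfunction of the shifts, and the eigenvalue does not
    depend on the permutation. *)
Lemma Phi_laplacian n (v : 'I_n -> F) (x : 'I_n -> int) : (forall k, v k != 0) ->
  \sum_(i < n) (Phi v (shift x i 1) + Phi v (shift x i (-1))) =
  (\sum_(i < n) (v i + (v i)^-1)) * Phi v x.
Proof.
move=> v0.
have mono_shift (s : 'S_n) k d : \prod_(l < n) v (s l) ^ (shift x k d l) =
    (\prod_(l < n) v (s l) ^ x l) * v (s k) ^ d.
  rewrite (bigD1 k) //= [in RHS](bigD1 k) //= /shift eqxx expfzDr // mulrAC.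
  by congr (_ * _ * _); apply: eq_bigr => l /negPf ->.
under eq_bigr do rewrite /Phi -big_split /=.
rewrite exchange_big /= /Phi big_distrr /=; apply: eq_bigr => s _.
rewrite [in RHS](reindex_inj (@perm_inj _ s)) big_distrl /=; apply: eq_bigr => i _.
rewrite !mono_shift expr1z exprN1.
by move: ((-1) ^+ s) (pair_prod _ _) (\prod_(_ < n) _) => ? ? ?; ring.
Qed.
End BetheAlgebra.

(** * A recursion for the Izergin-Korepin determinant *)

Section Lagrange.
Variables (F : fieldType) (n : nat).
Implicit Types (z : 'I_n.+1 -> F) (P : {poly F}).

Lemma lift_neqf z (a : 'I_n.+1) (j : 'I_n) : injective z -> z a - z (lift a j) != 0.
Proof.
by move=> zI; rewrite subr_eq0; apply/negP => /eqP/zI/eqP; rewrite (negPf (neq_lift a j)).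
Qed.

(** Interpolation at the distinct nodes [z]; every summation identity of this part is an
    instance of it for a well chosen polynomial and point. *)
Lemma lagrange z P x : injective z -> (size P <= n.+1)%N ->
  P.[x] = \sum_(b < n.+1) P.[z b] * \prod_(c < n) ((x - z (lift b c)) / (z b - z (lift b c))).
Proof.
move=> zI sP.
pose L b : {poly F} := \prod_(c < n) ((z b - z (lift b c))^-1 *: ('X - (z (lift b c))%:P)).
have LE b y : (L b).[y] = \prod_(c < n) ((y - z (lift b c)) / (z b - z (lift b c))).
  by rewrite /L horner_prod; apply: eq_bigr => c _; rewrite hornerZ hornerXsubC mulrC.
pose Q := P - \sum_b P.[z b] *: L b.
suff Q0 : Q = 0.
  move: (congr1 (fun q => q.[x]) Q0).
  rewrite /Q !hornerE horner_sum => /eqP; rewrite subr_eq0 => /eqP ->.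
  by apply: eq_bigr => b _; rewrite hornerZ LE.
apply: (@roots_geq_poly_eq0 _ _ [seq z i | i <- enum 'I_n.+1]).
- apply/allP => _ /mapP[b _ ->]; apply/rootP.
  rewrite /Q !hornerE horner_sum (bigD1 b) //= hornerZ LE big1 ?mulr1; last first.
    by move=> c _; rewrite mulfV // lift_neqf.
  rewrite big1 ?addr0 ?subrr // => c cb.
  rewrite hornerZ LE; have [j bj|bj] := unliftP c b; last by rewrite bj eqxx in cb.
  by rewrite bj (bigD1 j) //= subrr !(mul0r, mulr0).
- by rewrite map_inj_uniq ?enum_uniq.
- rewrite size_map size_enum_ord; apply: (leq_trans (size_polyD _ _)).
  rewrite geq_max sP size_polyN; apply: (leq_trans (size_sum _ _ _)).
  apply/bigmax_leqP => b _; apply: (leq_trans (size_scale_leq _ _)).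
  apply: (leq_trans (size_prod_leq _ _)); rewrite card_ord leq_subLR.
  have: (\sum_(i < n) size ((z b - z (lift b i))^-1 *: ('X - (z (lift b i))%:P))%R <= \sum_(i < n) 2)%N.
    by apply: leq_sum => i _; rewrite (leq_trans (size_scale_leq _ _)) ?size_XsubC.
  by rewrite sum_nat_const card_ord addnS ltnS muln2 addnn.
Qed.

Lemma size_prod_linear (a b : 'I_n -> F) :
  (size (\prod_(j < n) ((a j)%:P - b j *: 'X))%R <= n.+1)%N.
Proof.
apply: (leq_trans (size_prod_leq _ _)); rewrite card_ord leq_subLR.
have: (\sum_(j < n) size ((a j)%:P - b j *: 'X)%R <= \sum_(i < n) 2)%N.
  apply: leq_sum => i _; rewrite (leq_trans (size_polyD _ _)) // geq_max.
  rewrite (leq_trans (size_polyC_leq1 _)) // size_polyN.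
  by rewrite (leq_trans (size_scale_leq _ _)) ?size_polyX.
by rewrite sum_nat_const card_ord addnS ltnS muln2 addnn.
Qed.

Lemma prodMl_const (k : F) (f : 'I_n -> F) : \prod_(j < n) (k * f j) = k ^+ n * \prod_(j < n) f j.
Proof. by rewrite big_split /= prodr_const card_ord. Qed.

Lemma horner_prod_linear (b : 'I_n -> F) x :
  (\prod_(j < n) (1%:P - b j *: 'X)).[x] = \prod_(j < n) (1 - b j * x).
Proof. by rewrite horner_prod; apply: eq_bigr => j _; rewrite !hornerE. Qed.
End Lagrange.

Lemma prod_lift (R : comNzRingType) n (f : 'I_n.+1 -> R) b :
  \prod_(k < n.+1) f k = f b * \prod_(c < n) f (lift b c).
Proof. by rewrite (bigD1_ord b). Qed.

Lemma exprz_prod (F : fieldType) n (f : 'I_n -> F) (k : int) :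
  (\prod_i f i) ^ k = \prod_i f i ^ k.
Proof. by elim/big_rec2: _ => [|i a b _ <-]; rewrite ?exp1rz ?expfzMl. Qed.

Section DetRecursion.
Variables (F : fieldType) (D : F).
Local Notation scat := (scat D).

Definition mix (a b : F) : F := a + b - 2 * D * a * b.

Definition cauchy (a b : F) : F := ((1 - a * b) * mix a b)^-1.

Lemma mixC a b : mix a b = mix b a.
Proof. by rewrite /mix; ring. Qed.

Lemma cauchyC a b : cauchy a b = cauchy b a.
Proof. by rewrite /cauchy mixC (mulrC a). Qed.

Section Residues.
Variables (n : nat) (v w : 'I_n.+1 -> F).
Hypotheses (vw1 : forall i j, 1 - v i * w j != 0) (vwm : forall i j, mix (v i) (w j) != 0)
  (wI : injective w).

(** Up to sign, [alpha v w] is the image under the matrix [cauchy (v i) (w j)] of the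
    vector [weight v w]. The same holds with the two families exchanged, so that both
    [alpha]s pair with the cofactors to give multiples of the determinant. *)
Definition alpha (a : 'I_n.+1) : F :=
  (\prod_(j < n) scat (v a) (v (lift a j))) / \prod_(k < n.+1) mix (v a) (w k).

Definition weight (b : 'I_n.+1) : F :=
  (\prod_(j < n.+1) (1 - v j * w b)) / \prod_(c < n) (w b - w (lift b c)).

Lemma cauchy_weight a b : cauchy (v a) (w b) * weight b =
  (\prod_(j < n) (1 - v (lift a j) * w b)) / (mix (v a) (w b) * \prod_(c < n) (w b - w (lift b c))).
Proof.
rewrite /weight (prod_lift _ a) /cauchy.
have := vw1 a b; move: (1 - v a * w b) => q q0.
move: (\prod_(_ < n) _) => A; move: (\prod_(_ < n) _) (mix _ _) => B m.
by rewrite !invfM -[RHS]mul1r -(mulVf q0); ring.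
Qed.

(** Interpolate the product of [1 - v j * X] over [j != a] at the nodes [w] and evaluate
    at [- v a / (1 - 2 D v a)], the zero of [mix (v a)]: the products of differences
    become the products of [mix] in [alpha]. *)
Lemma sum_cauchy_weight a : 1 - 2 * D * v a != 0 ->
  \sum_(b < n.+1) cauchy (v a) (w b) * weight b = (-1) ^+ n * alpha a.
Proof.
set q := 1 - 2 * D * v a => q0.
have E : \prod_(j < n) (1 - v (lift a j) * (- v a / q)) = \sum_(b < n.+1)
    (\prod_(j < n) (1 - v (lift a j) * w b)) *
    \prod_(c < n) ((- v a / q - w (lift b c)) / (w b - w (lift b c))).
  rewrite -(horner_prod_linear (fun j => v (lift a j))).
  rewrite (lagrange _ wI (size_prod_linear _ _)); apply: eq_bigr => b _.
  by rewrite (horner_prod_linear (fun j => v (lift a j))).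
have xw c : - v a / q - w c = - q^-1 * mix (v a) (w c).
  rewrite /mix /q in q0 *; field; exact: q0.
have E1 : \prod_(j < n) (1 - v (lift a j) * (- v a / q)) =
    (q^-1) ^+ n * \prod_(j < n) scat (v a) (v (lift a j)).
  rewrite -prodMl_const; apply: eq_bigr => j _; rewrite /scat /q in q0 *; field; exact: q0.
have M0 : \prod_(k < n.+1) mix (v a) (w k) != 0 by apply/prodf_neq0 => k _.
have E2 (b : 'I_n.+1) : \prod_(c < n) ((- v a / q - w (lift b c)) / (w b - w (lift b c))) =
   (- q^-1) ^+ n * (\prod_(k < n.+1) mix (v a) (w k)) /
   (mix (v a) (w b) * \prod_(c < n) (w b - w (lift b c))).
  rewrite (prod_lift _ b) big_split /= prodfV.
  under eq_bigr do rewrite xw.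
  rewrite prodMl_const; have := vwm a b; move: (mix (v a) (w b)) => m m0.
  move: (\prod_(_ < n) _) ((- q^-1) ^+ n) => A e; move: (\prod_(_ < n) _) => B.
  by rewrite invfM -[LHS]mul1r -(mulVf m0); ring.
move: E; rewrite E1; under [X in _ = X]eq_bigr do rewrite E2.
move=> E.
under eq_bigr do rewrite cauchy_weight.
apply: (mulfI (_ : (q^-1) ^+ n * \prod_(k < n.+1) mix (v a) (w k) != 0)).
  by rewrite mulf_neq0 // expf_neq0 // invr_eq0.
transitivity ((-1) ^+ n * ((q^-1) ^+ n * \prod_(j < n) scat (v a) (v (lift a j)))); last first.
  rewrite /alpha; move: M0 (\prod_(_ < n) _) ((-1) ^+ n) ((q^-1) ^+ n) => /=.
  by move: (\prod_(_ < n.+1) _) => M M0 S e f; field.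
rewrite E !big_distrr /=; apply: eq_bigr => b _; rewrite (exprNn q^-1) -[LHS](signrMK n).
move: (\prod_(_ < n.+1) _) ((q^-1) ^+ n) ((-1) ^+ n) => M f e.
by move: (\prod_(_ < n) _) (_^-1) => A B; ring.
Qed.

Lemma prod_lagrange0 b : w b != 0 ->
  \prod_(c < n) ((0 - w (lift b c)) / (w b - w (lift b c))) =
  (- 1) ^+ n * (\prod_(k < n.+1) w k) / (w b * \prod_(c < n) (w b - w (lift b c))).
Proof.
rewrite (prod_lift _ b) big_split /= prodfV.
under eq_bigr do rewrite sub0r -mulN1r.
rewrite prodMl_const; move: (w b) => m m0.
move: (\prod_(_ < n) _) ((- 1) ^+ n) => A e; move: (\prod_(_ < n) _) => B.
by rewrite invfM -[LHS]mul1r -(mulVf m0); ring.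
Qed.

(** The same polynomial as in [sum_cauchy_weight], now evaluated at 0; the factor
    [weight b / w b] arises by partial fractions, since [mix (v a) (w b) = v a + (1 - 2
    D v a) * w b]. *)
Lemma sum_cauchy_weight_inv a : 1 - 2 * D * v a != 0 -> v a != 0 -> (forall b, w b != 0) ->
  alpha a * ((1 - 2 * D * v a) / v a) =
  (v a * \prod_(b < n.+1) w b)^-1
  - (-1) ^+ n * \sum_(b < n.+1) cauchy (v a) (w b) * (weight b / w b).
Proof.
move=> q0 v0 w0; have Ea := sum_cauchy_weight q0.
set q := 1 - 2 * D * v a in q0 *.
have E : 1 = \sum_(b < n.+1) (\prod_(j < n) (1 - v (lift a j) * w b)) *
    \prod_(c < n) ((0 - w (lift b c)) / (w b - w (lift b c))).
  transitivity (\prod_(j < n) (1 - v (lift a j) * 0)).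
    by rewrite big1 // => j _; rewrite mulr0 subr0.
  rewrite -(horner_prod_linear (fun j => v (lift a j))).
  rewrite (lagrange _ wI (size_prod_linear _ _)); apply: eq_bigr => b _.
  by rewrite (horner_prod_linear (fun j => v (lift a j))).
have W0 : \prod_(k < n.+1) w k != 0 by apply/prodf_neq0 => k _.
have E2 b := prod_lagrange0 (w0 b).
have Es : (-1) ^+ n * \sum_(b < n.+1) cauchy (v a) (w b) * (weight b / w b) =
    (v a * \prod_(b < n.+1) w b)^-1 - (q / v a) * alpha a; last by rewrite Es; ring.
rewrite -[alpha a](signrMK n) -Ea invfM -[X in X - _]mulr1 [X in _ * X - _]E.
rewrite !big_distrr /= -sumrB; apply: eq_bigr => b _.
rewrite [_ * (_ / w b)]mulrA cauchy_weight E2.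
have mE : mix (v a) (w b) = v a + q * w b by rewrite /mix /q; ring.
have m0 := vwm a b; have z0 := w0 b; rewrite !invfM.
clearbody q; move: (\prod_(_ < n.+1) _) W0 ((-1) ^+ n) => W W0 e.
have B0 : \prod_(c < n) (w b - w (lift b c)) != 0.
  by apply/prodf_neq0 => c _; apply: lift_neqf.
rewrite mE in m0 *; move: B0; move: (\prod_(c < n) (w b - w (lift b c))) (\prod_(_ < n) _) => B P B0.
by move: (w b) (v a) z0 v0 m0 => z x z0 x0 m0; field; rewrite x0 z0 W0 m0 B0.
Qed.

(** Interpolate the difference of the two monic polynomials with roots [(v j)^-1] and [w
    j]: its degree has dropped, and its values at the nodes [w] and at 0 are explicit
    products. *)
Lemma sum_weight_inv : (forall a, v a != 0) -> (forall b, w b != 0) ->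
  \sum_(b < n.+1) weight b / w b =
  (-1) ^+ n * (1 - (\prod_a v a) * \prod_b w b) / \prod_b w b.
Proof.
move=> v0 w0.
pose A : {poly F} := \prod_(j < n.+1) ('X - ((v j)^-1)%:P).
pose B : {poly F} := \prod_(j < n.+1) ('X - (w j)%:P).
have szA : size A = n.+2 by rewrite size_prod_XsubC /index_enum -enumT size_enum_ord.
have szB : size B = n.+2 by rewrite size_prod_XsubC /index_enum -enumT size_enum_ord.
have sz : (size (A - B)%R <= n.+1)%N.
  apply/leq_sizeP => j; rewrite leq_eqVlt => /predU1P[<-|nj].
    have : lead_coef A = lead_coef B by rewrite !(monicP (monic_prod_XsubC _ _ _)).
    by rewrite !lead_coefE szA szB /= coefB => ->; rewrite subrr.
  by rewrite coefB !nth_default ?subrr ?szA ?szB.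
have hA x : A.[x] = \prod_(j < n.+1) (x - (v j)^-1).
  by rewrite horner_prod; apply: eq_bigr => j _; rewrite hornerXsubC.
have hB x : B.[x] = \prod_(j < n.+1) (x - w j).
  by rewrite horner_prod; apply: eq_bigr => j _; rewrite hornerXsubC.
have V0 : \prod_a v a != 0 by apply/prodf_neq0.
have W0 : \prod_a w a != 0 by apply/prodf_neq0.
have E0 : (A - B).[0] = (-1) ^+ n.+1 * ((\prod_a v a)^-1 - \prod_a w a).
  rewrite hornerD hornerN hA hB mulrBr -prodfV -!prodMl_const.
  by congr (_ - _); apply: eq_bigr => j _; rewrite sub0r mulN1r.
have Eb b : (A - B).[w b] = (-1) ^+ n.+1 * (\prod_j (1 - v j * w b)) / \prod_a v a.
  rewrite hornerD hornerN hA hB [X in _ - X](bigD1 b) //= subrr mul0r subr0.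
  rewrite -prodfV -prodMl_const -big_split /=; apply: eq_bigr => j _.
  by field.
have := lagrange 0 wI sz; rewrite E0.
under [X in _ = X]eq_bigr => b _ do rewrite Eb prod_lagrange0 //.
move=> E.
have -> : \sum_(b < n.+1) weight b / w b = (-1) ^+ n * (-1) ^+ n.+1 * (\prod_a v a) / (\prod_b w b) *
   ((-1) ^+ n.+1 * ((\prod_a v a)^-1 - \prod_a w a)).
  rewrite E big_distrr /=; apply: eq_bigr => b _; rewrite /weight.
  rewrite -[LHS](signrMK n) -[LHS](signrMK n.+1) invfM.
  have : \prod_(c < n) (w b - w (lift b c)) != 0.
    by apply/prodf_neq0 => c _; apply: lift_neqf.
  move: ((-1) ^+ n) ((-1) ^+ n.+1) (\prod_(_ < n.+1) _) (\prod_(_ < n) _) => e f P Q Q0.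
  move: (\prod_(_ < n.+1) v _) V0 => V V0; move: (\prod_(_ < n.+1) w _) W0 => W W0.
  by field; rewrite Q0 w0 V0 W0.
rewrite -[RHS](signrMK n.+1).
move: ((-1) ^+ n) ((-1) ^+ n.+1) => e f.
move: (\prod_(_ < n.+1) v _) V0 => V V0; move: (\prod_(_ < n.+1) w _) W0 => W W0.
by field; rewrite ?V0 ?W0.
Qed.
End Residues.

(** If the matrix maps [V] to [c], then its adjugate maps [c] to the determinant times
    [V]. *)
Lemma adj_apply n (M : 'M[F]_n) (V c : 'I_n -> F) b :
  (forall a, \sum_b M a b * V b = c a) ->
  \sum_a c a * cofactor M a b = \det M * V b.
Proof.
move=> Vc; have <- : (\adj M *m (M *m \col_b V b)) b ord0 = \det M * V b.
  by rewrite mulmxA mul_adj_mx mul_scalar_mx !mxE.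
rewrite mxE; apply: eq_bigr => a _.
by rewrite -Vc !mxE mulrC; congr (_ * _); apply: eq_bigr => k _; rewrite mxE.
Qed.

Lemma cofactor_tr n (M : 'M[F]_n) i j : cofactor M^T i j = cofactor M j i.
Proof.
rewrite /cofactor addnC -[X in _ = _ * X]det_tr; congr (_ * \det _).
by apply/matrixP => k l; rewrite !mxE.
Qed.

Section Recursion.
Variables (n : nat) (v w : 'I_n.+1 -> F).
Hypotheses (vw1 : forall i j, 1 - v i * w j != 0) (vwm : forall i j, mix (v i) (w j) != 0)
  (vI : injective v) (wI : injective w) (v0 : forall i, v i != 0) (w0 : forall i, w i != 0)
  (vD : forall i, 1 - 2 * D * v i != 0) (wD : forall i, 1 - 2 * D * w i != 0).

Let M := \matrix_(i < n.+1, j < n.+1) cauchy (v i) (w j).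

(** Splitting [mix (v a) (w b) / (v a * w b)] as [(1 - 2 D v a) / v a + 1 / w b]
    separates the double sum into two parts. In each of them one of the sums against the
    cofactors collapses by [adj_apply] to the determinant times a weight; the remaining
    single sums cancel by [sum_cauchy_weight_inv], except for the boundary term, which
    [sum_weight_inv] evaluates. *)
Lemma det_cauchy_cofactor :
  (1 - (\prod_i v i) * \prod_i w i) * \det M =
  \sum_a \sum_b cofactor M a b * ((\prod_i v i) / v a * alpha v w a)
     * ((\prod_i w i) / w b * alpha w v b) * mix (v a) (w b).
Proof.
have wv1 i j : 1 - w i * v j != 0 by rewrite mulrC.
have wvm i j : mix (w i) (v j) != 0 by rewrite mixC.
have Ea b : \sum_a alpha v w a * cofactor M a b = \det M * ((-1) ^+ n * weight v w b).
  apply: (@adj_apply _ M (fun b => (-1) ^+ n * weight v w b) (alpha v w)) => a; rewrite -[RHS](signrMK n) -(sum_cauchy_weight vw1 vwm wI (vD a)).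
  by rewrite big_distrr /=; apply: eq_bigr => c _; rewrite mxE; ring.
have Eb a : \sum_b alpha w v b * cofactor M a b = \det M * ((-1) ^+ n * weight w v a).
  under eq_bigr do rewrite -cofactor_tr; rewrite -det_tr.
  apply: (@adj_apply _ M^T (fun a => (-1) ^+ n * weight w v a) (alpha w v)) => b; rewrite -[RHS](signrMK n) -(sum_cauchy_weight wv1 wvm vI (wD b)).
  by rewrite big_distrr /=; apply: eq_bigr => c _; rewrite !mxE cauchyC; ring.
have V0 : \prod_a v a != 0 by apply/prodf_neq0.
have W0 : \prod_a w a != 0 by apply/prodf_neq0.
(* The first of the two parts of [mix (v a) (w b) / (v a * w b)]. *)
pose p a := (1 - 2 * D * v a) / v a.
set c := (\prod_i v i) * (\prod_i w i).
transitivity (\sum_a \sum_b (c * (alpha v w a * p a * (alpha w v b * cofactor M a b)) +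
    c * (alpha w v b / w b * (alpha v w a * cofactor M a b)))); last first.
  apply: eq_bigr => a _; apply: eq_bigr => b _; rewrite /c /p /mix.
  move: (\prod_i v i) (\prod_i w i) (alpha _ _ _) (alpha _ _ _) (cofactor _ _ _) => V W ? ? ?.
  by field; rewrite v0 w0.
under eq_bigr do rewrite big_split /=; rewrite big_split /= [X in _ = _ + X]exchange_big /=.
under eq_bigr => a _ do rewrite -!big_distrr /= Eb.
under [X in _ = _ + X]eq_bigr => b _ do rewrite -!big_distrr /= Ea.
have Ep a : alpha v w a * p a = (v a * \prod_(b < n.+1) w b)^-1
    - (-1) ^+ n * \sum_(b < n.+1) cauchy (v a) (w b) * (weight v w b / w b).
  by rewrite -sum_cauchy_weight_inv.
under eq_bigr => a _ do rewrite Ep.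
have Ew b : alpha w v b = (-1) ^+ n * \sum_a cauchy (v a) (w b) * weight w v a.
  rewrite -[LHS](signrMK n) -(sum_cauchy_weight wv1 wvm vI (wD b)).
  by congr (_ * _); apply: eq_bigr => a _; rewrite cauchyC.
have Ex : \sum_b alpha w v b / w b * weight v w b =
    (-1) ^+ n * \sum_a weight w v a * \sum_b cauchy (v a) (w b) * (weight v w b / w b).
  under [in RHS]eq_bigr do rewrite big_distrr /=.
  rewrite [in RHS]exchange_big big_distrr /=; apply: eq_bigr => b _.
  have assoc (e S x y : F) : e * S * x * y = e * (S * (y * x)) by ring.
  rewrite Ew assoc; congr (_ * _); rewrite big_distrl /=; apply: eq_bigr => a _.
  by ring.
have Es := sum_weight_inv vI w0 v0.
transitivity (c * \det M * (-1) ^+ n * (\sum_a (v a * \prod_b w b)^-1 * weight w v a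
  - (-1) ^+ n * \sum_a weight w v a * (\sum_b cauchy (v a) (w b) * (weight v w b / w b)) +
  \sum_b alpha w v b / w b * weight v w b)); last first.
  rewrite mulrDr; congr (_ + _).
    rewrite [X in _ - X]big_distrr -sumrB big_distrr /=.
    apply: eq_bigr => a _; move: (\sum_b _) (\prod_b w b) ((-1) ^+ n) (weight _ _ _) => S W e U.
    by ring.
  rewrite big_distrr /=; apply: eq_bigr => b _.
  by move: ((-1) ^+ n) (weight _ _ _) => e U; ring.
rewrite Ex subrK.
have -> : \sum_a (v a * \prod_b w b)^-1 * weight w v a =
   (\prod_b w b)^-1 * \sum_a weight w v a / v a.
  by rewrite big_distrr /=; apply: eq_bigr => a _; rewrite invfM; ring.
rewrite Es /c -[LHS](signrMK n).
move: (\prod_i v i) (\prod_i w i) V0 W0 ((-1) ^+ n) => V W V0 W0 e.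
by field; rewrite V0 W0.
Qed.
End Recursion.

(** The coefficient with which the root [v a] enters when it is attached to the
    left-most particle, once the other particles are measured from the site to its
    right; see [Phi_cone_cons]. *)
Definition lead n (v : 'I_n.+1 -> F) (a : 'I_n.+1) : F :=
  (-1) ^+ a * \prod_(j < n) (v (lift a j) * scat (v a) (v (lift a j))).

(** The sum of [Phi v z * Phi w z] over all [0 <= z_1 < ... < z_n], in closed form: the
    position of the left-most particle gives a geometric series of ratio [(\prod v) *
    (\prod w)], and the remaining particles are summed recursively. *)
Fixpoint pairing n : ('I_n -> F) -> ('I_n -> F) -> F :=
  match n with
  | 0 => fun _ _ => 1
  | m.+1 => fun v w => (1 - (\prod_i v i) * \prod_i w i)^-1 *
      \sum_a \sum_b lead v a * lead w b * pairing (v \o lift a) (w \o lift b)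
  end.

Definition ik_det n (v w : 'I_n -> F) : F :=
  (\prod_i \prod_j mix (v i) (w j)) * \det (\matrix_(i < n, j < n) cauchy (v i) (w j)).

(** This is [det_cauchy_cofactor] with the products of [mix] redistributed among the
    minors; it is the recursion that defines [pairing]. *)
Lemma ik_det_rec n (v w : 'I_n.+1 -> F) :
    (forall i j, 1 - v i * w j != 0) -> (forall i j, mix (v i) (w j) != 0) ->
    injective v -> injective w -> (forall i, v i != 0) -> (forall i, w i != 0) ->
    (forall i, 1 - 2 * D * v i != 0) -> (forall i, 1 - 2 * D * w i != 0) ->
  (1 - (\prod_i v i) * \prod_i w i) * ik_det v w =
  \sum_a \sum_b lead v a * lead w b * ik_det (v \o lift a) (w \o lift b).
Proof.
move=> vw1 vwm vI wI v0 w0 vD wD.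
rewrite /ik_det mulrCA det_cauchy_cofactor // big_distrr /=; apply: eq_bigr => a _.
rewrite big_distrr /=; apply: eq_bigr => b _.
have -> : cofactor (\matrix_(i < n.+1, j < n.+1) cauchy (v i) (w j)) a b =
    (-1) ^+ a * (-1) ^+ b *
    \det (\matrix_(i < n, j < n) cauchy ((v \o lift a) i) ((w \o lift b) j)).
  rewrite /cofactor exprD; congr (_ * \det _).
  by apply/matrixP => i j; rewrite !mxE.
have -> : \prod_i \prod_j mix (v i) (w j) = (\prod_j mix (v a) (w j)) *
   (\prod_i mix (v (lift a i)) (w b)) *
   (\prod_i \prod_j mix ((v \o lift a) i) ((w \o lift b) j)).
  rewrite (prod_lift _ a) -mulrA -big_split /=; congr (_ * _).
  by apply: eq_bigr => i _; rewrite (prod_lift _ b).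
rewrite /lead /alpha !big_split /= (prod_lift v a) (prod_lift w b).
rewrite (prod_lift (fun k => mix (v a) (w k)) b).
rewrite (prod_lift (fun k => mix (w b) (v k)) a) (mixC (w b)).
have -> : \prod_(c < n) mix (w b) (v (lift a c)) = \prod_(c < n) mix (v (lift a c)) (w b).
  by apply: eq_bigr => c _; rewrite mixC.
have : \prod_(i < n) mix (v a) (w (lift b i)) != 0 by apply/prodf_neq0.
have : \prod_(i < n) mix (v (lift a i)) (w b) != 0 by apply/prodf_neq0.
have := vwm a b; have := v0 a; have := w0 b.
move: (\det _) => d.
move: (\prod_(i < n) mix (v (lift a i)) (w b)) (\prod_(i < n) mix (v a) (w (lift b i))) => X Y.
move: (\prod_(i < n) \prod_(j < n) mix ((v \o lift a) i) ((w \o lift b) j)) => Z.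
move: (\prod_(_ < n) _) => P1.
move: (\prod_(_ < n) _) => P2.
move: (\prod_(_ < n) _) => P3.
move: (\prod_(_ < n) _) => P4.
move: (mix _ _) => m; move: (v a) (w b) ((-1) ^+ a) ((-1) ^+ b) => x y e f y0 x0 m0 X0 Y0.
by field; rewrite ?x0 ?y0 ?m0 ?X0 ?Y0.
Qed.

Lemma pairing_det n (v w : 'I_n -> F) :
    (forall k (f g : 'I_k.+1 -> 'I_n), 1 - (\prod_i v (f i)) * \prod_i w (g i) != 0) ->
    (forall i j, mix (v i) (w j) != 0) ->
    injective v -> injective w -> (forall i, v i != 0) -> (forall i, w i != 0) ->
    (forall i, 1 - 2 * D * v i != 0) -> (forall i, 1 - 2 * D * w i != 0) ->
  pairing v w = ik_det v w.
Proof.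
elim: n v w => [|n IH] v w vw1 vwm vI wI v0 w0 vD wD.
  by rewrite /ik_det big_ord0 det_mx00 mulr1.
apply: (mulfI (vw1 _ id id)); rewrite ik_det_rec //; last first.
  by move=> i j; have := vw1 0%N (fun=> i) (fun=> j); rewrite !big_ord1.
rewrite /= mulVKf ?(vw1 _ id id) //; apply: eq_bigr => a _; apply: eq_bigr => b _.
congr (_ * _); apply: IH => [k f g|i j|i j /= /vI/lift_inj //|i j /= /wI/lift_inj //|i|i|i|i].
- exact: (vw1 _ (lift a \o f) (lift b \o g)).
- exact: vwm.
- exact: v0.
- exact: w0.
- exact: vD.
- exact: wD.
Qed.
End DetRecursion.

(** * The real-valued modulus of a complex number *)

Section Modulus.
Variable K : realType.
Local Notation C := K[i].
Implicit Types (z w : C) (a b : K).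

(** The norm of [K[i]] takes values in [K[i]]; estimates are easier with its real part,
    to which the real arithmetic tactics apply. *)
Definition cabs z : K := complex.Re `|z|.

Lemma cabsE z : `|z| = (cabs z)%:C.
Proof. by rewrite /cabs normc_def. Qed.

Lemma cabs_def z : cabs z = Num.sqrt (complex.Re z ^+ 2 + complex.Im z ^+ 2).
Proof. by rewrite /cabs normc_def. Qed.

Lemma cabs_ge0 z : 0 <= cabs z. Proof. by rewrite cabs_def sqrtr_ge0. Qed.

Lemma cabs0 : cabs 0 = 0 :> K. Proof. by rewrite /cabs normr0. Qed.

Lemma cabs1 : cabs 1 = 1 :> K. Proof. by rewrite /cabs normr1. Qed.

Lemma cabsM z w : cabs (z * w) = cabs z * cabs w.
Proof. by apply: complexI; rewrite rmorphM /= -!cabsE normrM. Qed.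

Lemma cabsN z : cabs (- z) = cabs z. Proof. by rewrite /cabs normrN. Qed.

Lemma cabsB z w : cabs (z - w) = cabs (w - z). Proof. by rewrite /cabs distrC. Qed.

Lemma cabs_eq0 z : (cabs z == 0) = (z == 0).
Proof. by rewrite -(inj_eq (@complexI _)) -cabsE normr_eq0. Qed.

Lemma cabsD z w : cabs (z + w) <= cabs z + cabs w.
Proof. by rewrite -lecR rmorphD /= -!cabsE ler_normD. Qed.

Lemma cabsV z : cabs z^-1 = (cabs z)^-1.
Proof. by apply: complexI; rewrite fmorphV /= -!cabsE normfV. Qed.

Lemma cabsX z n : cabs (z ^+ n) = cabs z ^+ n.
Proof. by apply: complexI; rewrite rmorphXn /= -!cabsE normrX. Qed.

Lemma cabsXz z (n : int) : cabs (z ^ n) = cabs z ^ n.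
Proof. by case: n => n; rewrite ?NegzE -?exprnP -?exprnN ?cabsV cabsX. Qed.

Lemma cabs_real a : cabs a%:C = `|a|.
Proof. by rewrite cabs_def /= expr0n addr0 sqrtr_sqr. Qed.

Lemma cabs_nat n : cabs n%:R = n%:R.
Proof. by rewrite -[n%:R](rmorph_nat (real_complex K)) cabs_real ger0_norm. Qed.

Lemma cabs_i : cabs 'i%C = 1.
Proof. by rewrite cabs_def /= expr0n add0r expr1n sqrtr1. Qed.

Lemma cabs_sum I (s : seq I) (P : pred I) (f : I -> C) :
  cabs (\sum_(i <- s | P i) f i) <= \sum_(i <- s | P i) cabs (f i).
Proof.
elim/big_rec2: _ => [|i x y _ IH]; first by rewrite cabs0.
by apply: le_trans (cabsD _ _) _; rewrite lerD2l.
Qed.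

Lemma cabs_prod I (s : seq I) (P : pred I) (f : I -> C) :
  cabs (\prod_(i <- s | P i) f i) = \prod_(i <- s | P i) cabs (f i).
Proof. by apply: (big_morph cabs cabsM cabs1). Qed.

Lemma Re_le_cabs z : `|complex.Re z| <= cabs z.
Proof. by rewrite cabs_def -sqrtr_sqr ler_wsqrtr // lerDl sqr_ge0. Qed.

Lemma Im_le_cabs z : `|complex.Im z| <= cabs z.
Proof. by rewrite cabs_def -sqrtr_sqr ler_wsqrtr // lerDr sqr_ge0. Qed.

Lemma cabs_le_parts z : cabs z <= `|complex.Re z| + `|complex.Im z|.
Proof.
case: z => a b /=; have := cabsD a%:C ('i%C * b%:C).
rewrite cabsM cabs_i mul1r !cabs_real; congr (cabs _ <= _).
by rewrite [RHS]complexE.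
Qed.

Lemma cabs_conj z : cabs z^*%C = cabs z.
Proof. by rewrite /cabs normcJ. Qed.

Lemma sqnormE z : sqnorm z = cabs z ^+ 2.
Proof. by rewrite cabs_def sqr_sqrtr // addr_ge0 // sqr_ge0. Qed.

Lemma sqnorm_conj z : (sqnorm z)%:C = z * z^*%C.
Proof. by rewrite sqnormE rmorphXn /= -cabsE sqr_normc. Qed.

End Modulus.

(** * Integrals over a circle *)

Section CircleIntegrals.
Variable K : realType.
Local Notation C := K[i].
Local Notation mu := (@lebesgue_measure K).
Implicit Types (z w : C) (f g : K -> C) (h : C -> C).

Lemma cexpD z w : cexp (z + w) = cexp z * cexp w.
Proof.
case: z w => [a b] [c d]; rewrite /cexp /= expRD cosD sinD; simpc.
by congr (_ +i* _); ring.
Qed.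

Lemma cexp0 : cexp 0 = 1 :> C.
Proof. by rewrite /cexp /= expR0 cos0 sin0 mul1r. Qed.

Lemma cexp_imE (s : K) : cexp ('i%C * s%:C) = cos s +i* sin s.
Proof. by rewrite /cexp /=; simpc; rewrite expR0; simpc. Qed.

Lemma cabs_cexp_im (s : K) : cabs (cexp ('i%C * s%:C)) = 1.
Proof. by rewrite cexp_imE cabs_def /= cos2Dsin2 sqrtr1. Qed.

Lemma cexp_im_exprz (s : K) (k : int) :
  cexp ('i%C * s%:C) ^ k = cexp ('i%C * (k%:~R * s)%:C).
Proof.
have E (n : nat) : cexp ('i%C * s%:C) ^+ n = cexp ('i%C * (n%:R * s)%:C).
  elim: n => [|n IH]; first by rewrite mul0r mulr0 cexp0.
  by rewrite exprSr IH -cexpD -mulrDr -rmorphD /= -[in RHS]natr1 mulrDl mul1r.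
case: k => n; first by rewrite -exprnP E.
rewrite NegzE -exprnN E; apply: (mulfI (_ : cexp ('i%C * (n.+1%:R * s)%:C) != 0)).
  by rewrite -cabs_eq0 cabs_cexp_im oner_eq0.
rewrite mulfV; last by rewrite -cabs_eq0 cabs_cexp_im oner_eq0.
by rewrite -cexpD -mulrDr -rmorphD /= rmorphN mulNr subrr mulr0 cexp0.
Qed.

Definition circle_point (r s : K) : C := r%:C * cexp ('i%C * s%:C).

Lemma cabs_circle_point r s : 0 < r -> cabs (circle_point r s) = r.
Proof. by move=> r0; rewrite cabsM cabs_cexp_im mulr1 cabs_real gtr0_norm. Qed.

(** Continuity by components, which is what the definition of [cintegral] asks for. *)
Definition ccontinuous f :=
  continuous (fun s => complex.Re (f s) : K^o) /\ continuous (fun s => complex.Im (f s) : K^o).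

Lemma ccontinuousP f : ccontinuous f <->
  forall s e, 0 < e -> \forall s' \near s, cabs (f s - f s') <= e.
Proof.
split=> [[cr ci] s e e0|h].
  have e2 : 0 < e / 2 by rewrite divr_gt0.
  have /cvgrPdist_le /(_ _ e2) Hr := cr s; have /cvgrPdist_le /(_ _ e2) Hi := ci s.
  near=> s'.
  have hr : `|complex.Re (f s) - complex.Re (f s')| <= e / 2 by near: s'.
  have hi : `|complex.Im (f s) - complex.Im (f s')| <= e / 2 by near: s'.
  apply: le_trans (cabs_le_parts _) _; rewrite !raddfB /= in hr hi *.
  by lra.
split=> s; apply/cvgrPdist_le => e e0; near=> s';
  have hs : cabs (f s - f s') <= e by near: s'; apply: h.
- by apply: le_trans hs; apply: le_trans (Re_le_cabs _); rewrite raddfB.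
- by apply: le_trans hs; apply: le_trans (Im_le_cabs _); rewrite raddfB.
Unshelve. all: by end_near. Qed.

Lemma ccontinuous_cst (c : C) : ccontinuous (fun=> c).
Proof. by split=> s; apply: cvg_cst. Qed.

Lemma ccontinuousD f g : ccontinuous f -> ccontinuous g -> ccontinuous (fun s => f s + g s).
Proof.
move=> [fr fi] [gr gi]; split=> s.
  rewrite (_ : (fun _ => _) = (fun s => complex.Re (f s)) \+ (fun s => complex.Re (g s))).
    by apply: cvgD; [exact: fr|exact: gr].
  by apply/funext => u /=; rewrite raddfD.
rewrite (_ : (fun _ => _) = (fun s => complex.Im (f s)) \+ (fun s => complex.Im (g s))).
  by apply: cvgD; [exact: fi|exact: gi].
by apply/funext => u /=; rewrite raddfD.
Qed.

Lemma Re_mulc z w : complex.Re (z * w) = complex.Re z * complex.Re w - complex.Im z * complex.Im w.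
Proof. by case: z w => [? ?] [? ?]. Qed.

Lemma Im_mulc z w : complex.Im (z * w) = complex.Re z * complex.Im w + complex.Im z * complex.Re w.
Proof. by case: z w => [? ?] [? ?]. Qed.

Lemma ccontinuousM f g : ccontinuous f -> ccontinuous g -> ccontinuous (fun s => f s * g s).
Proof.
move=> [fr fi] [gr gi]; split=> s.
  rewrite (_ : (fun _ => _) = ((fun s => complex.Re (f s)) \* (fun s => complex.Re (g s)))
    \- ((fun s => complex.Im (f s)) \* (fun s => complex.Im (g s)))).
    by apply: cvgB; apply: cvgM; [exact: fr|exact: gr|exact: fi|exact: gi].
  by apply/funext => u /=; rewrite Re_mulc.
rewrite (_ : (fun _ => _) = ((fun s => complex.Re (f s)) \* (fun s => complex.Im (g s)))
    \+ ((fun s => complex.Im (f s)) \* (fun s => complex.Re (g s)))).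
  by apply: cvgD; apply: cvgM; [exact: fr|exact: gi|exact: fi|exact: gr].
by apply/funext => u /=; rewrite Im_mulc.
Qed.

(** Uniform limits of continuous functions are continuous; this makes the inner contour
    integrals continuous in the outer variable. *)
Lemma ccontinuous_uniform f :
  (forall e, 0 < e -> exists2 g, ccontinuous g & forall s, cabs (f s - g s) <= e) ->
  ccontinuous f.
Proof.
move=> h; apply/ccontinuousP => s e e0.
have e3 : 0 < e / 3 by rewrite divr_gt0.
have [g /ccontinuousP cg fg] := h _ e3.
near=> s'.
have g3 : cabs (g s - g s') <= e / 3 by near: s'; apply: cg.
have A := fg s; have B := fg s'; rewrite cabsB in B.
have -> : f s - f s' = (f s - g s) + (g s - g s') + (g s' - f s') by ring.
apply: le_trans (cabsD _ _) _; have T := cabsD (f s - g s) (g s - g s').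
by lra.
Unshelve. all: by end_near. Qed.

Lemma ccontinuous_cexp_im (k : K) : ccontinuous (fun s => cexp ('i%C * (k * s)%:C)).
Proof.
have ck : continuous (fun s : K => k * s).
  by move=> s; apply: cvgM; [apply: cvg_cst|apply: cvg_id].
split=> s.
  rewrite (_ : (fun _ => _) = cos \o (fun s => k * s)); last first.
    by apply/funext => u; rewrite cexp_imE.
  by apply: continuous_comp; [exact: ck|exact: continuous_cos].
rewrite (_ : (fun _ => _) = sin \o (fun s => k * s)); last first.
  by apply/funext => u; rewrite cexp_imE.
by apply: continuous_comp; [exact: ck|exact: continuous_sin].
Qed.

Lemma circle_point_exprz r s (k : int) : r != 0 ->
  circle_point r s ^ k = (r ^ k)%:C * cexp ('i%C * (k%:~R * s)%:C).
Proof.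
move=> r0; rewrite /circle_point exprzMl ?cexp_im_exprz; last first.
- by rewrite unitfE -cabs_eq0 cabs_cexp_im oner_eq0.
- by rewrite unitfE -cabs_eq0 cabs_real normr_eq0.
by congr (_ * _); case: k => n; rewrite ?NegzE -?exprnP -?exprnN ?fmorphV rmorphXn.
Qed.

Lemma integrable_ccontinuous f : ccontinuous f ->
  mu.-integrable `[0, 2 * pi] (EFin \o (fun s => complex.Re (f s))) /\
  mu.-integrable `[0, 2 * pi] (EFin \o (fun s => complex.Im (f s))).
Proof.
move=> [fr fi]; split; apply: continuous_compact_integrable; do ?exact: segment_compact;
  exact: continuous_subspaceT.
Qed.

Let cint f := cintegral 0 (2 * pi) f.

Lemma cintegralD f g : ccontinuous f -> ccontinuous g ->
  cint (fun s => f s + g s) = cint f + cint g.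
Proof.
move=> /integrable_ccontinuous[fr fi] /integrable_ccontinuous[gr gi].
rewrite /cint /cintegral; simpc; congr (_ +i* _); rewrite -RintegralD //;
  by apply: eq_Rintegral => s _; rewrite raddfD.
Qed.

Lemma cintegralZ (c : C) f : ccontinuous f -> cint (fun s => c * f s) = c * cint f.
Proof.
move=> /integrable_ccontinuous[fr fi].
have S (a b : K) (u v : K -> K) : mu.-integrable `[0, 2 * pi] (EFin \o u) ->
    mu.-integrable `[0, 2 * pi] (EFin \o v) ->
    \int[mu]_(s in `[0, 2 * pi]) (a * u s + b * v s) =
    a * \int[mu]_(s in `[0, 2 * pi]) u s + b * \int[mu]_(s in `[0, 2 * pi]) v s.
  move=> iu iv; rewrite -!RintegralZl // RintegralD //.
    have -> : EFin \o (fun x => a * u x) = (fun x => a%:E * (EFin \o u) x)%E by apply/funext.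
    exact: integrableZl.
  have -> : EFin \o (fun x => b * v x) = (fun x => b%:E * (EFin \o v) x)%E by apply/funext.
  exact: integrableZl.
rewrite /cint /cintegral; apply/eqP; rewrite eq_complex Re_mulc Im_mulc /= -mulNr -!S //.
apply/andP; split; apply/eqP; apply: eq_Rintegral => s _; first by rewrite Re_mulc mulNr.
by rewrite Im_mulc.
Qed.

(** The constant is 4 pi, twice the optimal one, because the real and imaginary parts
    are bounded separately; only finiteness of the bound matters later. *)
Lemma cabs_cintegral f (M : K) : ccontinuous f -> (forall s, cabs (f s) <= M) ->
  cabs (cint f) <= 4 * pi * M.
Proof.
move=> /integrable_ccontinuous[fr fi] fM.
have B (u : K -> K) : mu.-integrable `[0, 2 * pi] (EFin \o u) -> (forall s, `|u s| <= M) ->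
    `|\int[mu]_(s in `[0, 2 * pi]) u s| <= 2 * pi * M.
  move=> iu uM; apply: le_trans (le_normr_Rintegral _ iu) _ => //.
  have im : mu.-integrable `[0, 2 * pi] (EFin \o (fun=> M)).
    apply: continuous_compact_integrable; first exact: segment_compact.
    by apply: continuous_subspaceT => ?; apply: cvg_cst.
  have mD : measurable (`[0, 2 * pi] : set (measurableTypeR K)) by [].
  apply: le_trans (le_Rintegral mD (integrable_norm iu) im (fun s _ => uM s)) _.
  rewrite Rintegral_cst //= lebesgue_measure_itv /= lte_fin.
  by rewrite mulr_gt0 ?pi_gt0 //= subr0 mulrC.
apply: le_trans (cabs_le_parts _) _ => /=.
have := B _ fr (fun s => le_trans (Re_le_cabs _) (fM s)).
have := B _ fi (fun s => le_trans (Im_le_cabs _) (fM s)).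
move=> Bi Br; apply: le_trans (lerD Br Bi) _.
by rewrite le_eqVlt; apply/orP; left; apply/eqP; ring.
Qed.

(** The single integral computed by the fundamental theorem of calculus; every contour
    integral below is reduced to it. *)
Lemma cintegral_mode (m : int) :
  cint (fun s => cexp ('i%C * (m%:~R * s)%:C)) = (if m == 0 then 2 * pi else 0)%:C.
Proof.
have [->|m0] := eqVneq m 0.
  rewrite /cint (_ : (fun _ => _) = fun=> 1); last first.
    by apply/funext => s; rewrite mul0r mulr0 cexp0.
  have I (c : K) : \int[mu]_(s in `[0, 2 * pi]) c = c * (2 * pi).
    rewrite Rintegral_cst //= lebesgue_measure_itv /= lte_fin.
    by rewrite mulr_gt0 ?pi_gt0 //= subr0.
  by rewrite /cintegral !I mul1r mul0r.
have p2 : 0 < 2 * pi :> K by rewrite mulr_gt0 ?pi_gt0.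
have mR : m%:~R != 0 :> K by rewrite intr_eq0.
have s2pi (n : nat) : sin (n%:R * (2 * pi)) = 0 :> K /\ cos (n%:R * (2 * pi)) = 1 :> K.
  rewrite (_ : 2 * pi = pi *+ 2); last by rewrite mulr_natl.
  elim: n => [|n [IHs IHc]]; first by rewrite mul0r sin0 cos0.
  by rewrite -natr1 mulrDl mul1r sinD2pi cosD2pi.
have s2 : sin (m%:~R * (2 * pi)) = 0 :> K /\ cos (m%:~R * (2 * pi)) = 1 :> K.
  case: (m) => n; first exact: s2pi.
  by rewrite NegzE rmorphN mulNr sinN cosN; have [-> ->] := s2pi n.+1; rewrite oppr0.
have FTC (G g : K -> K) : (forall s : K, is_derive s (1 : K) G (g s)) -> continuous g ->
   \int[mu]_(s in `[0, 2 * pi]) g s = G (2 * pi) - G 0.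
  move=> dG cg; rewrite /Rintegral (@continuous_FTC2 _ g G _ _ p2) ?fineB //=.
  - exact: continuous_subspaceT.
  - have cG (s : K) : {for s, continuous G}.
      by apply: differentiable_continuous; apply/derivable1_diffP; apply: (@ex_derive _ _ _ _ _ _ _ (dG s)).
    split=> [s _||]; first exact: (@ex_derive _ _ _ _ _ _ _ (dG s)).
      by apply: cvg_at_right_filter; exact: cG.
    by apply: cvg_at_left_filter; exact: cG.
  - by move=> s _; rewrite derive1E (@derive_val _ _ _ _ _ _ _ (dG s)).
have [cr ci] := ccontinuous_cexp_im m%:~R.
rewrite /cint /cintegral.
have Ds (s : K) : is_derive s (1 : K) (fun s => m%:~R^-1 * sin (m%:~R * s))
    (complex.Re (cexp ('i%C * (m%:~R * s)%:C))).
  rewrite cexp_imE /=; apply: is_derive_eq.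
  by rewrite /GRing.scale /=; field.
have Dc (s : K) : is_derive s (1 : K) (fun s => - (m%:~R^-1 * cos (m%:~R * s)))
    (complex.Im (cexp ('i%C * (m%:~R * s)%:C))).
  rewrite cexp_imE /=; apply: is_derive_eq.
  by rewrite /GRing.scale /=; field.
rewrite (FTC _ _ Ds cr) (FTC _ _ Dc ci).
by have [-> ->] := s2; rewrite !mulr0 sin0 cos0; congr (_ +i* _); ring.
Qed.

Section Circle.
Variable r : K.
Hypothesis r_gt0 : 0 < r.

Definition on_circle_continuous h := ccontinuous (fun s => h (circle_point r s)).

Let vel (s : K) : C := 'i%C * r%:C * cexp ('i%C * s%:C).

Let cvel : ccontinuous vel.
Proof.
apply: ccontinuousM; first exact: ccontinuous_cst.
rewrite (_ : (fun _ => _) = (fun s => cexp ('i%C * (1 * s)%:C))); first exact: ccontinuous_cexp_im.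
by apply/funext => s; rewrite mul1r.
Qed.

Lemma circle_intE h : circle_int r h =
  (2 * pi%:C * 'i%C)^-1 * cint (fun s => h (circle_point r s) * vel s).
Proof. by []. Qed.

Lemma eq_circle_int h1 h2 : (forall z, cabs z = r -> h1 z = h2 z) ->
  circle_int r h1 = circle_int r h2.
Proof.
move=> h12; rewrite !circle_intE; congr (_ * cint _); apply/funext => s.
by rewrite h12 // cabs_circle_point.
Qed.

Lemma circle_intD h1 h2 : on_circle_continuous h1 -> on_circle_continuous h2 ->
  circle_int r (fun z => h1 z + h2 z) = circle_int r h1 + circle_int r h2.
Proof.
move=> c1 c2; rewrite !circle_intE -mulrDr -cintegralD; do ?exact: (ccontinuousM c1 cvel); do ?exact: (ccontinuousM c2 cvel).
by congr (_ * cint _); apply/funext => s; rewrite mulrDl.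
Qed.

Lemma circle_intZ (c : C) h : on_circle_continuous h ->
  circle_int r (fun z => c * h z) = c * circle_int r h.
Proof.
move=> ch; rewrite !circle_intE [RHS]mulrCA -(cintegralZ c (ccontinuousM ch cvel)).
by congr (_ * cint _); apply/funext => s; rewrite mulrA.
Qed.

Lemma cabs_circle_int h M : on_circle_continuous h ->
  (forall z, cabs z = r -> cabs (h z) <= M) -> cabs (circle_int r h) <= 2 * r * M.
Proof.
move=> ch hM; rewrite circle_intE.
have vM s : cabs (h (circle_point r s) * vel s) <= r * M.
  have -> : vel s = 'i%C * circle_point r s by rewrite /vel -mulrA.
  rewrite cabsM (cabsM 'i%C) cabs_i cabs_circle_point // mul1r mulrC.
  by rewrite ler_pM2l //; apply/hM/cabs_circle_point.
have := cabs_cintegral (ccontinuousM ch cvel) vM.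
rewrite cabsM cabsV !cabsM cabs_i mulr1 cabs_real (cabs_nat _ 2) (gtr0_norm (pi_gt0 _)) => B.
have p0 := pi_gt0 K; rewrite ler_pdivrMl ?mulr_gt0 //; apply: le_trans B _.
by rewrite le_eqVlt; apply/orP; left; apply/eqP; ring.
Qed.

Lemma on_circle_continuousX (k : int) : on_circle_continuous (fun z => z ^ k).
Proof.
rewrite /on_circle_continuous; rewrite (_ : (fun _ => _) =
  (fun s => (r ^ k)%:C * cexp ('i%C * (k%:~R * s)%:C))).
  by apply: ccontinuousM; [exact: ccontinuous_cst|exact: ccontinuous_cexp_im].
by apply/funext => s; rewrite circle_point_exprz ?gt_eqF.
Qed.

(** The residue of a monomial. Approximation by Laurent polynomials reduces all residue
    computations to this one. *)
Lemma circle_int_exprz (k : int) : circle_int r (fun z => z ^ k) = (k == -1)%:R.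
Proof.
rewrite circle_intE (_ : (fun _ => _) =
  (fun s => ('i%C * (r ^ (k + 1))%:C) * cexp ('i%C * ((k + 1)%:~R * s)%:C))); last first.
  apply/funext => s; have cp0 : circle_point r s != 0.
    by rewrite -cabs_eq0 cabs_circle_point // gt_eqF.
  rewrite -mulrA -circle_point_exprz ?gt_eqF // expfzDr // expr1z.
  by rewrite /vel /circle_point; ring.
rewrite cintegralZ; last exact: ccontinuous_cexp_im.
rewrite cintegral_mode addr_eq0.
have p0 : pi%:C != 0 :> C by rewrite -cabs_eq0 cabs_real normr_eq0 gt_eqF // pi_gt0.
have i0 : 'i%C != 0 :> C by rewrite -cabs_eq0 cabs_i oner_eq0.
case: eqP => [->|_]; last by rewrite !mulr0.
rewrite addNr expr0z mulr1 rmorphM rmorph_nat /= [_ * 'i%C]mulrC.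
by rewrite mulVf // !mulf_neq0 // pnatr_eq0.
Qed.

Lemma on_circle_continuous_cst (c : C) : on_circle_continuous (fun=> c).
Proof. exact: ccontinuous_cst. Qed.

(** A real part is the cosine of at most two angles in a period, so that finitely many
    excluded points correspond to finitely many parameters. *)
Lemma circle_point_finite (B : seq C) : exists S : seq K,
  forall s, s \in `[0, 2 * pi] -> circle_point r s \in B -> s \in S.
Proof.
elim: B => [|z B [S HS]]; first by exists [::].
pose c := acos (complex.Re z / r).
exists (c :: 2 * pi - c :: S) => s sI; rewrite inE => /predU1P[sz|]; last first.
  by move=> /(HS _ sI); rewrite !inE => ->; rewrite !orbT.
have cs : complex.Re z / r = cos s.
  rewrite -sz /circle_point cexp_imE Re_mulc /= mul0r subr0 mulrC mulKf //.
  by rewrite gt_eqF.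
rewrite !inE /c cs; move: sI; rewrite in_itv /= => /andP[s0 s2].
have [sp|ps] := leP s pi.
  by rewrite cosK ?eqxx // in_itv /= s0.
have -> : cos s = cos (2 * pi - s).
  have E : 2 * pi - s = - s + pi *+ 2 by rewrite mulr2n; ring.
  by rewrite E cosD2pi cosN.
have pp := pi_gt0 K.
rewrite cosK; first by rewrite subKr eqxx orbT.
by rewrite in_itv /=; apply/andP; split; lra.
Qed.

(** Two functions that differ at finitely many points of the circle have the same
    integral. Only the second one has to be continuous: the first may be changed
    arbitrarily at the excluded points, which is where a formula with denominators can
    fail. *)
Lemma circle_int_except (B : seq C) h1 h2 : on_circle_continuous h2 ->
  (forall z, cabs z = r -> z \notin B -> h1 z = h2 z) ->
  circle_int r h1 = circle_int r h2.
Proof.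
move=> c2 h12; have [S HS] := circle_point_finite B.
rewrite !circle_intE; congr (_ * _).
set f1 := fun s => _; set f2 := (fun s => h2 _ * _).
have c : ccontinuous f2 by exact: (ccontinuousM c2 cvel).
have f12 s : s \in `[0, 2 * pi] -> s \notin S -> f1 s = f2 s.
  move=> sI sS; rewrite /f1 /f2 h12 // ?cabs_circle_point //.
  by apply: contra sS; exact: HS.
have I (u1 u2 : K -> K) : continuous u2 ->
    (forall s, s \in `[0, 2 * pi] -> s \notin S -> u1 s = u2 s) ->
    \int[mu]_(s in `[0, 2 * pi]) u1 s = \int[mu]_(s in `[0, 2 * pi]) u2 s.
  move=> cu u12.
  (* The two integrands agree off a finite set, but the first one is not known to be
     measurable; [w S] is, and agrees with it on the interval. *)
  pose w (L : seq K) s := if s \in L then u1 s else u2 s.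
  have mw L : measurable_fun setT (w L).
    elim: L => [|a L IH]; first exact: continuous_measurable_fun.
    rewrite (_ : w _ = fun s => if s == a then u1 a else w L s); last first.
      by apply/funext => s; rewrite /w inE; case: eqVneq => [->|].
    by apply: measurable_fun_ifT => //; by apply: measurable_fun_eqr => //; exact: measurable_cst.
  transitivity (\int[mu]_(s in `[0, 2 * pi]) w S s).
    apply: eq_Rintegral => s; rewrite inE /= => sI; rewrite /w.
    by case: ifPn => // /(u12 _ sI).
  rewrite /Rintegral; congr fine; apply: ae_eq_integral => //.
  - by apply/measurable_EFinP; apply: measurable_funTS; exact: mw.
  - by apply/measurable_EFinP; apply: measurable_funTS; exact: continuous_measurable_fun.
  - exists [set` S]; split.
    + by apply: countable_measurable; [move=> ?; exact: measurable_set1|exact/finite_set_countable/finite_seq].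
    + exact/countable_lebesgue_measure0/finite_set_countable/finite_seq.
    + move=> s /= /not_implyP[_ /eqP]; apply: contraTT => sS; rewrite negbK /w.
      by rewrite (negPf sS).
rewrite /cint /cintegral; congr (_ +i* _); apply: I.
- exact: c.1.
- by move=> s sI sS; rewrite f12.
- exact: c.2.
- by move=> s sI sS; rewrite f12.
Qed.
End Circle.
End CircleIntegrals.

(** * Functions approximated by Laurent polynomials on a torus *)

Section Torus.
Variable K : realType.
Local Notation C := K[i].
Variable r : K.
Hypothesis r_gt0 : 0 < r.

Definition on_torus n (v : n.-tuple C) := forall i, cabs (tnth v i) = r.

Lemma on_torus_cons n z (v : n.-tuple C) :
  cabs z = r -> on_torus v -> on_torus [tuple of z :: v].
Proof.
by move=> hz hv i; case: (unliftP ord0 i) => [j|] ->; rewrite ?tnthS ?tnth0.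
Qed.

Lemma on_torus_neq0 n (v : n.-tuple C) i : on_torus v -> tnth v i != 0.
Proof. by move=> hv; rewrite -cabs_eq0 hv gt_eqF. Qed.

Lemma eq_multi_circle_int n (f g : n.-tuple C -> C) :
  (forall v, on_torus v -> f v = g v) -> multi_circle_int r f = multi_circle_int r g.
Proof.
elim: n f g => [|n IH] f g fg /=; first by apply: fg => -[].
apply: eq_circle_int => // z hz; apply: IH => v hv; apply: fg.
exact: on_torus_cons.
Qed.

Definition monom n (e : {ffun 'I_n -> int}) (v : n.-tuple C) : C := \prod_i tnth v i ^ e i.

Definition lterm n : Type := (C * {ffun 'I_n -> int})%type.

Definition laurent n := seq (lterm n).

Definition leval n (L : laurent n) (v : n.-tuple C) : C := \sum_(t <- L) t.1 * monom t.2 v.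

(** The value of the iterated contour integral: only the monomial with all exponents
    equal to -1 contributes. *)
Definition lres n (L : laurent n) : C := \sum_(t <- L) t.1 * \prod_i (t.2 i == -1)%:R.

Definition lsupp n (sg : int) (L : laurent n) := all (fun t : lterm n => [forall i, 0 <= sg * t.2 i]) L.

(** [f] is a uniform limit on the torus of Laurent polynomials whose exponents all have
    the sign [sg] (no restriction for [sg = 0]). It replaces analyticity inside the
    torus for [sg = 1], analyticity outside it, up to infinity, for [sg = -1], and
    continuity on it for [sg = 0], and it is stable under all operations needed. *)
Definition lap n (sg : int) (f : n.-tuple C -> C) :=
  forall e, 0 < e -> exists2 L, lsupp sg L & forall v, on_torus v -> cabs (f v - leval L v) <= e.

Lemma cabs_monom n e (v : n.-tuple C) : on_torus v -> cabs (monom e v) = \prod_i r ^ e i.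
Proof. by move=> hv; rewrite cabs_prod; apply: eq_bigr => i _; rewrite cabsXz hv. Qed.

Lemma leval_cat n (L M : laurent n) v : leval (L ++ M) v = leval L v + leval M v.
Proof. by rewrite /leval big_cat. Qed.

Lemma lres_cat n (L M : laurent n) : lres (L ++ M) = lres L + lres M.
Proof. by rewrite /lres big_cat. Qed.

Definition lscale n (c : C) (L : laurent n) : laurent n := [seq (c * t.1, t.2) | t : lterm n <- L].

Lemma leval_scale n c (L : laurent n) v : leval (lscale c L) v = c * leval L v.
Proof. by rewrite /leval big_map big_distrr; apply: eq_bigr => t _; rewrite /= mulrA. Qed.

Lemma lres_scale n c (L : laurent n) : lres (lscale c L) = c * lres L.
Proof. by rewrite /lres big_map big_distrr; apply: eq_bigr => t _; rewrite /= mulrA. Qed.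

Lemma leval_bound n (L : laurent n) v : on_torus v ->
  cabs (leval L v) <= \sum_(t <- L) cabs t.1 * \prod_i r ^ t.2 i.
Proof.
move=> hv; apply: le_trans (cabs_sum _ _ _) _.
by apply: ler_sum => t _; rewrite cabsM cabs_monom.
Qed.

Definition lslice n (z : C) (L : laurent n.+1) : laurent n :=
  [seq (t.1 * z ^ t.2 ord0, [ffun i => t.2 (lift ord0 i)]) | t : lterm n.+1 <- L].

Lemma leval_slice n z (L : laurent n.+1) v :
  leval (lslice z L) v = leval L [tuple of z :: v].
Proof.
rewrite /leval big_map; apply: eq_bigr => t _ /=; rewrite /monom big_ord_recl tnth0 mulrA.
by congr (_ * _); apply: eq_bigr => i _; rewrite tnthS ffunE.
Qed.

Lemma lap_slice n sg (f : n.+1.-tuple C -> C) z : cabs z = r -> lap sg f ->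
  lap sg (fun v => f [tuple of z :: v]).
Proof.
move=> hz lf e e0; have [L sL fL] := lf e e0.
exists (lslice z L); last by move=> v hv; rewrite leval_slice; apply/fL/on_torus_cons.
apply/allP => _ /mapP[t tL ->] /=; apply/forallP => i; rewrite ffunE.
by have /forallP := allP sL t tL.
Qed.

Lemma on_circle_continuous_laurent (L : seq (C * int)) :
  on_circle_continuous r (fun z => \sum_(t <- L) t.1 * z ^ t.2).
Proof.
elim: L => [|t L IH].
  rewrite (_ : (fun _ => _) = fun=> 0); first exact: on_circle_continuous_cst.
  by apply/funext => z; rewrite big_nil.
rewrite (_ : (fun _ => _) = fun z => t.1 * z ^ t.2 + \sum_(t <- L) t.1 * z ^ t.2).
  apply: ccontinuousD => //; apply: ccontinuousM; first exact: ccontinuous_cst.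
  exact: on_circle_continuousX.
by apply/funext => z; rewrite big_cons.
Qed.

Lemma circle_int_laurent (L : seq (C * int)) :
  circle_int r (fun z => \sum_(t <- L) t.1 * z ^ t.2) = \sum_(t <- L) t.1 * (t.2 == -1)%:R.
Proof.
elim: L => [|t L IH].
  rewrite big_nil; transitivity (0 * circle_int r (fun z => z ^ (0 : int))); last by rewrite mul0r.
  rewrite -circle_intZ //; last exact: on_circle_continuousX.
  by apply: eq_circle_int => // z _; rewrite big_nil mul0r.
rewrite big_cons -IH -(circle_int_exprz r_gt0) // -circle_intZ //; last exact: on_circle_continuousX.
rewrite -circle_intD //.
- by apply: eq_circle_int => // z _; rewrite big_cons.
- apply: ccontinuousM; first exact: ccontinuous_cst.
  exact: on_circle_continuousX.
- exact: on_circle_continuous_laurent.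
Qed.

Lemma lres_slice n z (L : laurent n.+1) :
  lres (lslice z L) =
  \sum_(t <- [seq (t.1 * \prod_i (t.2 (lift ord0 i) == -1)%:R, t.2 ord0) | t : lterm n.+1 <- L]) t.1 * z ^ t.2.
Proof.
rewrite /lres !big_map; apply: eq_bigr => t _ /=; rewrite mulrAC.
by congr (_ * _ * _); apply: eq_bigr => i _; rewrite ffunE.
Qed.

(** By induction on the number of variables: the inner integrals are uniformly close to
    a Laurent polynomial in the outer variable. The same closeness, for arbitrary
    precision, gives the continuity in the outer variable on which linearity of the
    circle integral depends. *)
Lemma multi_circle_int_approx n (f : n.-tuple C -> C) L e : lap 0 f ->
  (forall v, on_torus v -> cabs (f v - leval L v) <= e) ->
  cabs (multi_circle_int r f - lres L) <= e * (2 * r) ^+ n.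
Proof.
have r2 : 0 < 2 * r by rewrite mulr_gt0.
elim: n f L e => [|n IH] f L e lf fL.
  rewrite expr0 mulr1 /=; apply: le_trans (fL [tuple] _); last by case.
  rewrite le_eqVlt; apply/orP; left; apply/eqP; congr (cabs (_ - _)).
  by apply: eq_bigr => t _; rewrite /monom !big_ord0.
pose q L z := lres (@lslice n z L).
have qc M : on_circle_continuous r (q M).
  rewrite (_ : q M = fun z => lres (lslice z M)) //.
  under [fun z => _]eq_fun do rewrite lres_slice.
  exact: on_circle_continuous_laurent.
have near_q M d : (forall v, on_torus v -> cabs (f v - leval M v) <= d) ->
    forall z, cabs z = r ->
    cabs (multi_circle_int r (fun v => f [tuple of z :: v]) - q M z) <= d * (2 * r) ^+ n.
  move=> fM z hz; apply: IH; first exact: lap_slice.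
  by move=> v hv; rewrite leval_slice; apply/fM/on_torus_cons.
have hc : on_circle_continuous r (fun z => multi_circle_int r (fun v => f [tuple of z :: v])).
  apply: ccontinuous_uniform => d d0.
  have [M _ fM] := lf (d / (2 * r) ^+ n) (divr_gt0 d0 (exprn_gt0 _ r2)).
  exists (fun s => q M (circle_point r s)); first exact: qc.
  move=> s; apply: le_trans (near_q _ _ fM _ (cabs_circle_point _ r_gt0)) _.
  by rewrite divfK // gt_eqF // exprn_gt0.
have -> : lres L = circle_int r (q L).
  rewrite /q; under eq_fun do rewrite lres_slice.
  rewrite circle_int_laurent big_map; apply: eq_bigr => t _ /=.
  by rewrite big_ord_recl [X in _ * X]mulrC mulrA.
rewrite /= -[- _]mulN1r -circle_intZ // -circle_intD //; last first.
  by apply: ccontinuousM; [exact: ccontinuous_cst|exact: qc].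
rewrite exprS [e * _]mulrCA; apply: cabs_circle_int => //.
  by apply: ccontinuousD => //; apply: ccontinuousM; [exact: ccontinuous_cst|exact: qc].
by move=> z hz; rewrite mulN1r; exact: near_q.
Qed.

Lemma on_circle_continuous_slices n (f : n.+1.-tuple C -> C) : lap 0 f ->
  on_circle_continuous r (fun z => multi_circle_int r (fun v => f [tuple of z :: v])).
Proof.
have r2 : 0 < 2 * r by rewrite mulr_gt0.
move=> lf; apply: ccontinuous_uniform => d d0.
have [M _ fM] := lf (d / (2 * r) ^+ n) (divr_gt0 d0 (exprn_gt0 _ r2)).
exists (fun s => lres (lslice (circle_point r s) M)).
  under [fun s => _]eq_fun do rewrite lres_slice.
  exact: on_circle_continuous_laurent.
move=> s; have hs := @cabs_circle_point _ r s r_gt0.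
have -> : d = d / (2 * r) ^+ n * (2 * r) ^+ n by rewrite divfK // gt_eqF // exprn_gt0.
apply: multi_circle_int_approx; first exact: lap_slice.
by move=> v hv; rewrite leval_slice; apply/fM/on_torus_cons.
Qed.
End Torus.

Section TorusCalculus.
Variable K : realType.
Local Notation C := K[i].
Variable r : K.
Hypothesis r_gt0 : 0 < r.
Local Notation lap := (lap r).
Local Notation T := (on_torus r).

Let r2 n : 0 < (2 * r) ^+ n. Proof. by rewrite exprn_gt0 // mulr_gt0. Qed.

Lemma lap_eq n sg (f g : n.-tuple C -> C) :
  (forall v, T v -> f v = g v) -> lap sg f -> lap sg g.
Proof.
by move=> fg lf e e0; have [L sL fL] := lf e e0; exists L => // v hv; rewrite -fg //; exact: fL.
Qed.

Lemma lap_weaken n sg (f : n.-tuple C -> C) : lap sg f -> lap 0 f.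
Proof.
move=> lf e e0; have [L _ fL] := lf e e0; exists L => //.
by apply/allP => t _; apply/forallP => i; rewrite mul0r.
Qed.

Lemma lap_monom n sg (e : {ffun 'I_n -> int}) : (forall i, 0 <= sg * e i) -> lap sg (monom e).
Proof.
move=> he d d0; exists [:: (1, e)]; first by rewrite /lsupp /= andbT; exact/forallP.
by move=> v _; rewrite /leval big_seq1 mul1r subrr cabs0 ltW.
Qed.

Lemma lap_cst n sg (c : C) : lap sg (fun _ : n.-tuple C => c).
Proof.
move=> d d0; exists [:: (c, 0)].
  by rewrite /lsupp /= andbT; apply/forallP => i; rewrite ffunE mulr0.
move=> v _; rewrite /leval big_seq1 /= /monom big1 ?mulr1 ?subrr ?cabs0 ?ltW // => i _.
by rewrite ffunE expr0z.
Qed.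

Lemma lap_coord n sg (i : 'I_n) (k : int) : 0 <= sg * k -> lap sg (fun v => tnth v i ^ k).
Proof.
move=> hk; apply: (@lap_eq _ _ (monom [ffun j => if j == i then k else 0])).
  move=> v _; rewrite /monom (bigD1 i) //= ffunE eqxx big1 ?mulr1 // => j ji.
  by rewrite ffunE (negPf ji) expr0z.
by apply: lap_monom => j; rewrite ffunE; case: eqP => // _; rewrite mulr0.
Qed.

Lemma lapD n sg (f g : n.-tuple C -> C) : lap sg f -> lap sg g -> lap sg (fun v => f v + g v).
Proof.
move=> lf lg e e0; have e2 : 0 < e / 2 by rewrite divr_gt0.
have [L sL fL] := lf _ e2; have [M sM gM] := lg _ e2.
exists (L ++ M); first by rewrite /lsupp all_cat; apply/andP.
move=> v hv; rewrite leval_cat.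
have -> : f v + g v - (leval L v + leval M v) = (f v - leval L v) + (g v - leval M v) by ring.
by apply: le_trans (cabsD _ _) _; have := fL v hv; have := gM v hv; lra.
Qed.

Lemma lap_bounded n sg (f : n.-tuple C -> C) : lap sg f ->
  exists2 M, 0 < M & forall v, T v -> cabs (f v) <= M.
Proof.
move=> lf; have [L _ fL] := lf 1 ltr01.
pose M := \sum_(t <- L) cabs t.1 * \prod_i r ^ t.2 i.
have M0 : 0 <= M.
  apply: sumr_ge0 => t _; rewrite mulr_ge0 ?cabs_ge0 // prodr_ge0 // => i _.
  by rewrite exprz_ge0 // ltW.
exists (M + 1) => [|v hv]; first by rewrite ltr_wpDl.
have -> : f v = leval L v + (f v - leval L v) by ring.
by apply: le_trans (cabsD _ _) _; rewrite lerD ?leval_bound ?fL.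
Qed.

Definition lmul n (L M : laurent K n) : laurent K n :=
  [seq (t.1 * u.1, t.2 + u.2) | t : lterm K n <- L, u : lterm K n <- M].

Lemma monomD n (d e : {ffun 'I_n -> int}) (v : n.-tuple C) : T v ->
  monom (d + e) v = monom d v * monom e v.
Proof.
move=> hv; rewrite /monom -big_split /=; apply: eq_bigr => i _.
by rewrite ffunE expfzDr // (on_torus_neq0 r_gt0).
Qed.

Lemma leval_mul n (L M : laurent K n) v : T v -> leval (lmul L M) v = leval L v * leval M v.
Proof.
move=> hv; rewrite /leval big_allpairs_dep big_distrl; apply: eq_bigr => t _ /=.
by rewrite big_distrr; apply: eq_bigr => u _ /=; rewrite monomD // mulrACA.
Qed.

Lemma lsupp_mul n sg (L M : laurent K n) : lsupp sg L -> lsupp sg M -> lsupp sg (lmul L M).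
Proof.
move=> sL sM; apply/allP => _ /allpairsP[[t u] /= [tL uM ->]]; apply/forallP => i /=.
rewrite ffunE mulrDr addr_ge0 //.
  by have /forallP := allP sL t tL.
by have /forallP := allP sM u uM.
Qed.

Lemma lapM n sg (f g : n.-tuple C -> C) : lap sg f -> lap sg g -> lap sg (fun v => f v * g v).
Proof.
move=> lf lg e e0.
have [A A0 fA] := lap_bounded lf; have [B B0 gB] := lap_bounded lg.
(* With both approximations within [d <= 1], the error of the product is at most [d * (A
   + B + 1)]. *)
pose d := Num.min 1 (e / (A + B + 1)).
have AB : 0 < A + B + 1 by rewrite ltr_wpDr // addr_gt0.
have d0 : 0 < d by rewrite lt_min ltr01 divr_gt0.
have d1 : d <= 1 by rewrite ge_min lexx.
have de : d * (A + B + 1) <= e by rewrite -ler_pdivlMr // ge_min lexx orbT.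
have [L sL fL] := lf d d0; have [M sM gM] := lg d d0.
exists (lmul L M); first exact: lsupp_mul.
move=> v hv; rewrite leval_mul //.
have -> : f v * g v - leval L v * leval M v =
   f v * (g v - leval M v) + (f v - leval L v) * leval M v by ring.
apply: le_trans (cabsD _ _) _; rewrite !cabsM.
have h1 : cabs (f v) * cabs (g v - leval M v) <= A * d by rewrite ler_pM ?cabs_ge0 ?fA ?gM.
have M1 : cabs (leval M v) <= B + 1.
  have -> : leval M v = g v - (g v - leval M v) by ring.
  apply: le_trans (cabsD _ _) _; rewrite cabsN; apply: lerD; first exact: gB.
  exact: le_trans (gM v hv) d1.
have h2 : cabs (f v - leval L v) * cabs (leval M v) <= d * (B + 1).
  by rewrite ler_pM ?cabs_ge0 ?fL.
lra.
Qed.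

Lemma lapZ n sg c (f : n.-tuple C -> C) : lap sg f -> lap sg (fun v => c * f v).
Proof. by move=> lf; apply: lapM => //; exact: lap_cst. Qed.

Lemma lap_sum n sg I (s : seq I) (P : pred I) (f : I -> n.-tuple C -> C) :
  (forall i, lap sg (f i)) -> lap sg (fun v => \sum_(i <- s | P i) f i v).
Proof.
move=> lf; elim: s => [|i s IH].
  by apply: (lap_eq _ (@lap_cst n sg 0)) => v _; rewrite big_nil.
case: (boolP (P i)) => Pi.
  by apply: (lap_eq _ (lapD (lf i) IH)) => v _; rewrite big_cons Pi.
by apply: (lap_eq _ IH) => v _; rewrite big_cons (negPf Pi).
Qed.

Lemma lap_prod n sg I (s : seq I) (P : pred I) (f : I -> n.-tuple C -> C) :
  (forall i, lap sg (f i)) -> lap sg (fun v => \prod_(i <- s | P i) f i v).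
Proof.
move=> lf; elim: s => [|i s IH].
  by apply: (lap_eq _ (@lap_cst n sg 1)) => v _; rewrite big_nil.
case: (boolP (P i)) => Pi.
  by apply: (lap_eq _ (lapM (lf i) IH)) => v _; rewrite big_cons Pi.
by apply: (lap_eq _ IH) => v _; rewrite big_cons (negPf Pi).
Qed.

Lemma lapX n sg k (f : n.-tuple C -> C) : lap sg f -> lap sg (fun v => f v ^+ k).
Proof.
move=> lf; elim: k => [|k IH]; first exact: lap_cst.
by apply: (lap_eq _ (lapM lf IH)) => v _; rewrite exprS.
Qed.

Lemma lap_ulim n sg (f : n.-tuple C -> C) :
  (forall e, 0 < e -> exists2 g, lap sg g & forall v, T v -> cabs (f v - g v) <= e) -> lap sg f.
Proof.
move=> h e e0; have e2 : 0 < e / 2 by rewrite divr_gt0.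
have [g lg fg] := h _ e2; have [L sL gL] := lg _ e2; exists L => // v hv.
have -> : f v - leval L v = (f v - g v) + (g v - leval L v) by ring.
by apply: le_trans (cabsD _ _) _; have := fg v hv; have := gL v hv; lra.
Qed.

Lemma geometric_small (q e : K) : 0 <= q < 1 -> 0 < e -> exists n, q ^+ n <= e.
Proof.
move=> /andP[q0 q1] e0.
have nq : `|q| < 1 by rewrite ger0_norm.
have /cvgrPdist_lt /(_ _ e0) [n _ /(_ n (leqnn n))] := cvg_expr nq.
by rewrite sub0r normrN => /ltW h; exists n; apply: le_trans (ler_norm _) h.
Qed.

(** The inverse of [1 - g] is the limit of the geometric series, which keeps the sign of
    the exponents. *)
Lemma lap_geometric n sg (g : n.-tuple C -> C) (q : K) : 0 <= q < 1 ->
  (forall v, T v -> cabs (g v) <= q) -> lap sg g -> lap sg (fun v => (1 - g v)^-1).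
Proof.
move=> q01 gq lg; have /andP[q0 q1] := q01; apply: lap_ulim => e e0.
have q1' : 0 < 1 - q by rewrite subr_gt0.
have [m qm] := geometric_small q01 (mulr_gt0 e0 q1').
exists (fun v => \sum_(k < m) g v ^+ k); first by apply: lap_sum => k; exact: lapX.
move=> v hv; have h1 : 1 - q <= cabs (1 - g v).
  have := cabsD (1 - g v) (g v); rewrite subrK cabs1; have := gq v hv; lra.
have n0 : 1 - g v != 0 by rewrite -cabs_eq0 gt_eqF // (lt_le_trans q1').
have -> : (1 - g v)^-1 - \sum_(k < m) g v ^+ k = g v ^+ m / (1 - g v).
  apply: (mulIf n0); rewrite divfK // mulrBl mulVf // mulrC.
  have E := subrX1 (g v) m.
  have -> : (1 - g v) * (\sum_(k < m) g v ^+ k) = - ((g v - 1) * \sum_(k < m) g v ^+ k) by ring.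
  by rewrite -E; ring.
rewrite cabsM cabsV cabsX ler_pdivrMr ?(lt_le_trans q1') //.
apply: le_trans (_ : q ^+ m <= _); first by rewrite lerXn2r ?nnegrE ?cabs_ge0 ?gq.
by apply: le_trans qm _; rewrite ler_pM2l.
Qed.

Lemma le_eps (x c : K) : 0 <= c -> (forall e, 0 < e -> x <= e * c) -> x <= 0.
Proof.
move=> c0 h; rewrite leNgt; apply/negP => x0.
have c1 : 0 < c + 1 by rewrite ltr_wpDl.
have := h (x / (c + 1)) (divr_gt0 x0 c1); apply/negP; rewrite -ltNge mulrAC.
by rewrite ltr_pdivrMr // ltr_pM2l // ltrDl.
Qed.

Lemma cabs_eps (z w : C) (c : K) : 0 <= c -> (forall e, 0 < e -> cabs (z - w) <= e * c) -> z = w.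
Proof.
move=> c0 h; apply/eqP; rewrite -subr_eq0 -cabs_eq0 eq_le cabs_ge0 andbT.
exact: le_eps c0 h.
Qed.

Lemma multi_circle_intD n (f g : n.-tuple C -> C) : lap 0 f -> lap 0 g ->
  multi_circle_int r (fun v => f v + g v) = multi_circle_int r f + multi_circle_int r g.
Proof.
move=> lf lg; apply: (@cabs_eps _ _ (4 * (2 * r) ^+ n)); first by rewrite mulr_ge0 // ltW.
move=> e e0; have [L _ fL] := lf e e0; have [M _ gM] := lg e e0.
have hf := multi_circle_int_approx r_gt0 lf fL; have hg := multi_circle_int_approx r_gt0 lg gM.
have hs : cabs (multi_circle_int r (fun v => f v + g v) - lres (L ++ M)) <= (2 * e) * (2 * r) ^+ n.
  apply: (multi_circle_int_approx r_gt0 (lapD lf lg)) => v hv; rewrite leval_cat.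
  have -> : f v + g v - (leval L v + leval M v) = (f v - leval L v) + (g v - leval M v) by ring.
  by apply: le_trans (cabsD _ _) _; have := fL v hv; have := gM v hv; lra.
rewrite lres_cat in hs.
set A := multi_circle_int r _ in hs *; set B := multi_circle_int r f in hf *.
set D := multi_circle_int r g in hg *.
have -> : A - (B + D) = (A - (lres L + lres M)) - ((B - lres L) + (D - lres M)) by ring.
apply: le_trans (cabsD _ _) _; rewrite cabsN.
have := cabsD (B - lres L) (D - lres M); lra.
Qed.

Lemma multi_circle_intZ n c (f : n.-tuple C -> C) : lap 0 f ->
  multi_circle_int r (fun v => c * f v) = c * multi_circle_int r f.
Proof.
move=> lf; apply: (@cabs_eps _ _ (2 * cabs c * (2 * r) ^+ n)).
  by rewrite !mulr_ge0 ?cabs_ge0 // ltW.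
move=> e e0; have [L _ fL] := lf e e0.
have hf := multi_circle_int_approx r_gt0 lf fL.
have hs : cabs (multi_circle_int r (fun v => c * f v) - lres (lscale c L)) <= (cabs c * e) * (2 * r) ^+ n.
  apply: (multi_circle_int_approx r_gt0 (lapZ c lf)) => v hv.
  by rewrite leval_scale -mulrBr cabsM ler_wpM2l ?cabs_ge0 ?fL.
rewrite lres_scale in hs.
set A := multi_circle_int r _ in hs *; set B := multi_circle_int r f in hf *.
have -> : A - c * B = (A - c * lres L) - c * (B - lres L) by ring.
apply: le_trans (cabsD _ _) _; rewrite cabsN (cabsM c).
have := ler_wpM2l (cabs_ge0 c) hf; lra.
Qed.

Lemma multi_circle_int0 n : multi_circle_int r (fun _ : n.-tuple C => 0) = 0.
Proof.
rewrite -[RHS](mul0r (multi_circle_int r (fun _ : n.-tuple C => 0))) -multi_circle_intZ; last exact: lap_cst.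
by apply: eq_multi_circle_int => // v _; rewrite mul0r.
Qed.

Lemma multi_circle_int_sum n I (s : seq I) (P : pred I) (f : I -> n.-tuple C -> C) :
  (forall i, lap 0 (f i)) ->
  multi_circle_int r (fun v => \sum_(i <- s | P i) f i v) =
  \sum_(i <- s | P i) multi_circle_int r (f i).
Proof.
move=> lf; elim: s => [|i s IH].
  rewrite big_nil -[RHS](multi_circle_int0 n); apply: eq_multi_circle_int => // v _.
  by rewrite big_nil.
rewrite big_cons; case: ifP => Pi; rewrite -IH.
  rewrite -multi_circle_intD //; last exact: lap_sum.
  by apply: eq_multi_circle_int => // v _; rewrite big_cons Pi.
by apply: eq_multi_circle_int => // v _; rewrite big_cons Pi.
Qed.

Lemma multi_circle_int_near n (f g : n.-tuple C -> C) e : lap 0 f -> lap 0 g ->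
  (forall v, T v -> cabs (f v - g v) <= e) ->
  cabs (multi_circle_int r f - multi_circle_int r g) <= e * (2 * r) ^+ n.
Proof.
move=> lf lg fg; rewrite -subr_le0; apply: (@le_eps _ (2 * (2 * r) ^+ n)).
  by rewrite mulr_ge0 // ltW.
move=> d d0; have [L _ gL] := lg d d0.
have hg := multi_circle_int_approx r_gt0 lg gL.
have hf : cabs (multi_circle_int r f - lres L) <= (e + d) * (2 * r) ^+ n.
  apply: (multi_circle_int_approx r_gt0 lf) => v hv.
  have -> : f v - leval L v = (f v - g v) + (g v - leval L v) by ring.
  by apply: le_trans (cabsD _ _) _; rewrite lerD ?fg ?gL.
set A := multi_circle_int r f in hf *; set B := multi_circle_int r g in hg *.
have -> : A - B = (A - lres L) - (B - lres L) by ring.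
by have := cabsD (A - lres L) (- (B - lres L)); rewrite cabsN; lra.
Qed.

Definition permute_tuple n (s : 'S_n) (v : n.-tuple C) : n.-tuple C := [tuple tnth v (s i) | i < n].

Lemma on_torus_perm n (s : 'S_n) (v : n.-tuple C) : T v -> T (permute_tuple s v).
Proof. by move=> hv i; rewrite tnth_mktuple. Qed.

(** Permuting the variables of a Laurent polynomial does not change the coefficient of
    the monomial with all exponents -1, so that no Fubini theorem is involved. *)
Lemma multi_circle_int_perm n (s : 'S_n) (f : n.-tuple C -> C) : lap 0 f ->
  multi_circle_int r (fun v => f (permute_tuple s v)) = multi_circle_int r f.
Proof.
move=> lf; apply: (@cabs_eps _ _ (2 * (2 * r) ^+ n)); first by rewrite mulr_ge0 // ltW.
pose pL (L : laurent K n) : laurent K n :=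
  [seq (t.1, [ffun i => t.2 ((s^-1)%g i)]) | t : lterm K n <- L].
have eL L v : leval (pL L) v = leval L (permute_tuple s v).
  rewrite /leval big_map; apply: eq_bigr => t _; congr (_ * _); rewrite /monom /=.
  rewrite (reindex_inj (@perm_inj _ s)); apply: eq_bigr => i _.
  by rewrite ffunE permK tnth_mktuple.
have rL L : lres (pL L) = lres L.
  rewrite /lres big_map; apply: eq_bigr => t _; congr (_ * _) => /=.
  rewrite (reindex_inj (@perm_inj _ s)); apply: eq_bigr => i _.
  by rewrite ffunE permK.
have lfs : lap 0 (fun v => f (permute_tuple s v)).
  move=> e e0; have [L _ fL] := lf e e0; exists (pL L).
    by apply/allP => t _; apply/forallP => i; rewrite mul0r.
  by move=> v hv; rewrite eL; apply/fL/on_torus_perm.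
move=> e e0; have [L _ fL] := lf e e0.
have hf := multi_circle_int_approx r_gt0 lf fL.
have hs : cabs (multi_circle_int r (fun v => f (permute_tuple s v)) - lres (pL L)) <= e * (2 * r) ^+ n.
  by apply: (multi_circle_int_approx r_gt0 lfs) => v hv; rewrite eL; apply/fL/on_torus_perm.
rewrite rL in hs.
set A := multi_circle_int r _ in hs *; set B := multi_circle_int r f in hf *.
have -> : A - B = (A - lres L) - (B - lres L) by ring.
by apply: le_trans (cabsD _ _) _; rewrite cabsN; lra.
Qed.

(** Cauchy's theorem in the variable [j]: when the exponent [m j] is at least 0 and [g]
    has nonnegative exponents only, or [m j] is at most -2 and [g] has nonpositive
    exponents only, the exponent -1 never occurs. *)
Lemma multi_circle_int_vanish n (sg : int) (m : {ffun 'I_n -> int}) j (g : n.-tuple C -> C) :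
  lap sg g -> 0 < sg * (m j + 1) -> multi_circle_int r (fun v => monom m v * g v) = 0.
Proof.
move=> lg hm; have lm : lap 0 (monom m) by apply: lap_monom => i; rewrite mul0r.
have lg0 := lap_weaken lg.
have [B B0 mB] := lap_bounded lm.
apply: (@cabs_eps _ _ (B * (2 * r) ^+ n)); first by rewrite mulr_ge0 // ltW.
move=> e e0; have [L sL gL] := lg e e0.
have res0 : lres (lmul [:: (1, m)] L) = 0.
  rewrite /lres big_allpairs_dep big_seq1 big_seq big1 // => t tL; rewrite (bigD1 j) //= ffunE.
  have /forallP/(_ j) ht := allP sL t tL.
  rewrite (_ : (m j + t.2 j == -1) = false) ?mul0r ?mulr0 //; apply/eqP => mt.
  have tj : t.2 j = - (m j + 1) by lia.
  by move: ht; rewrite tj mulrN oppr_ge0 leNgt hm.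
have : cabs (multi_circle_int r (fun v => monom m v * g v) - lres (lmul [:: (1, m)] L))
    <= (B * e) * (2 * r) ^+ n.
  apply: (multi_circle_int_approx r_gt0 (lapM lm lg0)) => v hv.
  rewrite leval_mul // {1}/leval big_seq1 mul1r -mulrBr cabsM.
  by rewrite ler_pM ?cabs_ge0 ?mB ?gL.
by rewrite res0; lra.
Qed.

Lemma multi_circle_int_cons n (k : int) (g : n.-tuple C -> C) : lap 0 g ->
  multi_circle_int r (fun v : n.+1.-tuple C => thead v ^ k * g [tuple of behead v]) =
  (k == -1)%:R * multi_circle_int r g.
Proof.
move=> lg /=.
transitivity (circle_int r (fun z => multi_circle_int r g * z ^ k)).
  apply: eq_circle_int => // z _; rewrite mulrC -multi_circle_intZ //.
  apply: eq_multi_circle_int => // v _; rewrite theadE.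
  by congr (_ * g _); apply/val_inj.
rewrite circle_intZ //; last exact: on_circle_continuousX.
by rewrite circle_int_exprz // mulrC.
Qed.

(** An integrand may be replaced at nongeneric points, where two variables coincide or
    where one of them lies in a finite set [B]. In the induction the outer variable
    joins the set excluded for the inner ones. *)
Lemma multi_circle_int_generic n (B : seq C) (f g : n.-tuple C -> C) : lap 0 g ->
  (forall v, T v -> uniq v -> {in v, forall z, z \notin B} -> f v = g v) ->
  multi_circle_int r f = multi_circle_int r g.
Proof.
elim: n B f g => [|n IH] B f g lg fg /=; first by apply: fg => // -[].
apply: (circle_int_except r_gt0 (on_circle_continuous_slices r_gt0 lg)) => z hz zB.
apply: (IH (z :: B)); first exact: lap_slice.
move=> v hv uv vB; apply: fg; first exact: on_torus_cons.
  by rewrite /= uv andbT; apply/negP => /vB/negP; apply; exact: mem_head.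
move=> w wI; have : w \in z :: v := wI.
rewrite in_cons => /orP[/eqP->|wv]; first exact: zB.
have := vB w wv.
by rewrite in_cons negb_or => /andP[].
Qed.
End TorusCalculus.

(** * Locally uniform convergence of the exponential series *)

Section ExponentialSeries.
Variable K : realType.
Local Notation C := K[i].

Lemma cabs_cexp (z : C) : cabs (cexp z) = expR (complex.Re z).
Proof.
by rewrite /cexp cabsM cabs_real ger0_norm ?expR_ge0 // cabs_def /= cos2Dsin2 sqrtr1 mulr1.
Qed.

Lemma is_derive_monomial (c u : K) n :
  is_derive u (1 : K) (fun u : K => c * u ^+ n) (c * (n%:R * u ^+ n.-1)).
Proof.
rewrite (_ : (fun _ => _) = c \*: ((id : K -> K) ^+ n)).
  have D := is_deriveZ c (is_deriveX n (@is_derive_id K K u 1)).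
  by apply: (is_derive_eq D); rewrite /GRing.scale /= mulr1.
by apply/funext => y; rewrite /= exprfctE.
Qed.

(** A one-sided Taylor estimate: [c * s ^+ n.+1 / n.+1 - F s] vanishes at 0 and has a
    nonnegative derivative. *)
Lemma bound_of_derivative (F f : K -> K) (c : K) n :
  (forall s : K, is_derive s (1 : K) F (f s)) -> F 0 = 0 ->
  (forall s, 0 <= s <= 1 -> f s <= c * s ^+ n) ->
  forall s, 0 <= s <= 1 -> F s <= c * s ^+ n.+1 / n.+1%:R.
Proof.
move=> dF F0 fc s /andP[s0 s1].
pose G (u : K) := c / n.+1%:R * u ^+ n.+1 - F u.
have dG (u : K) : is_derive u (1 : K) G (c * u ^+ n - f u).
  have d1 : is_derive u (1 : K) (fun u : K => c / n.+1%:R * u ^+ n.+1) (c * u ^+ n).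
    have := is_derive_monomial (c / n.+1%:R) u n.+1.
    by rewrite mulrA divfK // pnatr_eq0.
  exact: is_deriveB d1 (dF u).
suff : G 0 <= G s.
  by rewrite /G F0 expr0n /= mulr0 subrr subr_ge0 mulrAC.
have h1 (u : K) : u \in `]0, 1[ -> derivable G u 1 by move=> _; case: (dG u).
have h2 (u : K) : u \in `]0, 1[ -> 0 <= derive1 G u.
  rewrite in_itv /= => /andP[u0 u1]; rewrite derive1E; case: (dG u) => _ ->.
  by rewrite subr_ge0 fc // !ltW.
have h3 : {within `[0, 1], continuous G}.
  apply: continuous_subspaceT => u; apply: differentiable_continuous.
  by apply/derivable1_diffP; case: (dG u).
by apply: (ger0_derive1_le_cc h1 h2 h3) => //; rewrite in_itv /= ?lexx ?ler01 ?s0 ?s1.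
Qed.

Lemma norm_bound_of_derivative (F f : K -> K) (c : K) n :
  (forall s : K, is_derive s (1 : K) F (f s)) -> F 0 = 0 ->
  (forall s, 0 <= s <= 1 -> `|f s| <= c * s ^+ n) ->
  forall s, 0 <= s <= 1 -> `|F s| <= c * s ^+ n.+1 / n.+1%:R.
Proof.
move=> dF F0 fc s s01; rewrite ler_norml lerNl; apply/andP; split.
  apply: (@bound_of_derivative (fun u => - F u) (fun u => - f u)) => //.
    by rewrite F0 oppr0.
  by move=> u u01; apply: le_trans (fc u u01); rewrite -normrN ler_norm.
by apply: bound_of_derivative F0 _ _ s01 => u u01; apply: le_trans (fc u u01); rewrite ler_norm.
Qed.

Definition exp_rem (n : nat) (w : C) (s : K) : C :=
  cexp (s%:C * w) - \sum_(k < n) (s%:C * w) ^+ k / k`!%:R.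

Lemma is_derive_cexp (w : C) (s : K) :
  is_derive s (1 : K) (fun s => complex.Re (cexp (s%:C * w))) (complex.Re (w * cexp (s%:C * w))) /\
  is_derive s (1 : K) (fun s => complex.Im (cexp (s%:C * w))) (complex.Im (w * cexp (s%:C * w))).
Proof.
case: w => a b.
have E (u : K) : cexp (u%:C * (a +i* b)) = (expR (a * u) * cos (b * u)) +i* (expR (a * u) * sin (b * u)).
  by rewrite /cexp; simpc; rewrite ![u * _]mulrC.
have de : is_derive s (1 : K) (fun u : K => expR (a * u)) (a * expR (a * s)).
  by apply: is_derive_eq; rewrite /GRing.scale /=; ring.
have dc : is_derive s (1 : K) (fun u : K => cos (b * u)) (- b * sin (b * s)).
  by apply: is_derive_eq; rewrite /GRing.scale /=; ring.
have ds : is_derive s (1 : K) (fun u : K => sin (b * u)) (b * cos (b * s)).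
  by apply: is_derive_eq; rewrite /GRing.scale /=; ring.
split; under eq_fun do rewrite E /=.
  apply: (is_derive_eq (is_deriveM de dc)).
  by rewrite E Re_mulc /GRing.scale /=; ring.
apply: (is_derive_eq (is_deriveM de ds)).
by rewrite E Im_mulc /GRing.scale /=; ring.
Qed.

Lemma exp_termE (w : C) (u : K) k :
  (u%:C * w) ^+ k / k`!%:R = (u ^+ k)%:C * (w ^+ k / k`!%:R).
Proof. by rewrite exprMn rmorphXn mulrA. Qed.

Lemma is_derive_exp_sum (w : C) n (s : K) :
  is_derive s (1 : K) (fun s => complex.Re (\sum_(k < n.+1) (s%:C * w) ^+ k / k`!%:R))
    (complex.Re (w * \sum_(k < n) (s%:C * w) ^+ k / k`!%:R)) /\
  is_derive s (1 : K) (fun s => complex.Im (\sum_(k < n.+1) (s%:C * w) ^+ k / k`!%:R))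
    (complex.Im (w * \sum_(k < n) (s%:C * w) ^+ k / k`!%:R)).
Proof.
have RZ (a : K) z : complex.Re (a%:C * z) = a * complex.Re z by rewrite Re_mulc /= mul0r subr0.
have IZ (a : K) z : complex.Im (a%:C * z) = a * complex.Im z by rewrite Im_mulc /= mul0r addr0.
elim: n => [|n [IHr IHi]].
  have E (u : K) : \sum_(k < 1) (u%:C * w) ^+ k / k`!%:R = 1.
    by rewrite big_ord1 expr0 fact0 divr1.
  by rewrite big_ord0 mulr0; split; under eq_fun do rewrite E; exact: is_derive_cst.
have step : w * \sum_(k < n.+1) (s%:C * w) ^+ k / k`!%:R = w * \sum_(k < n) (s%:C * w) ^+ k / k`!%:R +
   (n.+1%:R * s ^+ n)%:C * (w ^+ n.+1 / n.+1`!%:R).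
  rewrite big_ord_recr mulrDr exp_termE; congr (_ + _).
  rewrite factS natrM invfM rmorphM rmorph_nat exprS.
  have : n.+1%:R != 0 :> C by rewrite pnatr_eq0.
  by move: (n.+1%:R : C) (n`!%:R^-1 : C) (w ^+ n) => a f x a0; field.
have S (phi : C -> K) (phiD : forall y z, phi (y + z) = phi y + phi z)
    (phiZ : forall (a : K) z, phi (a%:C * z) = a * phi z) :
    is_derive s (1 : K) (fun s => phi (\sum_(k < n.+1) (s%:C * w) ^+ k / k`!%:R))
      (phi (w * \sum_(k < n) (s%:C * w) ^+ k / k`!%:R)) ->
    is_derive s (1 : K) (fun s => phi (\sum_(k < n.+2) (s%:C * w) ^+ k / k`!%:R))
      (phi (w * \sum_(k < n.+1) (s%:C * w) ^+ k / k`!%:R)).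
  move=> IH; rewrite step phiD phiZ.
  rewrite (_ : (fun _ => _) = (fun u => phi (\sum_(k < n.+1) (u%:C * w) ^+ k / k`!%:R)) +
     (fun u : K => phi (w ^+ n.+1 / n.+1`!%:R) * u ^+ n.+1)).
    apply: is_deriveD => //; rewrite [_ * phi _]mulrC.
    exact: (is_derive_monomial _ _ n.+1).
  by apply/funext => u; rewrite big_ord_recr phiD exp_termE phiZ [_ * phi _]mulrC.
split; [apply: S IHr => // y z|apply: S IHi => // y z]; by rewrite raddfD.
Qed.

(** The derivative in [s] of the remainder of order [n.+1] is [w] times the remainder of
    order [n]; integrating [n] times gives the factorial. The factor [2 ^+ n] comes from
    bounding the modulus by the sum of the two parts at each step. *)
Lemma exp_rem_bound (w : C) n s : 0 <= s <= 1 ->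
  `|complex.Re (exp_rem n w s)| <= expR (cabs w) * (2 * cabs w) ^+ n / n`!%:R * s ^+ n /\
  `|complex.Im (exp_rem n w s)| <= expR (cabs w) * (2 * cabs w) ^+ n / n`!%:R * s ^+ n.
Proof.
have w0 := cabs_ge0 w.
elim: n s => [|n IH] s s01.
  rewrite expr0 mulr1 fact0 divr1 expr0 mulr1 /exp_rem big_ord0 subr0.
  have /andP[s0 s1] := s01.
  have B : cabs (cexp (s%:C * w)) <= expR (cabs w).
    rewrite cabs_cexp ler_expR Re_mulc /= mul0r subr0.
    apply: le_trans (_ : s * cabs w <= _); last by rewrite ler_piMl.
    by rewrite ler_wpM2l // (le_trans (ler_norm _) (Re_le_cabs _)).
  by split; apply: le_trans B; [exact: Re_le_cabs|exact: Im_le_cabs].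
pose c := expR (cabs w) * (2 * cabs w) ^+ n.+1 / n`!%:R.
have -> : expR (cabs w) * (2 * cabs w) ^+ n.+1 / n.+1`!%:R * s ^+ n.+1 = c * s ^+ n.+1 / n.+1%:R.
  have n0 : n.+1%:R != 0 :> K by rewrite pnatr_eq0.
  have f0 : n`!%:R != 0 :> K by rewrite pnatr_eq0 -lt0n fact_gt0.
  by rewrite /c factS natrM; move: (n.+1%:R : K) (n`!%:R : K) n0 f0 => a f a0 f0; field; rewrite a0 f0.
have wB u : 0 <= u <= 1 -> cabs (w * exp_rem n w u) <= c * u ^+ n.
  move=> u01; have [hr hi] := IH u u01.
  have h : cabs (exp_rem n w u) <= 2 * (expR (cabs w) * (2 * cabs w) ^+ n / n`!%:R * u ^+ n).
    by apply: le_trans (cabs_le_parts _) _; lra.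
  rewrite cabsM; apply: le_trans (ler_wpM2l w0 h) _.
  by rewrite /c exprS le_eqVlt; apply/orP; left; apply/eqP; ring.
have rem0 : exp_rem n.+1 w 0 = 0.
  rewrite /exp_rem mul0r cexp0 big_ord_recl expr0 fact0 divr1 big1 ?addr0 ?subrr // => i _.
  by rewrite expr0n mul0r.
split.
- apply: (@norm_bound_of_derivative (fun u => complex.Re (exp_rem n.+1 w u))
    (fun u => complex.Re (w * exp_rem n w u)) c n) => //.
  + move=> u; rewrite /exp_rem; under eq_fun do rewrite raddfB.
    rewrite mulrBr raddfB; apply: is_deriveB.
      exact: (is_derive_cexp w u).1.
    exact: (is_derive_exp_sum w n u).1.
  + by rewrite rem0.
  + by move=> u u01; apply: le_trans (Re_le_cabs _) (wB u u01).
- apply: (@norm_bound_of_derivative (fun u => complex.Im (exp_rem n.+1 w u))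
    (fun u => complex.Im (w * exp_rem n w u)) c n) => //.
  + move=> u; rewrite /exp_rem; under eq_fun do rewrite raddfB.
    rewrite mulrBr raddfB; apply: is_deriveB.
      exact: (is_derive_cexp w u).2.
    exact: (is_derive_exp_sum w n u).2.
  + by rewrite rem0.
  + by move=> u u01; apply: le_trans (Im_le_cabs _) (wB u u01).
Qed.

Lemma cexp_series (M e : K) : 0 <= M -> 0 < e -> exists n0, forall n w, (n0 <= n)%N ->
  cabs w <= M -> cabs (cexp w - \sum_(k < n) w ^+ k / k`!%:R) <= e.
Proof.
move=> M0 e0; have c0 : 0 < 2 * expR M by rewrite mulr_gt0 ?expR_gt0.
have /cvgrPdist_lt /(_ _ (divr_gt0 e0 c0)) [n0 _ H] := cvg_exp_coeff (2 * M).
exists n0 => n w n0n wM; have w0 := cabs_ge0 w.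
have := H n n0n; rewrite sub0r normrN /exp_coeff /= => /ltW /(le_trans (ler_norm _)).
rewrite ler_pdivlMr // => B.
have [|hr hi] := @exp_rem_bound w n 1; first by rewrite ler01 lexx.
have -> : cexp w - \sum_(k < n) w ^+ k / k`!%:R = exp_rem n w 1 by rewrite /exp_rem rmorph1 mul1r.
apply: le_trans (cabs_le_parts _) _; apply: le_trans (lerD hr hi) _.
rewrite expr1n mulr1; apply: le_trans B.
have h1 : expR (cabs w) <= expR M by rewrite ler_expR.
have h2 : (2 * cabs w) ^+ n / n`!%:R <= (2 * M) ^+ n / n`!%:R.
  by rewrite ler_wpM2r ?invr_ge0 // lerXn2r ?nnegrE ?mulr_ge0 // ler_wpM2l.
have h3 : 0 <= (2 * cabs w) ^+ n / n`!%:R by rewrite divr_ge0 // exprn_ge0 // mulr_ge0.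
have := ler_pM (expR_ge0 _) h3 h1 h2; rewrite mulrA; lra.
Qed.
End ExponentialSeries.

(** * The free Hamiltonian and the kernels that commute with it *)

Definition incr n (x : 'I_n -> int) := forall i j : 'I_n, (i < j)%N -> x i < x j.

Definition freeup n (x : 'I_n -> int) i := [forall j, x j != x i + 1].
Definition freedn n (x : 'I_n -> int) i := [forall j, x j != x i - 1].

Lemma incr_inj n (x : 'I_n -> int) : incr x -> injective x.
Proof.
move=> hx i j xij; apply/val_inj/eqP; rewrite eqn_leq; apply/andP; split;
  by rewrite leqNgt; apply/negP => /hx; rewrite xij ltxx.
Qed.

Lemma incr_lift n (x : 'I_n.+1 -> int) : incr x -> incr (x \o lift ord0).
Proof. by move=> hx i j ij; apply: hx; rewrite /= /bump /= ltnS. Qed.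

Lemma incr_le n (x : 'I_n -> int) : incr x -> forall i j : 'I_n, (i <= j)%N -> x i <= x j.
Proof.
by move=> hx i j; rewrite leq_eqVlt => /predU1P[/val_inj->//|/hx/ltW].
Qed.

Lemma shift_self n (x : 'I_n -> int) i d : shift x i d i = x i + d.
Proof. by rewrite /shift eqxx. Qed.

Lemma shift_other n (x : 'I_n -> int) i d j : j != i -> shift x i d j = x j.
Proof. by rewrite /shift => /negPf ->. Qed.

Lemma shiftK n (x : 'I_n -> int) i d : shift (shift x i d) i (- d) = x.
Proof. by apply/funext => j; rewrite /shift; case: eqP => // ->; rewrite addrK. Qed.

Lemma sum_shift n (x : 'I_n -> int) i d : \sum_j shift x i d j = \sum_j x j + d.
Proof.
rewrite (bigD1 i) //= [in RHS](bigD1 i) //= shift_self addrAC; congr (_ + _ + _).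
by apply: eq_bigr => j; exact: shift_other.
Qed.

Lemma incr_up n (x : 'I_n -> int) i : incr x -> freeup x i -> incr (shift x i 1).
Proof.
move=> hx /forallP hi j k jk; have := hx j k jk; have := hi k; rewrite /shift.
by case: (j =P i) => [->|_]; case: (k =P i) => [->|_]; move=> /eqP; lia.
Qed.

Lemma incr_dn n (x : 'I_n -> int) i : incr x -> freedn x i -> incr (shift x i (-1)).
Proof.
move=> hx /forallP hi j k jk; have := hx j k jk; have := hi j; rewrite /shift.
by case: (j =P i) => [->|_]; case: (k =P i) => [->|_]; move=> /eqP; lia.
Qed.

Lemma incr_adjacent n (x : 'I_n -> int) i j : incr x -> x j = x i + 1 -> j = i.+1 :> nat.
Proof.
move=> hx xji; apply/eqP; rewrite eqn_leq andbC.
have ij : (i < j)%N.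
  by rewrite ltnNge; apply/negP => /(incr_le hx); rewrite xji; lia.
rewrite ij /= leqNgt; apply/negP => ij1.
have i1 : (i.+1 < n)%N by apply: leq_trans ij1 (ltnW (ltn_ord j)).
have := hx i (Ordinal i1) (ltnSn _); have := hx (Ordinal i1) j ij1; rewrite xji; lia.
Qed.

Section FreeHamiltonian.
Variables (C : comNzRingType) (D : C).

(** The XXZ Hamiltonian on [n] particles at increasing positions [x], defined for
    functions on all of [Z^n]: a particle moves only to a free site, and each such bond
    contributes [- D]. *)
Definition freeH n (g : ('I_n -> int) -> C) (x : 'I_n -> int) : C :=
  \sum_(i | freeup x i) (g (shift x i 1) - D * g x) +
  \sum_(i | freedn x i) (g (shift x i (-1)) - D * g x).

(** A blocked move is charged to the particle that occupies its target; this particle is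
    unique because positions are distinct. *)
Lemma sum_blocked n (x : 'I_n -> int) (p : 'I_n -> bool) (f : 'I_n -> C) (c : 'I_n -> int) :
  injective x -> (forall i, p i = [exists j, x j == c i]) ->
  \sum_(i | p i) f i = \sum_i \sum_(j | x j == c i) f i.
Proof.
move=> xI hp; rewrite big_mkcond /=; apply: eq_bigr => i _; rewrite hp.
case: existsP => [[j /eqP hj]|h].
  by rewrite (big_pred1 j) // => k; rewrite /= -hj (inj_eq xI).
by rewrite big_pred0 // => j; apply/negP => hj; apply: h; exists j.
Qed.

(** A function that satisfies the boundary condition at each pair of neighbouring
    particles is not affected by the exclusion: the terms of the free Laplacian that are
    blocked, one to the right and one to the left for each such pair, cancel. *)
Lemma freeH_boundary n (g : ('I_n -> int) -> C) x : incr x ->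
  (forall i j : 'I_n, j = i.+1 :> nat -> x j = x i + 1 ->
     g (shift x i 1) + g (shift x j (-1)) = 2 * D * g x) ->
  freeH g x = \sum_i (g (shift x i 1) + g (shift x i (-1)) - 2 * D * g x).
Proof.
move=> hx bc; have xI := incr_inj hx.
have upE i : ~~ freeup x i = [exists j, x j == x i + 1].
  by rewrite negb_forall; apply: eq_existsb => j; rewrite negbK.
have dnE i : ~~ freedn x i = [exists j, x j == x i - 1].
  by rewrite negb_forall; apply: eq_existsb => j; rewrite negbK.
have blocked : \sum_(i | ~~ freeup x i) (g (shift x i 1) - D * g x) +
    \sum_(i | ~~ freedn x i) (g (shift x i (-1)) - D * g x) = 0.
  rewrite (sum_blocked _ xI upE) (sum_blocked _ xI dnE).
  rewrite [X in _ + X](exchange_big_dep xpredT) //= -big_split big1 //= => i _.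
  under [X in _ + X]eq_bigl => j do rewrite eq_sym subr_eq.
  rewrite -big_split big1 //= => j /eqP xji.
  have := bc i j (incr_adjacent hx xji) xji; set a := g _; set b := g _ => ab.
  by rewrite addrACA ab; ring.
transitivity (\sum_i (g (shift x i 1) - D * g x) + \sum_i (g (shift x i (-1)) - D * g x)).
  rewrite [X in _ = X + _](bigID (freeup x)) [X in _ = _ + X](bigID (freedn x)) /=.
  by rewrite addrACA blocked addr0.
by rewrite -big_split; apply: eq_bigr => i _ /=; ring.
Qed.

Lemma freeHB n (g h : ('I_n -> int) -> C) x :
  freeH (fun y => g y - h y) x = freeH g x - freeH h x.
Proof.
rewrite /freeH opprD addrACA -!sumrB; congr (_ + _); apply: eq_bigr => i _; ring.
Qed.

Definition delta n (x y : 'I_n -> int) : C := [forall i, x i == y i]%:R.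

Lemma deltaP n (x y : 'I_n -> int) : reflect (x = y) [forall i, x i == y i].
Proof.
apply: (iffP forallP) => [h|-> i]; last exact: eqxx.
by apply/funext => i; exact/eqP.
Qed.

Lemma delta_shift n (x y : 'I_n -> int) i (d : int) :
  delta (shift x i d) y = delta x (shift y i (- d)).
Proof.
congr (_%:R); congr nat_of_bool; apply: eq_forallb => j.
by rewrite /shift; case: (j =P i) => // _; rewrite [RHS]eq_sym subr_eq eq_sym.
Qed.

(** The Hamiltonian is symmetric: a move from [x] to [y] is allowed exactly when the
    reverse move is. *)
Lemma freeH_delta n (x y : 'I_n -> int) : incr x -> incr y ->
  freeH (fun z => delta z y) x = freeH (delta x) y.
Proof.
move=> hx hy; rewrite /freeH !sumrB.
have match_shift (u v : 'I_n -> int) (d : int) (p q : 'I_n -> bool) : injective u -> injective v ->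
    (forall i, p i = [forall j, u j != u i + d]) -> (forall i, q i = [forall j, v j != v i - d]) ->
    d != 0 ->
    \sum_(i | p i) delta (shift u i d) v = \sum_(i | q i) delta u (shift v i (- d)).
  move=> uI vI hp hq d0; rewrite big_mkcond [RHS]big_mkcond; apply: eq_bigr => i _ /=.
  rewrite -delta_shift /delta; case: deltaP => [uv|_]; last by rewrite !if_same.
  have -> : p i.
    rewrite hp; apply/forallP => j; apply/eqP => uj.
    have ji : j = i.
      apply: vI; rewrite -uv shift_self -uj /shift; case: (j =P i) => // ji.
      by rewrite ji in uj; exfalso; move/eqP: d0; lia.
    by rewrite ji in uj; exfalso; move/eqP: d0; lia.
  have -> // : q i.
  rewrite hq; apply/forallP => j; rewrite -uv shift_self addrK /shift; case: (j =P i) => [->|/eqP ji].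
    by apply/eqP => h; exfalso; move/eqP: d0; lia.
  by rewrite (inj_eq uI).
have xI := incr_inj hx; have yI := incr_inj hy.
rewrite (match_shift x y 1 (freeup x) (freedn y)) //.
have -> : \sum_(i | freedn x i) delta (shift x i (-1)) y = \sum_(i | freeup y i) delta x (shift y i 1).
  rewrite (match_shift x y (-1) (freedn x) (freeup y)) ?opprK //; move=> i; rewrite opprK.
have counts : \sum_(i | freeup x i) D * delta x y + \sum_(i | freedn x i) D * delta x y =
    \sum_(i | freeup y i) D * delta x y + \sum_(i | freedn y i) D * delta x y.
  rewrite {1 2 3 4}/delta; case: deltaP => [->//|_].
  by rewrite !big1 // => i _; rewrite mulr0.
by rewrite addrACA -opprD counts opprD [in RHS]addrACA [X in X + _ = _]addrC.
Qed.

(** A kernel that commutes with the Hamiltonian is the identity as soon as it is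
    triangular and factorises when the first particle of [y] is separated from the other
    particles of [x]. The orthogonality of the Bethe functions is reduced to this, which
    avoids the evaluation of residues at the zeros of the scattering factors. *)
Section Uniqueness.
Variable k : forall n, ('I_n -> int) -> ('I_n -> int) -> C.
Hypothesis k0 : forall x y : 'I_0 -> int, k x y = 1.
Hypothesis k_le : forall n (x y : 'I_n -> int), incr x -> incr y -> k x y != 0 ->
  forall i, x i <= y i.
Hypothesis k_comm : forall n (x y : 'I_n -> int), incr x -> incr y ->
  freeH (fun z => k z y) x = freeH (k x) y.
Hypothesis k_cluster : forall n (x y : 'I_n.+1 -> int), incr x -> incr y ->
  (forall j, y ord0 < x (lift ord0 j)) ->
  k x y = (x ord0 == y ord0)%:R * k (x \o lift ord0) (y \o lift ord0).

Lemma delta_cons n (x y : 'I_n.+1 -> int) :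
  delta x y = (x ord0 == y ord0)%:R * delta (x \o lift ord0) (y \o lift ord0).
Proof.
rewrite /delta -natrM mulnb; congr (_%:R); congr nat_of_bool.
apply/forallP/andP => [h|[h0 /forallP h] i]; first by split; last apply/forallP => i; exact: h.
by case: (unliftP ord0 i) => [j|] ->; [exact: h|exact: h0].
Qed.

Lemma delta_neq n (x y : 'I_n -> int) i : x i != y i -> delta x y = 0.
Proof. by move=> xy; rewrite /delta; case: deltaP => // e; rewrite e eqxx in xy. Qed.

(** Induction on the number of particles, then on the level [d], a bound for [\sum y -
    \sum x], then on the amount by which the gap between the first two particles of [y]
    falls short of [d]. If the gap exceeds [d], either the first particle of [y] is
    separated and the kernel factorises, or the second particle of [x] lies so far to
    the left that triangularity forces both sides to vanish. Otherwise the first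
    particle of [y] is moved one step to the left, to [y']. The commutation relation at
    [(x, y')] expresses the value at [(x, y)] by values at a lower level, and by values
    at the same level for which the gap has grown. *)
Lemma kernel_delta n (x y : 'I_n -> int) : incr x -> incr y -> k x y = delta x y.
Proof.
elim: n x y => [|n IHn] x y hx hy.
  by rewrite k0 /delta (_ : [forall i, _]) //; apply/forallP => -[].
have cluster (x' y' : 'I_n.+1 -> int) : incr x' -> incr y' ->
    (forall j, y' ord0 < x' (lift ord0 j)) -> k x' y' = delta x' y'.
  by move=> hx' hy' h; rewrite k_cluster // delta_cons IHn //; exact: incr_lift.
have level_neg (x' y' : 'I_n.+1 -> int) : incr x' -> incr y' ->
    \sum_i y' i - \sum_i x' i < 0 -> k x' y' = delta x' y'.
  move=> hx' hy' neg; have nle : ~ forall i, x' i <= y' i.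
    by move=> h; move: neg; rewrite -sumrB ltNge sumr_ge0 // => i _; rewrite subr_ge0.
  have -> : k x' y' = 0.
    by apply/eqP/negP => /negP k0'; apply: nle; exact: k_le.
  by rewrite /delta; case: deltaP => // e; case: nle; rewrite e.
case: n x y hx hy IHn cluster level_neg => [|n] x y hx hy IHn cluster level_neg.
  by apply: cluster => // -[].
pose i1 : 'I_n.+2 := lift ord0 ord0.
suff H : forall d p (x y : 'I_n.+2 -> int), incr x -> incr y ->
    \sum_i y i - \sum_i x i <= d%:Z -> d%:Z - (y i1 - y ord0) < p%:Z -> k x y = delta x y.
  have [d dE] : exists d : nat, \sum_i y i - \sum_i x i <= d%:Z.
    by exists (absz (\sum_i y i - \sum_i x i)%R); lia.
  by apply: (H d (absz (d%:Z - (y i1 - y ord0))%R).+1) => //; lia.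
(* [d] bounds the level and [p] measures how far the gap is from exceeding it; at [p =
   0] the gap is larger than [d]. *)
elim/ltn_ind => d IHd; elim => [|p IHp] {}x {}y {}hx {}hy hd hp.
  have hgap : d%:Z < y i1 - y ord0 by lia.
  have [h|/existsNP[j hj]] := pselect (forall j, y ord0 < x (lift ord0 j)); first exact: cluster.
  have x1 : x i1 <= y ord0.
    by apply: le_trans (incr_le hx _) _; last by rewrite leNgt; exact/negP/hj; rewrite /= /bump.
  have xy1 : x i1 != y i1 by have := hy ord0 i1 isT; lia.
  rewrite (delta_neq xy1); apply/eqP/negP => /negP kn0.
  have le := k_le hx hy kn0.
  have : y i1 - x i1 <= \sum_i y i - \sum_i x i.
    rewrite -sumrB (bigD1 i1) //= lerDl sumr_ge0 // => i _; by rewrite subr_ge0.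
  lia.
have lower (a b : 'I_n.+2 -> int) : incr a -> incr b ->
    \sum_i b i - \sum_i a i <= d%:Z - 1 -> k a b = delta a b.
  move=> ha hb hab; have [neg|pos] := ltrP (\sum_i b i - \sum_i a i) 0; first exact: level_neg.
  apply: (IHd (absz (\sum_i b i - \sum_i a i)%R) _ (absz (d%:Z - (b i1 - b ord0))%R).+1) => //; lia.
(* Moving the first particle of [y] to the left lowers the level and widens the gap. *)
pose y' := shift y ord0 (-1).
have y'0 : y' ord0 = y ord0 - 1 by rewrite /y' shift_self.
have y'1 : y' i1 = y i1 by rewrite /y' shift_other.
have hy' : incr y'.
  apply: incr_dn => //; apply/forallP => j; apply/eqP => yj.
  by have := incr_le hy (leq0n j : (@ord0 n.+1 <= j)%N); rewrite yj; lia.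
have sy' : \sum_i y' i = \sum_i y i - 1 by rewrite sum_shift.
have up0 : freeup y' ord0.
  apply/forallP => j; rewrite y'0 subrK; apply/eqP.
  case: (unliftP ord0 j) => [j'|] ->; last by rewrite y'0; lia.
  by rewrite /y' shift_other //; have := hy ord0 (lift ord0 j') isT; lia.
have rel : freeH (fun z => k z y' - delta z y') x = freeH (fun z => k x z - delta x z) y'.
  by rewrite !freeHB k_comm // freeH_delta.
have kxy' : k x y' - delta x y' = 0 by rewrite lower ?subrr // sy'; lia.
have y'K : shift y' ord0 1 = y by rewrite /y' -[1]opprK shiftK.
move: rel; rewrite /freeH kxy' mulr0.
rewrite [X in X + _ = _]big1; last first.
  by move=> i hi; rewrite lower ?subrr ?sum_shift ?sy' //; [exact: incr_up|lia].
rewrite [X in _ + X = _]big1; last first.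
  move=> i hi; rewrite IHp ?subrr ?sum_shift ?sy' //; [exact: incr_dn|lia|].
  by rewrite y'0 y'1; lia.
rewrite [X in _ = _ + X]big1; last first.
  by move=> i hi; rewrite lower ?subrr ?sum_shift ?sy' //; [exact: incr_dn|lia].
rewrite (bigD1 ord0) //= y'K big1; last first.
  move=> i /andP[hi i0]; rewrite IHp ?subrr ?sum_shift ?sy' //; [exact: incr_up|lia|].
  rewrite [shift y' i 1 ord0]shift_other 1?eq_sym // y'0.
  have : y' i1 <= shift y' i 1 i1 by rewrite /shift; case: eqP; lia.
  by rewrite y'1; lia.
by rewrite !addr0 subr0 => /esym/eqP; rewrite subr_eq0 => /eqP.
Qed.
End Uniqueness.
End FreeHamiltonian.

(** * Bethe functions and their orthogonality on a torus *)

(** The product of [a * b] over all pairs is symmetric, so that powers of [a * b] split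
    off from a scattering factor cancel in [amplitude]. *)
Lemma pair_prod_mul (F : comNzRingType) n (w : 'I_n -> F) :
  pair_prod (fun a b => a * b) w = (\prod_i w i) ^+ n.-1.
Proof.
elim: n w => [|n IH] w; first by rewrite /pair_prod !big_ord0.
rewrite pair_prod_recl IH big_ord_recl /= big_split /= prodr_const card_ord exprMn.
rewrite -mulrA; congr (_ * _); case: n {IH} w => [|n] w; first by rewrite !big_ord0 mulr1.
by rewrite /= exprS.
Qed.

(** Pigeonhole: among the first [i + 1] indices, one is mapped by [s] to an index at
    least [i]. *)
Lemma incr_perm_le n (a b : 'I_n -> int) (s : 'S_n) : incr a -> incr b ->
  (forall j, a (s j) <= b j) -> forall i, a i <= b i.
Proof.
move=> ha hb hs i.
suff /existsP[j /andP[ji si]] : [exists j : 'I_n, (j <= i)%N && (i <= s j)%N].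
  apply: le_trans (incr_le ha si) _; apply: le_trans (hs j) _; exact: incr_le.
rewrite -[X in is_true X]negbK; apply/negP; rewrite negb_exists => /forallP h.
have sub : [set s j | j in [set j : 'I_n | (j <= i)%N]]%SET \subset [set j : 'I_n | (j < i)%N]%SET.
  apply/fintype.subsetP => _ /imsetP[j + ->]; rewrite !finset.inE => ji.
  by have := h j; rewrite ji /= -ltnNge.
have := subset_leq_card sub; rewrite card_imset; last exact: perm_inj.
have lt : [set j : 'I_n | (j < i)%N]%SET \proper [set j : 'I_n | (j <= i)%N]%SET.
  apply/properP; split.
    by apply/fintype.subsetP => j; rewrite !finset.inE => /ltnW.
  by exists i; rewrite !finset.inE ?leqnn ?ltnn.
by rewrite leqNgt (proper_card lt).
Qed.

(** The scattering factor is assumed to be, up to a power of [a * b], an invertible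
    function [phi] that is analytic inside the circle ([sg = 1]) or outside it ([sg =
    -1]). This treats small and large circles at once. *)
Section AnalyticKernel.
Variables (K : realType) (Delta rho : K).
Local Notation C := K[i].
Local Notation D := (Delta%:C : C).
Hypothesis rho_gt0 : 0 < rho.
Local Notation lap := (lap rho).
Local Notation I f := (multi_circle_int rho f).

Variables (sg : int) (k : nat) (phi : C -> C -> C).
Hypothesis phi_lap : forall n (i j : 'I_n), lap sg (fun v => phi (tnth v i) (tnth v j)).
Hypothesis phi_inv_lap : forall n (i j : 'I_n), lap sg (fun v => (phi (tnth v i) (tnth v j))^-1).
Hypothesis scatE : forall a b, cabs a = rho -> cabs b = rho -> scat D a b = (a * b) ^+ k * phi a b.
Hypothesis phi_neq0 : forall a b, cabs a = rho -> cabs b = rho -> phi a b != 0.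

Let cabs_neq0 a : cabs a = rho -> a != 0.
Proof. by move=> ha; rewrite -cabs_eq0 ha gt_eqF. Qed.

Lemma scat_neq0 a b : cabs a = rho -> cabs b = rho -> scat D a b != 0.
Proof.
by move=> ha hb; rewrite scatE // mulf_neq0 ?phi_neq0 // expf_neq0 // mulf_neq0 ?cabs_neq0.
Qed.

Lemma pair_prod_scat_neq0 n (v : n.-tuple C) : on_torus rho v -> pair_prod (scat D) (tnth v) != 0.
Proof.
move=> hv; apply/prodf_neq0 => i _; apply/prodf_neq0 => j _; exact: scat_neq0.
Qed.

Lemma pair_prod_scatE n (w : 'I_n -> C) : (forall i, cabs (w i) = rho) ->
  pair_prod (scat D) w = ((\prod_i w i) ^+ n.-1) ^+ k * pair_prod phi w.
Proof.
move=> hw; rewrite -pair_prod_mul /pair_prod -prodrXl -big_split /=; apply: eq_bigr => i _.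
by rewrite -prodrXl -big_split /=; apply: eq_bigr => j _; exact: scatE.
Qed.

(** The coefficient of the permutation [s] in the normalised Bethe wave function, a
    product of scattering matrices. *)
Definition amplitude n (s : 'S_n) (v : n.-tuple C) : C :=
  (-1) ^+ s * (pair_prod (scat D) (tnth v \o s) / pair_prod (scat D) (tnth v)).

Lemma amplitude_lap n (s : 'S_n) : lap sg (amplitude s).
Proof.
have E : forall v : n.-tuple C, on_torus rho v -> (-1) ^+ s *
    (pair_prod phi (tnth v \o s) * \prod_(j < n) \prod_(l < n | (j < l)%N) (phi (tnth v j) (tnth v l))^-1)
    = amplitude s v.
  move=> v hv; rewrite /amplitude !pair_prod_scatE //; last by move=> i; exact: hv.
  have -> : \prod_i (tnth v \o s) i = \prod_i tnth v i.
    by rewrite [RHS](reindex_inj (@perm_inj _ s)).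
  have P0 : (((\prod_i tnth v i) ^+ n.-1) ^+ k : C) != 0.
    by rewrite !expf_neq0 //; apply/prodf_neq0 => i _; exact: (on_torus_neq0 rho_gt0).
  rewrite invfM mulrACA mulfV // mul1r; congr (_ * (_ * _)).
  by rewrite -prodfV; apply: eq_bigr => i _; rewrite prodfV.
apply: (lap_eq E); apply: (lapM rho_gt0); first exact: lap_cst.
apply: (lapM rho_gt0).
  by do 2!(apply: (lap_prod rho_gt0) => ?); exact: phi_lap.
by do 2!(apply: (lap_prod rho_gt0) => ?); exact: phi_inv_lap.
Qed.

(** The left factor of the resolution of the identity: a single plane wave, not
    antisymmetrised. The exponent -1 turns the measure on the torus into the invariant
    one. *)
Definition plane n (y : 'I_n -> int) (v : n.-tuple C) : C := \prod_i tnth v i ^ (- y i - 1).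

Definition bethe_fun n (x y : 'I_n -> int) (v : n.-tuple C) : C :=
  Phi D (tnth v) x * plane y v / pair_prod (scat D) (tnth v).

Lemma coord_lap0 n (i : 'I_n) z : lap 0 (fun v => tnth v i ^ z).
Proof. by apply: lap_coord => //; rewrite mul0r. Qed.

Lemma inv_pair_prod_lap n : lap 0 (fun v : n.-tuple C => (pair_prod (scat D) (tnth v))^-1).
Proof.
have E : forall v : n.-tuple C, on_torus rho v ->
   ((\prod_i tnth v i ^ (-1)) ^+ n.-1) ^+ k *
   \prod_(j < n) \prod_(l < n | (j < l)%N) (phi (tnth v j) (tnth v l))^-1 =
   (pair_prod (scat D) (tnth v))^-1.
  move=> v hv; rewrite pair_prod_scatE // invfM -!exprVn -prodfV; congr (_ * _).
  by rewrite /pair_prod -prodfV; apply: eq_bigr => i _; rewrite prodfV.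
apply: (lap_eq E); apply: (lapM rho_gt0).
  by do 2!apply: (lapX rho_gt0); apply: (lap_prod rho_gt0) => i; exact: coord_lap0.
by do 2!(apply: (lap_prod rho_gt0) => ?); apply: (lap_weaken (phi_inv_lap _ _)).
Qed.

Lemma Phi_lap n (x : 'I_n -> int) : lap 0 (fun v : n.-tuple C => Phi D (tnth v) x).
Proof.
apply: lap_sum => s; apply: (lapM rho_gt0); last by apply: (lap_prod rho_gt0) => i; exact: coord_lap0.
apply: (lapM rho_gt0); first exact: lap_cst.
have h i : lap 0 (fun v : n.-tuple C => tnth v i).
  by apply: (lap_eq _ (coord_lap0 i 1)) => v _; rewrite expr1z.
do 2!(apply: (lap_prod rho_gt0) => ?); rewrite /scat; apply: lapD => //.
  by apply: lapD => //; [exact: lap_cst|apply: (lapM rho_gt0); exact: h].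
apply: (lap_eq (f := fun v => (- (2 * D)) * tnth v (s _))) => [v _|]; first by rewrite mulNr.
by apply: (lapZ rho_gt0); exact: h.
Qed.

Lemma plane_lap n (y : 'I_n -> int) : lap 0 (plane y).
Proof. by apply: (lap_prod rho_gt0) => i; exact: coord_lap0. Qed.

Lemma bethe_lap n (x y : 'I_n -> int) : lap 0 (bethe_fun x y).
Proof.
by apply: (lapM rho_gt0); [apply: (lapM rho_gt0); [exact: Phi_lap|exact: plane_lap]|exact: inv_pair_prod_lap].
Qed.

Definition bethe_term n (x y : 'I_n -> int) (s : 'S_n) (v : n.-tuple C) : C :=
  monom [ffun i => x ((s^-1)%g i) - y i - 1] v * amplitude s v.

Lemma bethe_termE n (x y : 'I_n -> int) s (v : n.-tuple C) : on_torus rho v ->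
  bethe_term x y s v = Phi_term D (tnth v) x s * plane y v / pair_prod (scat D) (tnth v).
Proof.
move=> hv; rewrite /bethe_term /Phi_term /amplitude /plane.
have -> : monom [ffun i => x ((s^-1)%g i) - y i - 1] v =
    (\prod_(i < n) tnth v (s i) ^ x i) * \prod_(i < n) tnth v i ^ (- y i - 1).
  rewrite [X in _ = X * _](reindex_inj (@perm_inj _ (s^-1)%g)) -big_split /=.
  apply: eq_bigr => i _; rewrite ffunE permKV -expfzDr ?(on_torus_neq0 rho_gt0) //.
  by rewrite addrA.
move: ((-1) ^+ s) (pair_prod _ (_ \o _)) (pair_prod _ _)^-1 => a b c.
by move: (\prod_(i < n) _) (\prod_(i < n) _) => d e; ring.
Qed.

Lemma bethe_term_lap n (x y : 'I_n -> int) s : lap 0 (bethe_term x y s).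
Proof.
apply: (lapM rho_gt0); first by apply: lap_monom => i; rewrite mul0r.
exact: lap_weaken (amplitude_lap s).
Qed.

Lemma bethe_funE n (x y : 'I_n -> int) (v : n.-tuple C) : on_torus rho v ->
  bethe_fun x y v = \sum_(s : 'S_n) bethe_term x y s v.
Proof.
move=> hv; under eq_bigr do rewrite bethe_termE //.
by rewrite -!big_distrl.
Qed.

(** Triangularity at the level of a single permutation: if one exponent has the wrong
    sign, the residue in that variable is zero. *)
Lemma bethe_term_vanish n (x y : 'I_n -> int) (s : 'S_n) j :
  0 < sg * (x ((s^-1)%g j) - y j) -> I (bethe_term x y s) = 0.
Proof.
move=> h; apply: (multi_circle_int_vanish rho_gt0 (j := j) (amplitude_lap s)).
by rewrite ffunE subrK.
Qed.

Definition kernel n (x y : 'I_n -> int) : C := I (bethe_fun x y).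

Lemma kernel_sum n (x y : 'I_n -> int) : kernel x y = \sum_(s : 'S_n) I (bethe_term x y s).
Proof.
rewrite -multi_circle_int_sum //; last by move=> s; exact: bethe_term_lap.
by apply: eq_multi_circle_int => // v hv; rewrite bethe_funE.
Qed.

Lemma kernel_neq0 n (x y : 'I_n -> int) : kernel x y != 0 ->
  exists s : 'S_n, forall j, ~~ (0 < sg * (x ((s^-1)%g j) - y j)).
Proof.
rewrite kernel_sum => h; apply: contrapT => no; move/negP: h; apply; apply/eqP.
rewrite big1 // => s _.
have [j /negP] : exists j, ~ ~~ (0 < sg * (x ((s^-1)%g j) - y j)).
  by apply: contrapT => nj; apply: no; exists s => j; apply: contrapT => hj; apply: nj; exists j.
by rewrite negbK; exact: bethe_term_vanish.
Qed.

(** The permutations that fix the first root reproduce the Bethe function of the other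
    particles: the scattering factors of the first root cancel against the denominator.
    *)
Lemma bethe_fun_cons n (x y : 'I_n.+1 -> int) (v : n.+1.-tuple C) : on_torus rho v ->
  \sum_(s : 'S_n.+1 | s ord0 == ord0) bethe_term x y s v =
  thead v ^ (x ord0 - y ord0 - 1) * bethe_fun (x \o lift ord0) (y \o lift ord0) [tuple of behead v].
Proof.
move=> hv; under eq_bigr do rewrite bethe_termE //.
rewrite -!big_distrl /= Phi_head expr0 mul1r.
case: (tupleP v) hv => z w hv; rewrite theadE tnth0.
have -> : [tuple of behead [tuple of z :: w]] = w by exact/val_inj.
have tw : tnth [tuple of z :: w] \o lift ord0 = tnth w by apply/funext => i /=; rewrite tnthS.
have hz : cabs z = rho by have := hv ord0; rewrite tnth0.
have hw : on_torus rho w by move=> i; have := hv (lift ord0 i); rewrite tnthS.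
have z0 : z != 0 by rewrite cabs_neq0.
rewrite /plane big_ord_recl tnth0 pair_prod_recl tw tnth0 /bethe_fun /plane.
under [X in _ * (_ * X) / _]eq_bigr do rewrite tnthS.
under [X in X * _ * _ * (_ * _) / _]eq_bigr do rewrite tnthS.
under [X in _ * (_ * _) / (X * _)]eq_bigr do rewrite tnthS.
have P0 : \prod_(i < n) scat D z (tnth w i) != 0.
  by apply/prodf_neq0 => i _; apply: scat_neq0.
have Q0 := pair_prod_scat_neq0 hw.
have -> : z ^ (x ord0 - y ord0 - 1) = z ^ x ord0 * z ^ (- y ord0 - 1).
  by rewrite -expfzDr // addrA.
move: (pair_prod _ _) Q0 (\prod_(i < n) scat _ _ _) P0 (z ^ x ord0) (z ^ _) => q q0 p p0 a b.
move: (Phi _ _ _) (\prod_(_ < n) _) => c d.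
by field; rewrite p0 q0.
Qed.

Lemma kernel_cluster n (x y : 'I_n.+1 -> int) :
  (forall s : 'S_n.+1, s ord0 != ord0 -> I (bethe_term x y s) = 0) ->
  kernel x y = (x ord0 == y ord0)%:R * kernel (x \o lift ord0) (y \o lift ord0).
Proof.
move=> van; rewrite kernel_sum.
have -> : \sum_(s : 'S_n.+1) I (bethe_term x y s) =
    \sum_(s : 'S_n.+1 | s ord0 == ord0) I (bethe_term x y s).
  by rewrite (bigID (fun s : 'S_n.+1 => s ord0 == ord0)) /= [X in _ + X]big1 ?addr0.
rewrite -multi_circle_int_sum //; last by move=> s; exact: bethe_term_lap.
rewrite (eq_multi_circle_int rho_gt0 (bethe_fun_cons x y)) multi_circle_int_cons //; last exact: bethe_lap.
by rewrite -(inj_eq (addIr 1)) subrK addNr subr_eq0.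
Qed.

Definition bethe_energy n (v : n.-tuple C) : C := \sum_i (tnth v i + (tnth v i)^-1 - 2 * D).

Lemma bethe_energy_lap n : lap 0 (@bethe_energy n).
Proof.
apply: lap_sum => i; apply: lapD; last exact: lap_cst.
apply: lapD; last exact: (lap_eq _ (coord_lap0 i (-1))).
by apply: (lap_eq _ (coord_lap0 i 1)) => v _; rewrite expr1z.
Qed.

(** With [w] a function of the energy, this is the kernel of that function of the
    Hamiltonian; see [iter_Hxxz_bethe] and [psiE]. *)
Definition kernelw n (w : n.-tuple C -> C) (x y : 'I_n -> int) : C :=
  I (fun v => w v * bethe_fun x y v).

(** The Bethe functions satisfy the boundary condition for each value of the roots,
    hence so do their integrals, and the free Laplacian then acts by multiplication by
    the energy. *)
Lemma freeH_kernelw n (w : n.-tuple C -> C) (x y : 'I_n -> int) : lap 0 w -> incr x ->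
  freeH D (fun z => kernelw w z y) x = kernelw (fun v => bethe_energy v * w v) x y.
Proof.
move=> lw hx; have lk z : lap 0 (fun v => w v * bethe_fun z y v).
  by apply: (lapM rho_gt0) => //; exact: bethe_lap.
have v0 (v : n.-tuple C) : on_torus rho v -> forall i, tnth v i != 0.
  by move=> hv i; exact: (on_torus_neq0 rho_gt0).
rewrite freeH_boundary //; last first.
  move=> i j ij xji; rewrite /kernelw -multi_circle_intD // -multi_circle_intZ //.
  apply: eq_multi_circle_int => // v hv; rewrite /bethe_fun.
  have := Phi_boundary D (v0 v hv) ij xji.
  move: (Phi _ _ x) (Phi _ _ _) (Phi _ _ _) (_^-1) => a b c d abc.
  transitivity (w v * ((c + b) * plane y v * d)); first by ring.
  by rewrite abc; ring.
have lk1 z : lap 0 (fun v => - (2 * D) * (w v * bethe_fun z y v)) by apply: lapZ.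
transitivity (\sum_(i < n) I (fun v => (w v * bethe_fun (shift x i 1) y v +
    w v * bethe_fun (shift x i (-1)) y v) + - (2 * D) * (w v * bethe_fun x y v))).
  apply: eq_bigr => i _; rewrite multi_circle_intD //; last exact: lapD.
  by rewrite multi_circle_intD // multi_circle_intZ // mulNr.
rewrite -multi_circle_int_sum //; last by move=> i; apply: lapD => //; exact: lapD.
apply: eq_multi_circle_int => // v hv.
transitivity (w v * (\sum_(i < n) (Phi D (tnth v) (shift x i 1) + Phi D (tnth v) (shift x i (-1)))
    - \sum_(i < n) 2 * D * Phi D (tnth v) x) * plane y v / pair_prod (scat D) (tnth v)).
  rewrite -sumrB big_distrr !big_distrl /=; apply: eq_bigr => i _; rewrite /bethe_fun.
  by move: (Phi _ _ x) (Phi _ _ _) (Phi _ _ _) (_^-1) => a b c d; ring.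
rewrite Phi_laplacian; last exact: v0.
rewrite /bethe_fun /bethe_energy sumrB -big_distrl /= -!mulr_suml.
by move: (Phi _ _ _) (_^-1) => a b; ring.
Qed.

Lemma plane_shift n (y : 'I_n -> int) i d (v : n.-tuple C) : on_torus rho v ->
  plane (shift y i d) v = plane y v * tnth v i ^ (- d).
Proof.
move=> hv; rewrite /plane (bigD1 i) //= [in RHS](bigD1 i) //= shift_self.
rewrite mulrAC -expfzDr ?(on_torus_neq0 rho_gt0) //; congr (_ * _).
  by congr (_ ^ _); ring.
by apply: eq_bigr => j ji; rewrite shift_other.
Qed.

(** In the other argument the boundary condition only holds after integration. The
    combination of the three integrands equals [G], in which the scattering factor of
    the pair [i, j] has cancelled. What remains is symmetric in [v i] and [v j], apart
    from [Phi], which is antisymmetric; the integral over the torus therefore vanishes.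
    *)
Lemma kernel_boundary n (x y : 'I_n -> int) (i j : 'I_n) : j = i.+1 :> nat -> y j = y i + 1 ->
  kernel x (shift y i 1) + kernel x (shift y j (-1)) = 2 * D * kernel x y.
Proof.
move=> ij yij; have neqij : i != j by rewrite -val_eqE /= ij; lia.
apply/eqP; rewrite -subr_eq0; apply/eqP.
pose P (v : n.-tuple C) : C := \prod_(l | (l != i) && (l != j)) tnth v l ^ (- y l - 1).
pose G (v : n.-tuple C) : C := Phi D (tnth v) x * ((tnth v i * tnth v j) ^ (- y i - 2) * P v) /
   pair_prod_but (scat D) i j (tnth v).
have GE v : on_torus rho v -> G v = bethe_fun x (shift y i 1) v + bethe_fun x (shift y j (-1)) v
    + - (2 * D) * bethe_fun x y v.
  move=> hv; rewrite /bethe_fun !plane_shift // opprK expr1z exprN1.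
  have vi0 : tnth v i != 0 by exact: (on_torus_neq0 rho_gt0).
  have vj0 : tnth v j != 0 by exact: (on_torus_neq0 rho_gt0).
  have -> : plane y v = (tnth v i * tnth v j) ^ (- y i - 2) * P v * tnth v i.
    rewrite /plane (bigD1 i) //= (bigD1 j) /= 1?eq_sym // yij /P.
    rewrite exprzMl ?unitfE //.
    have -> : - y i - 1 = (- y i - 2) + 1 by ring.
    have -> : - (y i + 1) - 1 = - y i - 2 by ring.
    rewrite expfzDr // expr1z.
    by move: (\prod_(_ | _) _) (_ ^ _) (_ ^ _) => a b c; ring.
  rewrite (pair_prod_adjacent _ _ ij) /G.
  have s0 : scat D (tnth v i) (tnth v j) != 0 by rewrite scat_neq0.
  have := s0; rewrite {2 3 4}/scat; rewrite /scat in s0.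
  rewrite invfM.
  move: (_ ^ _) (P v) (pair_prod_but _ _ _ _)^-1 (Phi _ _ _) => a b c d _.
  move: (tnth v i) (tnth v j) vi0 vj0 s0 => p q p0 q0 s0.
  by field; rewrite p0 s0.
have lG : lap 0 G.
  apply: (lap_eq (fun v hv => esym (GE v hv))).
  by apply: lapD; [apply: lapD; exact: bethe_lap|apply: lapZ => //; exact: bethe_lap].
have -> : kernel x (shift y i 1) + kernel x (shift y j (-1)) - 2 * D * kernel x y = I G.
  rewrite (eq_multi_circle_int rho_gt0 GE) multi_circle_intD //; last first.
  - by apply: lapZ => //; exact: bethe_lap.
  - by apply: lapD; exact: bethe_lap.
  rewrite multi_circle_intD ?multi_circle_intZ ?mulNr //; exact: bethe_lap.
have anti v : G (permute_tuple (tperm i j) v) = -1 * G v.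
  rewrite /G (_ : tnth (permute_tuple (tperm i j) v) = tnth v \o tperm i j); last first.
    by apply/funext => l; rewrite tnth_mktuple.
  rewrite Phi_perm odd_tperm neqij pair_prod_but_tperm //= tpermL tpermR expr1.
  have -> : P (permute_tuple (tperm i j) v) = P v.
    by apply: eq_bigr => l /andP[li lj]; rewrite tnth_mktuple tpermD // eq_sym.
  by rewrite [tnth v j * _]mulrC; ring.
have := multi_circle_int_perm rho_gt0 (tperm i j) lG.
under [X in multi_circle_int _ X]eq_fun do rewrite anti.
rewrite multi_circle_intZ // mulN1r => e.
have : I G *+ 2 == 0 by rewrite mulr2n -{1}e addNr.
by rewrite mulrn_eq0 => /eqP.
Qed.

Lemma freeH_kernel_right n (x y : 'I_n -> int) : incr y ->
  freeH D (kernel x) y = kernelw (@bethe_energy n) x y.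
Proof.
move=> hy; rewrite freeH_boundary //; last by move=> i j; exact: kernel_boundary.
have lb z : lap 0 (bethe_fun x z) by exact: bethe_lap.
transitivity (\sum_(i < n) I (fun v => (bethe_fun x (shift y i 1) v +
    bethe_fun x (shift y i (-1)) v) + - (2 * D) * bethe_fun x y v)).
  apply: eq_bigr => i _; rewrite multi_circle_intD //; [|exact: lapD|exact: lapZ].
  by rewrite multi_circle_intD // multi_circle_intZ // mulNr.
rewrite -multi_circle_int_sum //; last by move=> i; apply: lapD; [exact: lapD|exact: lapZ].
apply: eq_multi_circle_int => // v hv; rewrite /bethe_energy big_distrl /=; apply: eq_bigr => i _.
rewrite /bethe_fun !plane_shift // opprK expr1z exprN1.
by move: (_^-1) (_^-1) => a b; ring.
Qed.

Lemma kernel_comm n (x y : 'I_n -> int) : incr x -> incr y ->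
  freeH D (fun z => kernel z y) x = freeH D (kernel x) y.
Proof.
move=> hx hy; rewrite freeH_kernel_right //.
have := freeH_kernelw y (@lap_cst _ rho n 0 1) hx.
rewrite /kernelw; under eq_fun do under eq_fun do rewrite mul1r.
by move=> ->; congr (I _); apply/funext => v; rewrite mulr1.
Qed.

Lemma kernel_size0 (x y : 'I_0 -> int) : kernel x y = 1.
Proof.
by rewrite /kernel /= /bethe_fun /plane /pair_prod !big_ord0 divr1 mulr1 Phi_size0.
Qed.

Hypothesis sgE : sg = 1 \/ sg = -1.

(** If the amplitudes are analytic inside the circle, a nonzero value of the kernel
    forces [x <= y] in each coordinate; if they are analytic outside, it forces [y <=
    x], and the uniqueness argument is applied with the arguments exchanged. *)
Theorem bethe_orthogonality n (x y : 'I_n -> int) : incr x -> incr y -> kernel x y = delta C x y.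
Proof.
case: sgE => sg1 hx hy.
  apply: (@kernel_delta C D kernel) => //; first exact: kernel_size0.
  - move=> m a b ha hb /kernel_neq0[s hs]; apply: (@incr_perm_le _ a b s^-1%g) => // j.
    by have := hs j; rewrite sg1 mul1r -leNgt subr_le0.
  - exact: kernel_comm.
  - move=> m a b ha hb hab; apply: kernel_cluster => s s0.
    apply: (@bethe_term_vanish _ _ _ _ ord0); rewrite sg1 mul1r subr_gt0.
    case: (unliftP ord0 ((s^-1)%g ord0)) => [j ->//|e].
    by move: s0; rewrite -[X in s X]e permKV eqxx.
have -> : delta C x y = delta C y x.
  by congr (_%:R); congr nat_of_bool; apply: eq_forallb => i; rewrite eq_sym.
apply: (@kernel_delta C D (fun m a b => kernel b a)) => //; first by move=> a b; exact: kernel_size0.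
- move=> m a b ha hb /kernel_neq0[s hs]; apply: (@incr_perm_le _ a b s) => // j.
  by have := hs (s j); rewrite permK sg1 mulN1r oppr_gt0 -leNgt subr_ge0.
- by move=> m a b ha hb; rewrite kernel_comm.
- move=> m a b ha hb hab; rewrite eq_sym; apply: kernel_cluster => s s0.
  apply: (@bethe_term_vanish _ _ _ _ (s ord0)); rewrite permK sg1 mulN1r oppr_gt0 subr_lt0.
  by case: (unliftP ord0 (s ord0)) s0 => [j ->//|->]; rewrite eqxx.
Qed.
End AnalyticKernel.

(** * Configurations as increasing functions *)

Lemma sum_map_enum (V : nmodType) n (h : 'I_n -> int) (F : int -> V) :
  \sum_(j <- [seq h i | i <- enum 'I_n]) F j = \sum_i F (h i).
Proof. by rewrite (@big_map _ _ _ _ _ h (enum 'I_n)) big_enum. Qed.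

Section Configurations.
Variable N : nat.
Implicit Types X Y : config N.

Definition positions X : 'I_N -> int := fun i => pos X i.

Lemma size_sort_config X : size (sort <=%R (val X : {fset int})) = N.
Proof. by rewrite size_sort; exact/eqP/(valP X). Qed.

Lemma positions_incr X : incr (positions X).
Proof.
move=> i j ij; rewrite /positions /pos.
have srt : sorted <%R (sort <=%R (val X : {fset int})) by rewrite sort_lt_sorted fset_uniq.
by apply: (sorted_ltn_nth lt_trans 0 srt) => //; rewrite inE size_sort_config.
Qed.

Lemma mem_positions X k : (k \in val X) = [exists i, positions X i == k].
Proof.
rewrite -(mem_sort <=%R); apply/(nthP 0)/existsP => [[j + <-]|[i /eqP <-]].
  by rewrite size_sort_config => jN; exists (Ordinal jN).
by exists i => //; rewrite size_sort_config.
Qed.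

Lemma positions_inj : injective positions.
Proof.
move=> X Y XY; apply/val_inj/fsetP => k; rewrite !mem_positions.
by apply: eq_existsb => i; rewrite XY.
Qed.

Lemma incr_sorted (x : 'I_N -> int) : incr x -> sorted <%R [seq x i | i <- enum 'I_N].
Proof.
move=> hx; rewrite sorted_map; apply: (sub_sorted (e := relpre val ltn)).
  by move=> i j; exact: hx.
by have := iota_ltn_sorted 0 N; rewrite -val_enum_ord sorted_map.
Qed.

(** A strictly sorted sequence is determined by its set of entries. *)
Lemma incr_unique (x y : 'I_N -> int) : incr x -> incr y ->
  (forall k, [exists i, x i == k] = [exists i, y i == k]) -> x = y.
Proof.
move=> hx hy xy.
have E : [seq x i | i <- enum 'I_N] = [seq y i | i <- enum 'I_N].
  apply: (lt_sorted_eq (incr_sorted hx) (incr_sorted hy)) => k.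
  have M (z : 'I_N -> int) : (k \in [seq z i | i <- enum 'I_N]) = [exists i, z i == k].
    apply/mapP/existsP => [[i _ ->]|[i /eqP <-]]; first by exists i.
    by exists i => //; rewrite mem_enum.
  by rewrite !M.
apply/funext => i.
have M (z : 'I_N -> int) : nth 0 [seq z i | i <- enum 'I_N] i = z i.
  by rewrite (@nth_map _ i _ 0 z i (enum 'I_N)) ?size_enum_ord // nth_ord_enum.
by rewrite -[LHS]M -[RHS]M E.
Qed.

Lemma positions_surj (x : 'I_N -> int) : incr x -> exists X, positions X = x.
Proof.
move=> hx.
have cx : #|` [fset x i | i in 'I_N]%fset| == N.
  rewrite card_imfset /=; last exact: incr_inj.
  by rewrite size_enum_ord.
exists (Sub [fset x i | i in 'I_N]%fset cx); apply: incr_unique => //; first exact: positions_incr.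
move=> k; rewrite -mem_positions /=; apply/imfsetP/existsP => [[i _ ->]|[i /eqP <-]].
  by exists i.
by exists i.
Qed.

Lemma positions_exchange_up X i : freeup (positions X) i ->
  positions (exchange (positions X i) X) = shift (positions X) i 1.
Proof.
move=> hi; have xI := incr_inj (positions_incr X).
apply: incr_unique; [exact: positions_incr|exact: incr_up (positions_incr X) hi|].
have sw j : swap (positions X i) (positions X j) = shift (positions X) i 1 j.
  rewrite /swap /shift (inj_eq xI); have /forallP/(_ j)/negPf -> := hi.
  by case: (j =P i) => [->|].
move=> k; rewrite -mem_positions /=.
apply/imfsetP/existsP => /= [[l + ->]|[j /eqP <-]].
  by rewrite mem_positions => /existsP[j /eqP <-]; exists j; rewrite sw.
by exists (positions X j); [rewrite mem_positions; apply/existsP; exists j|rewrite sw].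
Qed.

Lemma positions_exchange_dn X i : freedn (positions X) i ->
  positions (exchange (positions X i - 1) X) = shift (positions X) i (-1).
Proof.
move=> hi; have xI := incr_inj (positions_incr X).
apply: incr_unique; [exact: positions_incr|exact: incr_dn (positions_incr X) hi|].
have sw j : swap (positions X i - 1) (positions X j) = shift (positions X) i (-1) j.
  rewrite /swap /shift subrK (inj_eq xI); have /forallP/(_ j)/negPf -> := hi.
  by case: (j =P i) => [->|].
move=> k; rewrite -mem_positions /=.
apply/imfsetP/existsP => /= [[l + ->]|[j /eqP <-]].
  by rewrite mem_positions => /existsP[j /eqP <-]; exists j; rewrite sw.
by exists (positions X j); [rewrite mem_positions; apply/existsP; exists j|rewrite sw].
Qed.

Section Hamiltonian.
Variables (K : realType) (Delta : K).
Local Notation C := K[i].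
Local Notation D := (Delta%:C : C).

(** A bond contributes when exactly one of its ends is occupied: it is then indexed by
    the particle at its left end or by the one at its right end. *)
Lemma HxxzE (f : config N -> C) X : Hxxz Delta f X =
  \sum_(i | freeup (positions X) i) (f (exchange (positions X i) X) - D * f X) +
  \sum_(i | freedn (positions X) i) (f (exchange (positions X i - 1) X) - D * f X).
Proof.
set x := positions X; have xI : injective x := incr_inj (positions_incr X).
pose F j := f (exchange j X) - D * f X.
pose A j := if (j \in val X) && (j + 1 \notin val X) then F j else 0.
pose B j := if (j \notin val X) && (j + 1 \in val X) then F j else 0.
pose xs := [seq x i | i <- enum 'I_N]; pose ys := [seq x i - 1 | i <- enum 'I_N].
have xsX j : (j \in xs) = (j \in val X).
  rewrite mem_positions; apply/mapP/existsP => [[i _ ->]|[i /eqP <-]]; first by exists i.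
  by exists i => //; rewrite mem_enum.
have ysX j : (j \in ys) = (j + 1 \in val X).
  rewrite mem_positions; apply/mapP/existsP => [[i _ ->]|[i /eqP hi]].
    by exists i; rewrite subrK.
  by exists i; [rewrite mem_enum|rewrite /x hi addrK].
have uxs : uniq xs by rewrite map_inj_uniq ?enum_uniq.
have uys : uniq ys.
  by rewrite map_inj_uniq ?enum_uniq // => i j /addIr /xI.
have T (r : seq int) (G : int -> C) : uniq r -> (forall j, j \notin r -> G j = 0) ->
    \sum_(j \in [set: int]) G j = \sum_(j <- r) G j.
  move=> ur G0; rewrite (fsbigE r) //; last by move=> j _; exact: G0.
  by apply: eq_bigl => j; rewrite in_setT.
pose r := undup (xs ++ ys).
have ur : uniq r by exact: undup_uniq.
have A0 j : j \notin r -> A j = 0.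
  by rewrite mem_undup mem_cat negb_or xsX /A => /andP[/negPf ->].
have B0 j : j \notin r -> B j = 0.
  by rewrite mem_undup mem_cat negb_or ysX /B andbC => /andP[/negPf ->]; rewrite andbF.
have AB j : hloc Delta j f X = A j + B j.
  rewrite /hloc /half_filled /A /B /F.
  by case: (j \in val X); case: (j + 1 \in val X); rewrite /= ?addr0 ?add0r // mulNr addrC.
transitivity (\sum_(j <- xs) A j + \sum_(j <- ys) B j).
  rewrite /Hxxz (T r) //; last by move=> j jr; rewrite AB A0 // B0 // addr0.
  under eq_bigr do rewrite AB.
  rewrite big_split /= -(T r) // -(T r B) // (T xs) // ?(T ys) //.
  - by move=> j; rewrite ysX /B => /negPf ->; rewrite andbF.
  - by move=> j; rewrite xsX /A => /negPf ->.
rewrite !sum_map_enum; congr (_ + _); rewrite [RHS]big_mkcond /=; apply: eq_bigr => i _.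
  rewrite /A mem_positions (_ : [exists _, _] = true); last by apply/existsP; exists i.
  rewrite mem_positions /= (_ : ~~ _ = freeup x i) // negb_exists.
  by apply: eq_forallb.
rewrite /B subrK mem_positions.
rewrite [X in _ && X]mem_positions (_ : [exists j, positions X j == x i] = true) ?andbT.
  rewrite (_ : ~~ _ = freedn x i) // negb_exists; exact: eq_forallb.
by apply/existsP; exists i.
Qed.

Lemma Hxxz_positions (g : ('I_N -> int) -> C) X :
  Hxxz Delta (fun Y => g (positions Y)) X = freeH D g (positions X).
Proof.
rewrite HxxzE; congr (_ + _); apply: eq_bigr => i hi.
  by rewrite positions_exchange_up.
by rewrite positions_exchange_dn.
Qed.
End Hamiltonian.
End Configurations.

(** * Radii on which the scattering factor is invertible *)

Section Radii.
Variables (K : realType) (Delta : K).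
Local Notation C := K[i].
Local Notation D := (Delta%:C : C).

(** The hypotheses of [bethe_orthogonality] on the scattering factor, collected for one
    radius. *)
Definition bethe_radius (rho : K) : Prop := 0 < rho /\
  exists sg : int, exists k : nat, exists phi : C -> C -> C,
  [/\ sg = 1 \/ sg = -1,
      forall n (i j : 'I_n), lap rho sg (fun v => phi (tnth v i) (tnth v j)),
      forall n (i j : 'I_n), lap rho sg (fun v => (phi (tnth v i) (tnth v j))^-1),
      forall a b, cabs a = rho -> cabs b = rho -> scat D a b = (a * b) ^+ k * phi a b &
      forall a b, cabs a = rho -> cabs b = rho -> phi a b != 0].

Lemma one_sub_neq0 (z : C) (q : K) : q < 1 -> cabs z <= q -> 1 - z != 0.
Proof.
move=> q1 zq; rewrite subr_eq0; apply: contraTneq zq => <-.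
by rewrite cabs1 -ltNge.
Qed.

Lemma cabs_2Delta : cabs (2 * D) = 2 * `|Delta|.
Proof. by rewrite cabsM cabs_real (cabs_nat _ 2). Qed.

(** Here the scattering factor itself is close to 1, and its inverse is a geometric
    series in the roots. *)
Lemma small_bethe_radius (r : K) : 0 < r -> 2 * `|Delta| * r + r ^+ 2 < 1 -> bethe_radius r.
Proof.
move=> r0 r1; split=> //; exists 1, 0%N, (scat D).
have co n (i : 'I_n) : lap r 1 (fun v => tnth v i).
  by apply: (lap_eq (f := fun v => tnth v i ^ 1)) => [v _|]; rewrite ?expr1z //; exact: lap_coord.
pose g a b : C := 2 * D * a - a * b.
have gE a b : scat D a b = 1 - g a b by rewrite /scat /g; ring.
have gl n (i j : 'I_n) : lap r 1 (fun v => g (tnth v i) (tnth v j)).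
  apply: lapD; first exact: lapZ.
  apply: (lap_eq (f := fun v => -1 * (tnth v i * tnth v j))) => [v _|]; first by rewrite mulN1r.
  by apply: lapZ => //; exact: lapM.
have gB a b : cabs a = r -> cabs b = r -> cabs (g a b) <= 2 * `|Delta| * r + r ^+ 2.
  move=> ha hb; apply: le_trans (cabsD _ _) _.
  by rewrite cabsN (cabsM a) cabsM cabs_2Delta ha hb expr2.
split; first by left.
- move=> n i j; apply: (lap_eq (f := fun v => 1 + -1 * g (tnth v i) (tnth v j))) => [v _|].
    by rewrite gE mulN1r.
  by apply: lapD; [exact: lap_cst|exact: lapZ].
- move=> n i j; apply: (lap_eq (f := fun v => (1 - g (tnth v i) (tnth v j))^-1)) => [v _|].
    by rewrite gE.
  apply: (lap_geometric r0 (q := 2 * `|Delta| * r + r ^+ 2)) => //.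
    by rewrite r1 andbT addr_ge0 ?sqr_ge0 // mulr_ge0 ?mulr_ge0 // ltW.
  by move=> v hv; exact: gB.
- by move=> a b _ _; rewrite expr0 mul1r.
- by move=> a b ha hb; rewrite gE; exact: one_sub_neq0 r1 (gB a b ha hb).
Qed.

(** After division by [a * b] the scattering factor is [1 + (a * b)^-1 - 2 D b^-1], and
    its inverse is a geometric series in the inverses of the roots. *)
Lemma large_bethe_radius (R : K) : 0 < R -> 2 * `|Delta| / R + R ^- 2 < 1 -> bethe_radius R.
Proof.
move=> R0 R1; split=> //.
pose g a b : C := 2 * D * b^-1 - a^-1 * b^-1.
exists (-1), 1%N, (fun a b => 1 - g a b).
have co n (i : 'I_n) : lap R (-1) (fun v => (tnth v i)^-1).
  by apply: (lap_eq (f := fun v => tnth v i ^ (-1))) => [v _|]; rewrite ?exprN1 //; exact: lap_coord.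
have gl n (i j : 'I_n) : lap R (-1) (fun v => g (tnth v i) (tnth v j)).
  apply: lapD; first exact: lapZ.
  apply: (lap_eq (f := fun v => -1 * ((tnth v i)^-1 * (tnth v j)^-1))) => [v _|]; first by rewrite mulN1r.
  by apply: lapZ => //; exact: lapM.
have gB a b : cabs a = R -> cabs b = R -> cabs (g a b) <= 2 * `|Delta| / R + R ^- 2.
  move=> ha hb; apply: le_trans (cabsD _ _) _.
  by rewrite cabsN (cabsM a^-1) cabsM cabs_2Delta !cabsV ha hb expr2 invfM.
split; first by right.
- move=> n i j; apply: (lap_eq (f := fun v => 1 + -1 * g (tnth v i) (tnth v j))) => [v _|].
    by rewrite mulN1r.
  by apply: lapD; [exact: lap_cst|exact: lapZ].
- move=> n i j.
  apply: (lap_geometric R0 (q := 2 * `|Delta| / R + R ^- 2)) => //.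
    by rewrite R1 andbT addr_ge0 ?invr_ge0 ?sqr_ge0 // divr_ge0 ?mulr_ge0 // ltW.
  by move=> v hv; exact: gB.
- move=> a b ha hb; have a0 : a != 0 by rewrite -cabs_eq0 ha gt_eqF.
  have b0 : b != 0 by rewrite -cabs_eq0 hb gt_eqF.
  by rewrite /g /scat expr1; field; rewrite a0 b0.
- by move=> a b ha hb; exact: one_sub_neq0 R1 (gB a b ha hb).
Qed.

Let sign_Delta : exists s : K, [/\ s * s = 1, s * `|Delta| = Delta & `|s| = 1].
Proof.
have [h|h] := lerP 0 Delta.
  by exists 1; rewrite mulr1 mul1r normr1 ger0_norm.
by exists (- 1); rewrite mulrNN mulr1 normrN normr1 ltr0_norm // mulrNN mul1r.
Qed.

Let scat_real (a b : K) :
  (1 + a%:C * b%:C - 2 * D * a%:C != 0) = (1 + a * b - 2 * Delta * a != 0).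
Proof.
rewrite -[in RHS](inj_eq (@complexI K)); congr (_ != _).
by rewrite rmorphB rmorphD !rmorphM rmorph1 /= rmorph_nat.
Qed.

(** If the bound failed, the scattering factor would have a zero at explicit real points
    of modulus at most [r]; the sign of [Delta] decides which. That it has no zero in
    the closed bidisc is thus equivalent to the estimate that makes the geometric series
    converge. *)
Lemma small_radius_bound (r : K) : 0 < r ->
  (forall z w : C, `|z| <= r%:C -> `|w| <= r%:C -> 1 + z * w - 2 * D * z != 0) ->
  2 * `|Delta| * r + r ^+ 2 < 1.
Proof.
move=> r0 h; rewrite ltNge; apply/negP => r1.
have h' (a b : K) : `|a| <= r -> `|b| <= r -> 1 + a * b - 2 * Delta * a != 0.
  by move=> ha hb; rewrite -scat_real; apply: h; rewrite cabsE cabs_real lecR.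
have [s [s2 sD ns]] := sign_Delta.
have E a b : 1 + (s * a) * (- s * b) - 2 * Delta * (s * a) = 1 - a * b - 2 * `|Delta| * a.
  rewrite -[Delta in LHS]sD; transitivity (1 - (s * s) * (a * b) - 2 * `|Delta| * (s * s) * a); first by ring.
  by rewrite s2; ring.
have [big|small] := lerP 1 (2 * `|Delta| * r).
  have D0 : 0 < 2 * `|Delta|.
    by rewrite -(pmulr_lgt0 _ r0); apply: lt_le_trans big.
  (* With second argument 0 the factor vanishes at [(2 Delta)^-1], which lies in the
     disc. *)
  have := h' (s * (2 * `|Delta|)^-1) (- s * 0).
  rewrite E !mulr0 subr0 (mulfV (lt0r_neq0 D0)) subrr eqxx normr0 normrM ns mul1r.
  rewrite gtr0_norm ?invr_gt0 // => H.
  suff : false by []. apply: H; last exact: ltW.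
  by rewrite -(ler_pM2l D0) (mulfV (lt0r_neq0 D0)).
have := h' (s * r) (- s * ((1 - 2 * `|Delta| * r) / r)).
have e : r * ((1 - 2 * `|Delta| * r) / r) = 1 - 2 * `|Delta| * r.
  by rewrite mulrC divfK // lt0r_neq0.
rewrite E e subKr subrr eqxx !normrM normrN ns !mul1r (gtr0_norm r0).
move=> H; suff : false by []. apply: H => //.
rewrite normfV (gtr0_norm r0) gtr0_norm ?subr_gt0 // ler_pdivrMr // -expr2; lra.
Qed.

(** As for the small radius: at the real points [- s R] and [s (2 |Delta| + R^-1)], with
    [s] the sign of [Delta], the scattering factor vanishes, and the second one has
    modulus at least [R] if the bound fails. *)
Lemma large_radius_bound (R : K) : 0 < R ->
  (forall z w : C, R%:C <= `|z| -> R%:C <= `|w| -> 1 + z * w - 2 * D * z != 0) ->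
  2 * `|Delta| / R + R ^- 2 < 1.
Proof.
move=> R0 h; rewrite ltNge; apply/negP => R1.
have h' (a b : K) : R <= `|a| -> R <= `|b| -> 1 + a * b - 2 * Delta * a != 0.
  by move=> ha hb; rewrite -scat_real; apply: h; rewrite cabsE cabs_real lecR.
have [s [s2 sD ns]] := sign_Delta.
have := h' (- s * R) (s * (2 * `|Delta| + R^-1)).
rewrite !normrM normrN ns !mul1r (gtr0_norm R0) lexx ger0_norm; last first.
  by rewrite addr_ge0 ?mulr_ge0 // invr_ge0 ltW.
have -> : R <= 2 * `|Delta| + R^-1.
  have := ler_wpM2l (ltW R0) R1; rewrite mulr1 => /le_trans; apply.
  rewrite le_eqVlt; apply/orP; left; apply/eqP; field; exact: lt0r_neq0.
move=> /(_ isT isT)/negP; apply; apply/eqP.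
have DE : 2 * Delta * (- s * R) = - (2 * `|Delta| * (s * s) * R) by rewrite -{1}sD; ring.
rewrite DE.
transitivity (1 - (s * s) * (2 * `|Delta| * R + R * R^-1) + 2 * `|Delta| * (s * s) * R); first by ring.
rewrite s2 (mulfV (lt0r_neq0 R0)); ring.
Qed.
End Radii.

(** * Bethe-ansatz formula for the wave function *)

Section SumsOverSequences.
Variables (K : realType) (T : choiceType).

Lemma esum_le_seq (S : set T) (a : T -> K) (M : K) :
  (forall s : seq T, uniq s -> {in s, forall x, S x} -> \sum_(x <- s) a x <= M) ->
  (\esum_(x in S) (a x)%:E <= M%:E)%E.
Proof.
move=> h; apply: ge_ereal_sup => _ [A [Af AS] <-].
rewrite fsbig_finite //= sumEFin lee_fin; apply: h => [|x]; first exact: fset_uniq.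
by rewrite in_fset_set // inE => /AS.
Qed.

Lemma esum_ge_seq (S : set T) (a : T -> K) (s : seq T) :
  uniq s -> {in s, forall x, S x} -> ((\sum_(x <- s) a x)%:E <= \esum_(x in S) (a x)%:E)%E.
Proof.
move=> us sS; apply: esum_ge; exists [set` s]; first by split => [|x /= /sS]; [exact: finite_seq|].
by rewrite -fsbig_seq // sumEFin.
Qed.
End SumsOverSequences.

Section TimeEvolution.
Variables (K : realType) (Delta : K) (N : nat).
Local Notation C := K[i].
Local Notation D := (Delta%:C : C).
Implicit Types (X Y : config N) (f g : config N -> C).

(** The exponential series is estimated in the norm of l^1, which bounds the norm of l^2
    and needs no Cauchy-Schwarz inequality. *)
Definition l1_bounded f (M : K) := forall s : seq (config N), uniq s -> \sum_(X <- s) cabs (f X) <= M.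

Lemma l1_move f M (i : 'I_N) (p : config N -> bool) (m : config N -> config N) (d : int) :
  l1_bounded f M -> (forall X, p X -> positions (m X) = shift (positions X) i d) ->
  forall s : seq (config N), uniq s -> \sum_(X <- s | p X) cabs (f (m X)) <= M.
Proof.
move=> fM hm s us; rewrite -big_filter -(big_map m xpredT (fun X => cabs (f X))).
apply: fM; rewrite map_inj_in_uniq ?filter_uniq // => X X'.
rewrite !mem_filter => /andP[pX _] /andP[pX' _] mXX'; apply: positions_inj.
by rewrite -[LHS](shiftK _ i d) -[RHS](shiftK _ i d) -!hm // mXX'.
Qed.

(** Each of the [N] particles makes at most two moves, and a move is injective on the
    configurations that allow it. *)
Lemma l1_Hxxz f M : 0 <= M -> l1_bounded f M ->
  l1_bounded (Hxxz Delta f) ((2 * (1 + `|Delta|) * N%:R) * M).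
Proof.
move=> M0 fM s us.
have part (p : 'I_N -> config N -> bool) (m : 'I_N -> config N -> config N) (d : int) :
    (forall i X, p i X -> positions (m i X) = shift (positions X) i d) ->
    \sum_(X <- s) cabs (\sum_(i | p i X) (f (m i X) - D * f X)) <= (1 + `|Delta|) * N%:R * M.
  move=> hm; apply: (le_trans (y := \sum_(X <- s) \sum_(i | p i X) (cabs (f (m i X)) + `|Delta| * cabs (f X)))).
    apply: ler_sum => X _; apply: le_trans (cabs_sum _ _ _) _; apply: ler_sum => i _.
    by apply: le_trans (cabsD _ _) _; rewrite cabsN cabsM cabs_real.
  rewrite (exchange_big_dep xpredT) //=.
  apply: (le_trans (y := \sum_(i < N) (1 + `|Delta|) * M)).
    apply: ler_sum => i _; rewrite big_split mulrDl mul1r /=; apply: lerD.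
      exact: (l1_move fM (hm i)).
    rewrite -big_distrr /= ler_wpM2l //; apply: le_trans (fM s us).
    rewrite big_mkcond /=; apply: ler_sum => X _; case: ifP => // _; exact: cabs_ge0.
  by rewrite sumr_const card_ord -mulr_natr le_eqVlt; apply/orP; left; apply/eqP; ring.
have hu := part (fun i X => freeup (positions X) i) (fun i X => exchange (positions X i) X) 1
  (fun i X => @positions_exchange_up N X i).
have hd := part (fun i X => freedn (positions X) i) (fun i X => exchange (positions X i - 1) X) (-1)
  (fun i X => @positions_exchange_dn N X i).
apply: (le_trans (y := \sum_(X <- s)
  (cabs (\sum_(i | freeup (positions X) i) (f (exchange (positions X i) X) - D * f X)) +
   cabs (\sum_(i | freedn (positions X) i) (f (exchange (positions X i - 1) X) - D * f X))))).
  by apply: ler_sum => X _; rewrite HxxzE; exact: cabsD.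
rewrite big_split /=; apply: le_trans (lerD hu hd) _.
by rewrite le_eqVlt; apply/orP; left; apply/eqP; ring.
Qed.

Lemma l1_ket Y : l1_bounded (ket K Y : config N -> C) 1.
Proof.
move=> s us; have [Ys|Ys] := boolP (Y \in s).
  rewrite (bigD1_seq Y) //= /ket eqxx cabs1 big1 ?addr0 // => X /negPf ->.
  by rewrite cabs0.
rewrite big_seq big1 // => X Xs; rewrite /ket; case: eqP => [XY|_]; last by rewrite cabs0.
by rewrite -XY Xs in Ys.
Qed.

Let B : K := 2 * (1 + `|Delta|) * N%:R.
Let B0 : 0 <= B. Proof. by rewrite !mulr_ge0 // addr_ge0. Qed.

Lemma l1_iter Y k : l1_bounded (iter k (Hxxz Delta) (ket K Y)) (B ^+ k).
Proof.
elim: k => [|k IH]; first exact: l1_ket.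
by rewrite iterS exprS; apply: l1_Hxxz => //; rewrite exprn_ge0.
Qed.

Lemma Hxxz_conj f X : Hxxz Delta (fun Y => (f Y)^*%C) X = (Hxxz Delta f X)^*%C.
Proof.
rewrite !HxxzE rmorphD !rmorph_sum /=.
by congr (_ + _); apply: eq_bigr => i _; rewrite rmorphB rmorphM /= oppr0.
Qed.

(** The matrix elements of the powers of the Hamiltonian are real; conjugating the wave
    function hence amounts to reversing time. *)
Lemma iter_Hxxz_real Y k X :
  (iter k (Hxxz Delta) (ket K Y) X)^*%C = iter k (Hxxz Delta) (ket K Y) X.
Proof.
elim: k X => [|k IH] X; first by rewrite /= /ket conjc_nat.
rewrite iterS -Hxxz_conj; congr (Hxxz Delta _ X); apply/funext => Z; exact: IH.
Qed.

Definition ctends (u : nat -> C) (l : C) := forall e, 0 < e ->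
  exists n0, forall n, (n0 <= n)%N -> cabs (u n - l) <= e.

Lemma ctends_unique u l l' : ctends u l -> ctends u l' -> l = l'.
Proof.
move=> h h'; apply: (@cabs_eps _ _ _ 2) => // e e0.
have [n0 H] := h e e0; have [n1 H'] := h' e e0.
have A := H _ (leq_maxl n0 n1); have A' := H' _ (leq_maxr n0 n1).
set m := maxn n0 n1 in A A'.
have -> : l - l' = (u m - l') - (u m - l) by ring.
apply: le_trans (cabsD _ _) _; rewrite cabsN; lra.
Qed.

Lemma ctends_conj u l : ctends u l -> ctends (fun n => (u n)^*%C) l^*%C.
Proof.
move=> h e e0; have [n0 H] := h e e0; exists n0 => n /H.
by rewrite -[X in _ -> X <= e]cabs_conj rmorphB /= !conjcK.
Qed.

Section Radius.
Variable rho : K.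
Hypothesis rho_ok : bethe_radius Delta rho.

Let rho_gt0 : 0 < rho. Proof. by case: rho_ok. Qed.

Let bl n (x y : 'I_n -> int) : lap rho 0 (bethe_fun Delta x y).
Proof. by case: rho_ok => _ [sg [k [phi [sgE h1 h2 h3 h4]]]]; exact: (bethe_lap rho_gt0 h2 h3). Qed.

(** The case [k = 0] is the resolution of the identity [bethe_orthogonality]; each
    application of the Hamiltonian then multiplies the integrand by the energy. *)
Lemma iter_Hxxz_bethe Y k X : iter k (Hxxz Delta) (ket K Y) X =
  kernelw Delta rho (fun v => bethe_energy Delta v ^+ k) (positions X) (positions Y).
Proof.
case: rho_ok => _ [sg [kk [phi [sgE h1 h2 h3 h4]]]].
elim: k X => [|k IH] X.
  transitivity (kernel Delta rho (positions X) (positions Y)).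
    rewrite (bethe_orthogonality rho_gt0 h1 h2 h3 h4 sgE); do ?exact: positions_incr.
    rewrite /= /ket /delta; congr (_%:R); congr nat_of_bool.
    by apply/eqP/deltaP => [->//|/positions_inj].
  rewrite /kernelw; apply: eq_multi_circle_int => // v _.
  by rewrite expr0 mul1r.
rewrite iterS (_ : iter k _ _ = fun X => kernelw Delta rho (fun v => bethe_energy Delta v ^+ k)
  (positions X) (positions Y)); last by apply/funext => Z; exact: IH.
rewrite (Hxxz_positions _ (fun z => kernelw Delta rho _ z (positions Y))).
rewrite (freeH_kernelw rho_gt0 h2 h3).
- by apply: eq_multi_circle_int => // v _; rewrite exprS.
- apply: lapX => //; exact: bethe_energy_lap.
- exact: positions_incr.
Qed.

Lemma energy_exp_series (c : C) e : 0 < e -> exists n0, forall n, (n0 <= n)%N ->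
  forall v : N.-tuple C, on_torus rho v ->
  cabs (cexp (c * bethe_energy Delta v) - \sum_(k < n) (c * bethe_energy Delta v) ^+ k / k`!%:R) <= e.
Proof.
move=> e0.
have [M M0 EM] := lap_bounded rho_gt0 (lapZ rho_gt0 c (@bethe_energy_lap K Delta rho N)).
have [n0 H] := cexp_series (ltW M0) e0.
by exists n0 => n nn v hv; apply: H => //; exact: EM.
Qed.

Let exp_sum_lap (c : C) n :
  lap rho 0 (fun v : N.-tuple C => \sum_(k < n) (c * bethe_energy Delta v) ^+ k / k`!%:R).
Proof.
apply: lap_sum => k.
apply: (lap_eq (f := fun v => k`!%:R^-1 * (c * bethe_energy Delta v) ^+ k)) => [v _|]; first by rewrite mulrC.
by apply: lapZ => //; apply: lapX => //; apply: lapZ => //; exact: bethe_energy_lap.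
Qed.

Lemma energy_exp_lap (c : C) : lap rho 0 (fun v : N.-tuple C => cexp (c * bethe_energy Delta v)).
Proof.
apply: lap_ulim => e e0; have [n0 H] := energy_exp_series c e0.
exists (fun v => \sum_(k < n0) (c * bethe_energy Delta v) ^+ k / k`!%:R); first exact: exp_sum_lap.
by move=> v hv; exact: H.
Qed.

Lemma exp_kernelw_tends (c : C) (x y : 'I_N -> int) :
  ctends (fun n => \sum_(k < n) c ^+ k / k`!%:R *
     kernelw Delta rho (fun v => bethe_energy Delta v ^+ k) x y)
   (kernelw Delta rho (fun v => cexp (c * bethe_energy Delta v)) x y).
Proof.
move=> e e0.
have [M M0 bM] := lap_bounded rho_gt0 (bl x y).
have d0 : 0 < M * (2 * rho) ^+ N by rewrite mulr_gt0 // exprn_gt0 // mulr_gt0.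
have [n0 H] := energy_exp_series c (divr_gt0 e0 d0).
exists n0 => n nn.
have -> : \sum_(k < n) c ^+ k / k`!%:R * kernelw Delta rho (fun v => bethe_energy Delta v ^+ k) x y =
   multi_circle_int rho (fun v =>
     (\sum_(k < n) (c * bethe_energy Delta v) ^+ k / k`!%:R) * bethe_fun Delta x y v).
  have le k : lap rho 0 (fun v : N.-tuple C => bethe_energy Delta v ^+ k * bethe_fun Delta x y v).
    by apply: lapM => //; apply: lapX => //; exact: bethe_energy_lap.
  rewrite /kernelw; under eq_bigr do rewrite -multi_circle_intZ //.
  rewrite -multi_circle_int_sum //; last by move=> k; exact: lapZ.
  apply: eq_multi_circle_int => // v _; rewrite big_distrl /=; apply: eq_bigr => k _.
  by rewrite exprMn; ring.
rewrite cabsB; apply: le_trans (multi_circle_int_near rho_gt0 _ _ (e := e / (M * (2 * rho) ^+ N) * M) _) _.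
- by apply: lapM => //; exact: energy_exp_lap.
- by apply: lapM => //; exact: exp_sum_lap.
- move=> v hv; rewrite -mulrBl cabsM ler_pM ?cabs_ge0 ?bM //; exact: H.
by rewrite -mulrA divfK // gt_eqF.
Qed.
End Radius.
End TimeEvolution.

Section WaveFunction.
Variables (K : realType) (Delta : K) (N : nat) (t : K) (Y : config N).
Local Notation C := K[i].
Implicit Types (X : config N) (s : seq (config N)).

Let c : C := - 'i%C * t%:C.
Let ep n X : C := exp_partial Delta t (ket K Y) n X.
Let B : K := 2 * (1 + `|Delta|) * N%:R.

Lemma sum_sqr_le I (s : seq I) (a : I -> K) : (forall i, 0 <= a i) ->
  \sum_(i <- s) a i ^+ 2 <= (\sum_(i <- s) a i) ^+ 2.
Proof.
move=> a0; elim: s => [|i s IH]; first by rewrite !big_nil expr0n.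
have S0 : 0 <= \sum_(j <- s) a j by exact: sumr_ge0.
rewrite !big_cons sqrrD; have := mulr_ge0 (a0 i) S0; move: IH; lra.
Qed.

(** The powers of the Hamiltonian grow at most geometrically in l^1, so that the
    exponential series is dominated by a scalar one. *)
Lemma exp_partial_cauchy e : 0 < e -> exists n0, forall n m, (n0 <= n)%N -> (n <= m)%N ->
  forall s, uniq s -> \sum_(X <- s) cabs (ep m X - ep n X) <= e.
Proof.
move=> e0; have e2 : 0 < e / 2 by rewrite divr_gt0.
have tB0 : 0 <= `|t| * B by rewrite mulr_ge0 // !mulr_ge0 // addr_ge0.
have [n0 H] := cexp_series tB0 e2.
exists n0 => n m n0n nm s us.
have wz : cabs (`|t| * B)%:C <= `|t| * B by rewrite cabs_real ger0_norm.
have Hn := H n _ n0n wz; have Hm := H m _ (leq_trans n0n nm) wz.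
have split_sum (V : zmodType) (F : nat -> V) : \sum_(k < m) F k - \sum_(k < n) F k = \sum_(n <= k < m) F k.
  rewrite -!(big_mkord xpredT) (@big_cat_nat _ _ _ n 0 m) //=.
  by rewrite addrAC subrr add0r.
have ct : cabs c = `|t| by rewrite /c cabsM cabsN cabs_i mul1r cabs_real.
apply: (le_trans (y := \sum_(n <= k < m) (`|t| * B) ^+ k / k`!%:R)).
  apply: (le_trans (y := \sum_(X <- s) \sum_(n <= k < m)
     (`|t| ^+ k / k`!%:R * cabs (iter k (Hxxz Delta) (ket K Y) X)))).
    apply: ler_sum => X _; rewrite /ep /exp_partial.
    rewrite (split_sum _ (fun k => (- 'i%C * t%:C) ^+ k / (k`!)%:R * iter k (Hxxz Delta) (ket K Y) X)).
    apply: le_trans (cabs_sum _ _ _) _; apply: ler_sum => k _.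
    by rewrite cabsM cabsM cabsX cabsV (cabs_nat _ k`!) -/c ct.
  rewrite exchange_big /=; apply: ler_sum => k _; rewrite -big_distrr /= exprMn [X in _ <= X]mulrAC.
  by apply: ler_wpM2l; [rewrite divr_ge0 // exprn_ge0|exact: l1_iter].
have -> : \sum_(n <= k < m) (`|t| * B) ^+ k / k`!%:R =
   cabs (\sum_(k < m) ((`|t| * B)%:C : C) ^+ k / k`!%:R - \sum_(k < n) ((`|t| * B)%:C : C) ^+ k / k`!%:R).
  rewrite (split_sum _ (fun k => ((`|t| * B)%:C : C) ^+ k / k`!%:R)).
  rewrite (eq_bigr (fun k => ((`|t| * B) ^+ k / k`!%:R)%:C)); last first.
    by move=> k _; move: (`|t| * B) => z; rewrite rmorphM rmorphXn fmorphV rmorph_nat.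
  rewrite -rmorph_sum cabs_real [X in _ = X]ger0_norm //; apply: sumr_ge0 => k _.
  by rewrite divr_ge0 // exprn_ge0.
set S := cexp _ in Hn Hm; set sm := \sum_(k < m) _ in Hm *; set sn := \sum_(k < n) _ in Hn *.
have -> : sm - sn = (S - sn) - (S - sm) by ring.
by apply: le_trans (cabsD _ _) _; rewrite cabsN; lra.
Qed.

Lemma ctends_sum (u : nat -> config N -> C) (l : config N -> C) s e : 0 < e ->
  (forall X, ctends (u^~ X) (l X)) ->
  exists n0, forall n, (n0 <= n)%N -> \sum_(X <- s) cabs (u n X - l X) <= e.
Proof.
move=> e0 ul; elim: s e e0 => [|X s IH] e e0; first by exists 0%N => n _; rewrite big_nil ltW.
have e2 : 0 < e / 2 by rewrite divr_gt0.
have [n0 H0] := ul X _ e2; have [n1 H1] := IH _ e2.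
exists (maxn n0 n1) => n; rewrite geq_max => /andP[/H0 h0 /H1 h1].
rewrite big_cons; lra.
Qed.

Section Limit.
Variable F : config N -> C.
Hypothesis epF : forall X, ctends (ep^~ X) (F X).

(** Pointwise convergence improves to convergence in l^2: compare on a finite set of
    configurations with a partial sum so far that it is close to [F] there, and use the
    Cauchy estimate, which is uniform in the set. *)
Lemma exp_partial_l2 e : 0 < e -> exists n0, forall n, (n0 <= n)%N ->
  (l2dist2 (exp_partial Delta t (ket K Y) n) F <= (e ^+ 2)%:E)%E.
Proof.
move=> e0; have e2 : 0 < e / 2 by rewrite divr_gt0.
have [n0 H] := exp_partial_cauchy e2; exists n0 => n n0n.
rewrite /l2dist2; apply: esum_le_seq => s us _.
under eq_bigr do rewrite sqnormE.
apply: le_trans (sum_sqr_le _ _) _; first by move=> X; exact: cabs_ge0.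
rewrite lerXn2r ?nnegrE ?(ltW e0) //; first by apply: sumr_ge0 => X _; exact: cabs_ge0.
have [n1 H1] := ctends_sum s e2 epF.
have h1 := H1 _ (leq_maxr n n1); have h2 := H n _ n0n (leq_maxl n n1) s us.
set m := maxn n n1 in h1 h2.
apply: (le_trans (y := \sum_(X <- s) (cabs (ep m X - F X) + cabs (ep m X - ep n X)))).
  apply: ler_sum => X _; rewrite -/(ep n X).
  have -> : ep n X - F X = (ep m X - F X) - (ep m X - ep n X) by ring.
  by apply: le_trans (cabsD _ _) _; rewrite cabsN.
by rewrite big_split /=; lra.
Qed.

Lemma l2dist2_ge0 (f g : config N -> C) : (0 <= l2dist2 f g)%E.
Proof. by apply: esum_ge0 => X _; rewrite lee_fin sqnormE sqr_ge0. Qed.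

Lemma exp_partial_cvg : l2dist2 (exp_partial Delta t (ket K Y) n) F @[n --> \oo] --> 0%E.
Proof.
apply/fine_cvgP; split.
  have [n0 H] := exp_partial_l2 ltr01; exists n0 => // n /= n0n.
  rewrite ge0_fin_numE ?l2dist2_ge0 //; apply: le_lt_trans (H _ n0n) _; exact: ltry.
apply/cvgrPdist_le => e e0.
have se0 : 0 < Num.sqrt e by rewrite sqrtr_gt0.
have [n0 H] := exp_partial_l2 se0; exists n0 => // n /= n0n.
rewrite sub0r normrN ger0_norm ?fine_ge0 ?l2dist2_ge0 //.
have := H _ n0n; rewrite sqr_sqrtr ?(ltW e0) // => h.
rewrite -lee_fin fineK // ge0_fin_numE ?l2dist2_ge0 //; apply: le_lt_trans h _; exact: ltry.
Qed.

(** A limit in l^2 is also a pointwise limit, and pointwise limits are unique; hence the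
    limit chosen by [xget] is the function [F]. *)
Lemma exp_mitH_limit X : exp_mitH Delta t (ket K Y) X = F X.
Proof.
rewrite /exp_mitH.
set P := [set f | _]; have PF : P F by exact: exp_partial_cvg.
have : P (xget (fun=> 0) P) by exact: xgetI PF.
set G := xget _ _ => PG; apply: (@ctends_unique K (ep^~ X)); last exact: epF.
move=> e e0; have e20 : 0 < e ^+ 2 by rewrite exprn_gt0.
move: PG => /fine_cvgP[[n1 _ H1] /cvgrPdist_le /(_ _ e20) [n0 _ H0]].
exists (maxn n0 n1) => n; rewrite geq_max => /andP[/H0 /= + /H1 /=].
rewrite sub0r normrN ger0_norm ?fine_ge0 ?l2dist2_ge0 // => h hf.
rewrite -(ler_pXn2r (n := 2)) ?nnegrE ?cabs_ge0 ?(ltW e0) //.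
apply: le_trans h; rewrite -lee_fin fineK // -sqnormE.
apply: le_trans (@esum_ge_seq K _ [set: config N] (fun Z => sqnorm (ep n Z - G Z)) [:: X] _ _) => //.
by rewrite big_seq1.
Qed.
End Limit.

Lemma psiE rho X : bethe_radius Delta rho ->
  psi Delta Y X t = kernelw Delta rho (fun v => cexp (- 'i%C * t%:C * bethe_energy Delta v))
    (positions X) (positions Y).
Proof.
move=> ok; rewrite /psi; apply: (exp_mitH_limit (F := fun Z => kernelw Delta rho _ (positions Z) _)) => Z e e0.
have [n0 H] := exp_kernelw_tends ok (- 'i%C * t%:C) (positions Z) (positions Y) e0.
exists n0 => n /H; congr (cabs (_ - _) <= e); rewrite /ep /exp_partial.
by apply: eq_bigr => k _; rewrite (iter_Hxxz_bethe ok).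
Qed.

(** The conjugate of the wave function is again a contour integral, and its radius is
    independent of the one used for the wave function itself. *)
Lemma psi_conjE rho X : bethe_radius Delta rho ->
  (psi Delta Y X t)^*%C = kernelw Delta rho (fun v => cexp ('i%C * t%:C * bethe_energy Delta v))
    (positions X) (positions Y).
Proof.
move=> ok; rewrite (psiE _ ok).
apply: (ctends_unique (ctends_conj (exp_kernelw_tends ok _ _ _))) => e e0.
have [n0 H] := exp_kernelw_tends ok ('i%C * t%:C) (positions X) (positions Y) e0.
exists n0 => n /H; congr (cabs (_ - _) <= e).
rewrite rmorph_sum; apply: eq_bigr => k _ /=.
rewrite -!(iter_Hxxz_bethe ok) !rmorphM /= iter_Hxxz_real rmorphXn /= fmorphV rmorph_nat.
by congr (_ ^+ _ / _ * _); apply/eqP; rewrite eq_complex /=; apply/andP; split; apply/eqP; ring.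
Qed.
End WaveFunction.

(** * Summing products of plane waves over translated configurations *)

Section Cone.

(** Configurations to the right of a point are parametrised by the position [a] of the
    left-most particle and the configuration of the others relative to the site after
    it. *)
Definition cone_cons n (a : nat) (z : {ffun 'I_n -> int}) : {ffun 'I_n.+1 -> int} :=
  [ffun i => if unlift ord0 i is Some j then a%:Z + 1 + z j else a%:Z].

(** Finite exhaustion of the set of all [0 <= z_1 < ... < z_n]: the gaps are bounded by
    [L], so that the truncated sums still satisfy a recursion. *)
Fixpoint cone (L n : nat) : seq {ffun 'I_n -> int} :=
  match n with
  | 0 => [:: [ffun=> 0]]
  | m.+1 => [seq cone_cons a z | a <- iota 0 L, z <- cone L m]
  end.

Lemma cone_cons0 n a (z : {ffun 'I_n -> int}) : cone_cons a z ord0 = a%:Z.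
Proof. by rewrite ffunE unlift_none. Qed.

Lemma cone_consS n a (z : {ffun 'I_n -> int}) j : cone_cons a z (lift ord0 j) = a%:Z + 1 + z j.
Proof. by rewrite ffunE liftK. Qed.

Lemma cone_ge0 L n z : z \in cone L n -> forall i, 0 <= z i.
Proof.
elim: n z => [|n IH] z /=; first by move=> _ [].
case/allpairsP => -[a z'] /= [_ /IH z0 ->] i.
by case: (unliftP ord0 i) => [j|] ->; rewrite ?cone_consS ?cone_cons0 // !addr_ge0.
Qed.

Lemma cone_incr L n z : z \in cone L n -> incr z.
Proof.
elim: n z => [|n IH] z /=; first by move=> _ [].
case/allpairsP => -[a z'] /= [_ zc ->] i j; have hz := IH _ zc; have z0 := cone_ge0 zc.
case: (unliftP ord0 i) => [i'|] ->; case: (unliftP ord0 j) => [j'|] -> // ij.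
  by rewrite !cone_consS ltrD2l; apply: hz; move: ij; rewrite /= /bump /=; lia.
by rewrite cone_consS cone_cons0 ltr_wpDr // ltrDl.
Qed.

Lemma cone_cons_inj n a b (z w : {ffun 'I_n -> int}) :
  cone_cons a z = cone_cons b w -> a = b /\ z = w.
Proof.
move=> e; have ab : a = b.
  by have := congr1 (fun f : {ffun 'I_n.+1 -> int} => f ord0) e; rewrite /= !cone_cons0 => -[].
split=> //; apply/ffunP => i.
have := congr1 (fun f : {ffun 'I_n.+1 -> int} => f (lift ord0 i)) e.
by rewrite /= !cone_consS ab => /addrI.
Qed.

Lemma cone_uniq L n : uniq (cone L n).
Proof.
elim: n => [|n IH] //=; apply: allpairs_uniq => //; first exact: iota_uniq.
by move=> [a z] [b w] _ _ /= /cone_cons_inj[-> ->].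
Qed.

Lemma mem_cone n (z : {ffun 'I_n -> int}) : incr z -> (forall i, 0 <= z i) ->
  exists L0, forall L, (L0 <= L)%N -> z \in cone L n.
Proof.
elim: n z => [|n IH] z hz z0.
  by exists 0%N => L _; rewrite /= inE; apply/eqP/ffunP => -[].
pose a := `|z ord0|%N.
have az : a%:Z = z ord0 by rewrite /a; have := z0 ord0; lia.
pose z' : {ffun 'I_n -> int} := [ffun j => z (lift ord0 j) - a%:Z - 1].
have [|i|L0 H] := IH z'.
- by move=> i j ij; rewrite !ffunE !ltrD2r; apply: hz; rewrite /= /bump.
- by rewrite ffunE; have := hz ord0 (lift ord0 i) isT; rewrite -az; lia.
exists (maxn L0 a.+1) => L; rewrite geq_max => /andP[/H zc aL] /=.
apply/allpairsP; exists (a, z') => /=; split=> //; first by rewrite mem_iota.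
apply/ffunP => i; case: (unliftP ord0 i) => [j|] ->; rewrite ?cone_consS ?cone_cons0 ?ffunE //.
by ring.
Qed.
End Cone.

Section Convergence.
Variables (K : realType) (Delta : K).
Local Notation C := K[i].
Local Notation D := (Delta%:C : C).

Lemma Phi_translate n (v : 'I_n -> C) (z : 'I_n -> int) (c : int) : (forall i, v i != 0) ->
  Phi D v (fun i => c + z i) = (\prod_i v i) ^ c * Phi D v z.
Proof.
move=> v0; rewrite /Phi big_distrr /=; apply: eq_bigr => s _.
rewrite mulrCA; congr (_ * _).
have -> : (\prod_i v i) ^ c = \prod_i v (s i) ^ c.
  by rewrite exprz_prod [LHS](reindex_inj (@perm_inj _ s)).
by rewrite -big_split /=; apply: eq_bigr => i _; rewrite expfzDr.
Qed.

(** Expanding along the left-most particle and translating the other ones produces the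
    coefficient [lead] and the factor [(\prod v) ^+ a]. *)
Lemma Phi_cone_cons n (v : 'I_n.+1 -> C) a (z : {ffun 'I_n -> int}) : (forall i, v i != 0) ->
  Phi D v (cone_cons a z) =
  (\prod_i v i) ^+ a * \sum_i lead D v i * Phi D (v \o lift i) z.
Proof.
move=> v0; rewrite Phi_rec big_distrr /=; apply: eq_bigr => i _.
have -> : cone_cons a z \o lift ord0 = fun j => (a%:Z + 1) + z j.
  by apply/funext => j /=; rewrite cone_consS.
rewrite Phi_translate => [|j]; last exact: v0.
rewrite cone_cons0 (prod_lift v i) /= /lead big_split /= -exprnP -[a%:Z + 1]/(a + 1)%N%:Z -exprnP addn1 exprS exprMn.
move: (Phi _ _ _) (_ ^+ i) (\prod_(j < n) scat _ _ _) => p e S.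
have -> : \prod_i0 (v \o lift i) i0 = \prod_j v (lift i j) by [].
rewrite /scat.
by move: (\prod_j v (lift i j)) (\prod_(j < n) _) => b T; move: (b ^+ a) (v i ^+ a) => *; ring.
Qed.

Definition cone_sum L n (v w : 'I_n -> C) : C :=
  \sum_(z <- cone L n) Phi D v z * Phi D w z.

Lemma cone_sum_rec L n (v w : 'I_n.+1 -> C) : (forall i, v i != 0) -> (forall i, w i != 0) ->
  cone_sum L v w = (\sum_(a < L) ((\prod_i v i) * \prod_i w i) ^+ a) *
    \sum_i \sum_j lead D v i * lead D w j * cone_sum L (v \o lift i) (w \o lift j).
Proof.
move=> v0 w0; rewrite /cone_sum big_allpairs_dep /= big_distrl /=.
rewrite -[L in iota 0 L]subn0 -/(index_iota 0 L) big_mkord; apply: eq_bigr => a _.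
under eq_bigr do rewrite !Phi_cone_cons // mulrACA -exprMn.
rewrite -big_distrr /=; congr (_ * _).
under eq_bigr do rewrite big_distrlr /=.
rewrite exchange_big /=; apply: eq_bigr => i _.
rewrite exchange_big /=; apply: eq_bigr => j _.
by rewrite big_distrr /=; apply: eq_bigr => z _; rewrite mulrACA.
Qed.

Lemma cabs_lead n (rho : K) (v : 'I_n.+1 -> C) i : (forall i, cabs (v i) = rho) ->
  cabs (lead D v i) <= (rho * (1 + rho * rho + 2 * `|Delta| * rho)) ^+ n.
Proof.
move=> hv; rewrite /lead cabsM cabsX cabsN cabs1 expr1n mul1r cabs_prod.
rewrite -[n in X in _ <= X]card_ord -prodr_const; apply: ler_prod => j _.
rewrite cabs_ge0 /= cabsM hv; apply: ler_wpM2l; first by rewrite -(hv i) cabs_ge0.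
apply: le_trans (cabsD _ _) _; rewrite cabsN cabsM cabs_2Delta hv lerD2r.
by apply: le_trans (cabsD _ _) _; rewrite cabs1 cabsM !hv.
Qed.

Lemma cabs_prod_cst n (rho : K) (v : 'I_n -> C) : (forall i, cabs (v i) = rho) ->
  cabs (\prod_i v i) = rho ^+ n.
Proof.
by move=> hv; rewrite cabs_prod (eq_bigr _ (fun i _ => hv i)) prodr_const card_ord.
Qed.

(** The truncated sums and [pairing] obey the same recursion, except that the geometric
    series is cut off at [L]; since the ratio has modulus at most [R * r], the error is
    of order [(R * r) ^+ L]. *)
Lemma cone_sum_pairing n (R r : K) : 0 < R -> 0 < r -> R * r < 1 ->
  exists2 A, 0 <= A & forall v w : 'I_n -> C,
    (forall i, cabs (v i) = R) -> (forall i, cabs (w i) = r) ->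
    cabs (pairing D v w) <= A /\
    forall L, cabs (cone_sum L v w - pairing D v w) <= A * (R * r) ^+ L.
Proof.
move=> R0 r0 q1; elim: n => [|n [A A0 IH]].
  exists 1 => // v w _ _; rewrite /= cabs1; split=> // L.
  rewrite /cone_sum /= big_seq1 !Phi_size0 mulr1 subrr cabs0 mul1r exprn_ge0 //.
  by rewrite mulr_ge0 // ltW.
set q := R * r in q1 IH *.
have q0 : 0 <= q by rewrite mulr_ge0 // ltW.
have q1' : 0 < 1 - q by rewrite subr_gt0.
pose B rho := (rho * (1 + rho * rho + 2 * `|Delta| * rho)) ^+ n.
have B0 rho : 0 < rho -> 0 <= B rho.
  by move=> h; rewrite exprn_ge0 // mulr_ge0 ?(ltW h) // !addr_ge0 // ?mulr_ge0 // ltW.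
pose T := \sum_(i < n.+1) \sum_(j < n.+1) B R * B r * A.
have T0 : 0 <= T by do 2!(apply: sumr_ge0 => ? _); rewrite !mulr_ge0 ?B0.
exists (3 * T / (1 - q)) => [|v w hv hw]; first by rewrite divr_ge0 ?mulr_ge0 // ltW.
have v0 i : v i != 0 by rewrite -cabs_eq0 hv gt_eqF.
have w0 i : w i != 0 by rewrite -cabs_eq0 hw gt_eqF.
have double (f : 'I_n.+1 -> 'I_n.+1 -> C) (e : K) : (forall i j, cabs (f i j) <= A * e) ->
    cabs (\sum_i \sum_j lead D v i * lead D w j * f i j) <= T * e.
  move=> hf; apply: le_trans (cabs_sum _ _ _) _; rewrite big_distrl /=; apply: ler_sum => i _.
  apply: le_trans (cabs_sum _ _ _) _; rewrite big_distrl /=; apply: ler_sum => j _.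
  rewrite cabsM [X in X * _]cabsM -[leRHS]mulrA; apply: ler_pM; rewrite ?mulr_ge0 ?cabs_ge0 //.
  by apply: ler_pM; rewrite ?cabs_ge0 //; exact: cabs_lead.
rewrite /= -/(pairing D); set p := (\prod_i v i) * \prod_i w i.
have pq : cabs p <= q.
  rewrite /p cabsM (cabs_prod_cst hv) (cabs_prod_cst hw) -exprMn -/q exprS -[leRHS]mulr1.
  by apply: ler_wpM2l => //; rewrite exprn_ile1 // ltW.
have p1 : 1 - p != 0 by exact: (one_sub_neq0 q1).
have ip : cabs (1 - p)^-1 <= (1 - q)^-1.
  rewrite cabsV lef_pV2 ?posrE //; last by rewrite lt_def cabs_eq0 p1 cabs_ge0.
  have := cabsD (1 - p) p; rewrite subrK cabs1; lra.
set Sp := \sum_a \sum_b _; set g := (1 - p)^-1.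
have hSp : cabs Sp <= T.
  rewrite -[T]mulr1; apply: double => i j; rewrite mulr1.
  by have [] := IH (v \o lift i) (w \o lift j) (fun=> hv _) (fun=> hw _).
split=> [|L].
  rewrite cabsM; apply: le_trans (ler_pM (cabs_ge0 _) (cabs_ge0 _) ip hSp) _.
  by rewrite mulrC; apply: ler_wpM2r; [rewrite invr_ge0 ltW | lra].
rewrite cone_sum_rec // -/p; set SL := \sum_i \sum_j _; set gL := \sum_(a < L) _.
have hSL : cabs (SL - Sp) <= T * q ^+ L.
  have -> : SL - Sp = \sum_i \sum_j lead D v i * lead D w j *
     (cone_sum L (v \o lift i) (w \o lift j) - pairing D (v \o lift i) (w \o lift j)).
    rewrite -sumrB; apply: eq_bigr => i _; rewrite -sumrB; apply: eq_bigr => j _.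
    by rewrite mulrBr.
  apply: double => i j.
  by have [_] := IH (v \o lift i) (w \o lift j) (fun=> hv _) (fun=> hw _); apply.
(* The truncated geometric series. *)
have gE : gL = g - g * p ^+ L.
  apply: (mulfI p1); rewrite -[LHS]opprK -mulNr opprB -subrX1.
  by rewrite mulrBr mulrA /g mulfV // mul1r opprB.
have gpL : cabs (g * p ^+ L) <= (1 - q)^-1 * q ^+ L.
  rewrite cabsM cabsX; apply: ler_pM; rewrite ?exprn_ge0 ?cabs_ge0 //.
  by apply: lerXn2r; rewrite ?nnegrE ?cabs_ge0.
have -> : gL * SL - g * Sp = g * (SL - Sp) - g * p ^+ L * (SL - Sp) - g * p ^+ L * Sp.
  by rewrite gE; move: (p ^+ L) => *; ring.
have qL : 0 <= q ^+ L by rewrite exprn_ge0.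
have qL1 : q ^+ L <= 1 by rewrite exprn_ile1 // ltW.
apply: le_trans (cabsD _ _) _; rewrite cabsN.
have i0 : 0 <= (1 - q)^-1 by rewrite invr_ge0 ltW.
have h1 : cabs (g * (SL - Sp)) <= (1 - q)^-1 * (T * q ^+ L).
  by rewrite cabsM; apply: ler_pM; rewrite ?cabs_ge0.
have h2 : cabs (g * p ^+ L * (SL - Sp)) <= (1 - q)^-1 * (T * q ^+ L).
  rewrite cabsM; apply: ler_pM; rewrite ?cabs_ge0 //; apply: le_trans gpL _.
  by rewrite -[leRHS]mulr1; exact: ler_wpM2l.
have h3 : cabs (g * p ^+ L * Sp) <= (1 - q)^-1 * (T * q ^+ L).
  rewrite cabsM (mulrC T) mulrA; exact: ler_pM (cabs_ge0 _) (cabs_ge0 _) gpL hSp.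
have h12 := cabsD (g * (SL - Sp)) (- (g * p ^+ L * (SL - Sp))); rewrite cabsN in h12.
move: h1 h2 h3 h12; set u := (1 - q)^-1 * (T * q ^+ L).
have -> : 3 * T / (1 - q) * q ^+ L = 3 * u.
  by rewrite /u; move: (q ^+ L) (1 - q)^-1 => *; ring.
by lra.
Qed.
End Convergence.

(** * The probability as a double contour integral *)

Section Assembly.
Variables (K : realType) (Delta : K) (N : nat) (t : K) (Y : config N) (x : int) (R r : K).
Local Notation C := K[i].
Local Notation D := (Delta%:C : C).
Hypotheses (okR : bethe_radius Delta R) (okr : bethe_radius Delta r) (Rr1 : R * r < 1).

Implicit Types z w : {ffun 'I_N -> int}.

Let R0 : 0 < R. Proof. by case: okR. Qed.
Let r0 : 0 < r. Proof. by case: okr. Qed.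

(** The part of [mode] that does not depend on the configuration. *)
Definition mode_factor (c : C) (v : N.-tuple C) : C :=
  cexp (c * bethe_energy Delta v) *
  ((\prod_i tnth v i) ^ x * plane (positions Y) v / pair_prod (scat D) (tnth v)).

(** For [c = - i t] and [c = i t] the integrands of the wave function at the
    configuration [x + z] and of its conjugate. *)
Definition mode (c : C) (z : {ffun 'I_N -> int}) (v : N.-tuple C) : C :=
  cexp (c * bethe_energy Delta v) * bethe_fun Delta (fun i => x + z i) (positions Y) v.

Lemma modeE rho c z v : 0 < rho -> on_torus rho v ->
  mode c z v = mode_factor c v * Phi D (tnth v) z.
Proof.
move=> rho0 hv; rewrite /mode /mode_factor /bethe_fun Phi_translate => [|i]; last first.
  exact: (on_torus_neq0 rho0).
move: (cexp _) (_ ^ x) (Phi _ _ _) (plane _ _) (_^-1) => *; ring.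
Qed.

Lemma prod_coord_lap rho : 0 < rho -> lap rho 0 (fun v : N.-tuple C => (\prod_i tnth v i) ^ x).
Proof.
move=> rho0; apply: (lap_eq (f := fun v => \prod_i tnth v i ^ x)) => [v hv|].
  by rewrite exprz_prod.
by apply: (lap_prod rho0) => i; exact: coord_lap0.
Qed.

Lemma mode_factor_lap rho c : bethe_radius Delta rho -> lap rho 0 (mode_factor c).
Proof.
move=> ok; have [rho0 [sg [k [phi [sg1 h1 h2 h3 h4]]]]] := ok.
apply: (lapM rho0); first exact: energy_exp_lap.
apply: (lapM rho0); last exact: (inv_pair_prod_lap rho0 h2 h3).
by apply: (lapM rho0); [exact: prod_coord_lap|exact: plane_lap].
Qed.

Lemma mode_lap rho c z : bethe_radius Delta rho -> lap rho 0 (mode c z).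
Proof.
move=> ok; have [rho0 [sg [k [phi [sg1 h1 h2 h3 h4]]]]] := ok.
by apply: (lapM rho0); [exact: energy_exp_lap|exact: (bethe_lap rho0 h2 h3)].
Qed.

(** The default configuration [Y] is used only when [z] is not increasing. *)
Definition translate_config (z : {ffun 'I_N -> int}) : config N :=
  xget Y [set X | positions X = fun i => x + z i].

Lemma positions_translate z : incr z -> positions (translate_config z) = fun i => x + z i.
Proof.
move=> hz; have [X hX] : exists X : config N, positions X = fun i => x + z i.
  by apply: positions_surj => i j ij; rewrite ltrD2l; exact: hz.
exact: (@xgetI _ Y [set X | positions X = fun i => x + z i] X hX).
Qed.

Lemma psi_mode z : incr z ->
  psi Delta Y (translate_config z) t = multi_circle_int R (mode (- 'i%C * t%:C) z).
Proof. by move=> hz; rewrite (psiE t Y _ okR) positions_translate. Qed.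

Lemma psi_conj_mode z : incr z ->
  (psi Delta Y (translate_config z) t)^*%C = multi_circle_int r (mode ('i%C * t%:C) z).
Proof. by move=> hz; rewrite (psi_conjE t Y _ okr) positions_translate. Qed.

Let cp : C := - 'i%C * t%:C.
Let cm : C := 'i%C * t%:C.

(** The continuous extension of the determinantal integrand to the product of the two
    tori. *)
Definition pairing_integrand (xi zeta : N.-tuple C) : C :=
  mode_factor (- 'i%C * t%:C) xi * mode_factor ('i%C * t%:C) zeta *
  pairing D (tnth xi) (tnth zeta).

Let part L (xi zeta : N.-tuple C) : C := \sum_(z <- cone L N) mode cp z xi * mode cm z zeta.

Definition inner_integral (xi : N.-tuple C) : C :=
  multi_circle_int r (pairing_integrand xi).

(** The truncated sum over configurations converges uniformly on the product of the two
    tori, so that it may be integrated term by term. *)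
Lemma part_near : exists2 A, 0 <= A & forall L xi zeta, on_torus R xi -> on_torus r zeta ->
  cabs (part L xi zeta - pairing_integrand xi zeta) <= A * (R * r) ^+ L.
Proof.
have [A A0 hA] := cone_sum_pairing Delta N R0 r0 Rr1.
have [P P0 hP] := lap_bounded R0 (mode_factor_lap cp okR).
have [M M0 hM] := lap_bounded r0 (mode_factor_lap cm okr).
exists (P * M * A) => [|L xi zeta hx hz]; first by rewrite !mulr_ge0 // ltW.
have -> : part L xi zeta = mode_factor cp xi * mode_factor cm zeta * cone_sum Delta L (tnth xi) (tnth zeta).
  rewrite /part /cone_sum big_distrr /=; apply: eq_bigr => z _.
  by rewrite (modeE _ _ R0 hx) (modeE _ _ r0 hz) mulrACA.
rewrite /pairing_integrand -/cp -/cm -mulrBr cabsM [X in X * _]cabsM -[leRHS]mulrA.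
have [_ /(_ L) h] := hA _ _ hx hz.
exact: ler_pM (mulr_ge0 (cabs_ge0 _) (cabs_ge0 _)) (cabs_ge0 _) (ler_pM (cabs_ge0 _) (cabs_ge0 _) (hP _ hx) (hM _ hz)) h.
Qed.

Let Rr01 : 0 <= R * r < 1.
Proof. by rewrite Rr1 mulr_ge0 // ltW. Qed.

Lemma geometric_le (A e : K) : 0 <= A -> 0 < e ->
  exists L0, forall L, (L0 <= L)%N -> A * (R * r) ^+ L <= e.
Proof.
move=> A0 e0; have d0 : 0 < e / (A + 1) by rewrite divr_gt0 // ltr_wpDl.
have [L0 h] := geometric_small Rr01 d0; exists L0 => L hL.
have /andP[q0 q1] := Rr01.
apply: (le_trans (y := A * (e / (A + 1)))).
  apply: ler_wpM2l => //; apply: le_trans h; apply: ler_wiXn2l => //; exact: ltW.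
rewrite mulrCA -[leRHS]mulr1; apply: ler_wpM2l; first exact: ltW.
by rewrite ler_pdivrMr ?ltr_wpDl // mul1r lerDl.
Qed.

Lemma pairing_integrand_lap xi : on_torus R xi -> lap r 0 (pairing_integrand xi).
Proof.
move=> hx; apply: lap_ulim => e e0; have [A A0 h] := part_near.
have [L hL] := geometric_le A0 e0.
exists (part L xi) => [|zeta hz].
  by apply: lap_sum => z; apply: (lapZ r0); exact: mode_lap.
by rewrite cabsB; apply: le_trans (h L _ _ hx hz) (hL _ _).
Qed.

Let part_inner L (xi : N.-tuple C) : C :=
  \sum_(z <- cone L N) (psi Delta Y (translate_config z) t)^*%C * mode cp z xi.

Lemma part_innerE L xi : on_torus R xi -> multi_circle_int r (part L xi) = part_inner L xi.
Proof.
move=> hx; rewrite /part (multi_circle_int_sum r0); last first.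
  by move=> z; apply: (lapZ r0); exact: mode_lap.
rewrite /part_inner !big_seq; apply: eq_bigr => z /cone_incr zc.
by rewrite (multi_circle_intZ r0); [rewrite psi_conj_mode // mulrC|exact: mode_lap].
Qed.

Lemma inner_near : exists2 A, 0 <= A & forall L xi, on_torus R xi ->
  cabs (part_inner L xi - inner_integral xi) <= A * (R * r) ^+ L.
Proof.
have [A A0 h] := part_near; exists (A * (2 * r) ^+ N) => [|L xi hx].
  by rewrite mulr_ge0 // exprn_ge0 // mulr_ge0 // ltW.
rewrite -part_innerE // mulrAC; apply: (multi_circle_int_near r0).
- by apply: lap_sum => z; apply: (lapZ r0); exact: mode_lap.
- exact: pairing_integrand_lap.
- by move=> v hv; exact: h.
Qed.

Lemma part_inner_lap L : lap R 0 (part_inner L).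
Proof. by apply: lap_sum => z; apply: (lapZ R0); exact: mode_lap. Qed.

Lemma inner_lap : lap R 0 inner_integral.
Proof.
apply: lap_ulim => e e0; have [A A0 h] := inner_near.
have [L hL] := geometric_le A0 e0.
exists (part_inner L) => [|xi hx]; first exact: part_inner_lap.
by rewrite cabsB; apply: le_trans (h L _ hx) (hL _ _).
Qed.

Lemma part_sum L : multi_circle_int R (part_inner L) =
  (\sum_(z <- cone L N) sqnorm (psi Delta Y (translate_config z) t))%:C.
Proof.
rewrite /part_inner (multi_circle_int_sum R0); last first.
  by move=> z; apply: (lapZ R0); exact: mode_lap.
rewrite rmorph_sum /= !big_seq; apply: eq_bigr => z /cone_incr zc.
rewrite (multi_circle_intZ R0); last exact: mode_lap.
by rewrite -psi_mode // sqnorm_conj mulrC.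
Qed.

(** Integrating one term over both tori gives the product of the wave function and its
    conjugate, by [psi_mode] and [psi_conj_mode]. *)
Lemma partial_sums_tend e : 0 < e -> exists L0, forall L, (L0 <= L)%N ->
  cabs ((\sum_(z <- cone L N) sqnorm (psi Delta Y (translate_config z) t))%:C
        - multi_circle_int R inner_integral) <= e.
Proof.
move=> e0; have [A A0 h] := inner_near.
have B0 : 0 <= A * (2 * R) ^+ N.
  by rewrite mulr_ge0 // exprn_ge0 // mulr_ge0 // ltW.
have [L0 hL] := geometric_le B0 e0; exists L0 => L /hL; apply: le_trans.
rewrite -part_sum mulrAC; apply: (multi_circle_int_near R0).
- exact: part_inner_lap.
- exact: inner_lap.
- by move=> v hv; exact: h.
Qed.

Lemma pos_le (X : config N) i : pos X 0 <= positions X i.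
Proof.
case: N X i => [|n] X i; first by case: i.
exact: (incr_le (positions_incr X) (i := ord0) (j := i)).
Qed.

Lemma translate_ge z L : z \in cone L N -> (0 < N)%N -> x <= pos (translate_config z) 0.
Proof.
move=> zc N0; have := congr1 (fun f => f (Ordinal N0)) (positions_translate (cone_incr zc)).
by rewrite /positions /= => ->; rewrite lerDl; exact: (cone_ge0 zc).
Qed.

Lemma translate_surj (X : config N) : x <= pos X 0 ->
  exists z : {ffun 'I_N -> int}, [/\ incr z, forall i, 0 <= z i & translate_config z = X].
Proof.
move=> xX; pose z : {ffun 'I_N -> int} := [ffun i => positions X i - x].
have zi : incr z.
  by move=> i j ij; rewrite !ffunE ltrD2r; exact: positions_incr.
exists z; split=> // [i|]; first by rewrite ffunE subr_ge0 (le_trans xX) ?pos_le.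
apply: positions_inj; rewrite positions_translate //.
by apply/funext => i; rewrite ffunE addrCA subrr addr0.
Qed.

Lemma translate_inj z w : incr z -> incr w -> translate_config z = translate_config w -> z = w.
Proof.
move=> hz hw e; apply/ffunP => i.
have := congr1 (@positions N) e; rewrite !positions_translate // => /(congr1 (fun f => f i)) /=.
by move/addrI.
Qed.

Lemma finite_in_cone (s : seq (config N)) : {in s, forall X, x <= pos X 0} ->
  exists L0, forall L, (L0 <= L)%N ->
    {subset s <= [seq translate_config z | z <- cone L N]}.
Proof.
elim: s => [|X s IH] h; first by exists 0%N.
have [|L1 H1] := IH; first by move=> Z Zs; apply: h; rewrite in_cons Zs orbT.
have [z [hz z0 zX]] := translate_surj (h X (mem_head _ _)).
have [L2 H2] := mem_cone hz z0.
exists (maxn L1 L2) => L; rewrite geq_max => /andP[/H1 sub /H2 zc] Z.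
by rewrite in_cons => /orP[/eqP->|/sub //]; apply/mapP; exists z.
Qed.

Lemma translate_uniq L : uniq [seq translate_config z | z <- cone L N].
Proof.
rewrite map_inj_in_uniq ?cone_uniq // => z w /cone_incr hz /cone_incr hw.
exact: translate_inj.
Qed.

(** The truncations exhaust the configurations with [x <= x_1], and their sums converge;
    the sum of nonnegative terms is therefore finite and equals the limit, which is in
    particular real. *)
Theorem prob_pairing : (0 < N)%N ->
  prob_leftmost_ge Delta Y t x \is a fin_num /\
  (fine (prob_leftmost_ge Delta Y t x))%:C = double_contour R r pairing_integrand.
Proof.
move=> N0; rewrite -[double_contour _ _ _]/(multi_circle_int R inner_integral).
set V := multi_circle_int R inner_integral; set P := prob_leftmost_ge _ _ _ _.
pose f X := sqnorm (psi Delta Y X t).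
have f0 X : 0 <= f X by rewrite /f sqnormE sqr_ge0.
pose s L := \sum_(z <- cone L N) f (translate_config z).
have sV e : 0 < e -> exists L0, forall L, (L0 <= L)%N -> cabs ((s L)%:C - V) <= e.
  exact: partial_sums_tend.
have sP L : ((s L)%:E <= P)%E.
  rewrite /s -(big_map translate_config xpredT f); apply: esum_ge_seq; first exact: translate_uniq.
  by move=> X /mapP[z zc ->] /=; exact: translate_ge zc N0.
have Re_bound e L : cabs ((s L)%:C - V) <= e -> `|s L - complex.Re V| <= e.
  by apply: le_trans; have := Re_le_cabs ((s L)%:C - V); case: (V).
have PV : (P <= (complex.Re V)%:E)%E.
  apply: esum_le_seq => u uu uS; rewrite -subr_le0; apply: (@le_eps _ _ 1) => // e e0.
  have [L1 H1] := sV _ e0; have [L2 H2] := finite_in_cone uS.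
  have h1 := Re_bound _ _ (H1 _ (leq_maxl L1 L2)); have h2 := H2 _ (leq_maxr L1 L2).
  set L := maxn L1 L2 in h1 h2.
  have us : \sum_(X <- u) f X <= s L.
    rewrite /s -(big_map translate_config xpredT f).
    set S := map _ _ in h2 *; rewrite [leRHS](bigID (mem u)) /=.
    apply: ler_wpDr; first by apply: sumr_ge0.
    rewrite -[leRHS]big_filter [leRHS](perm_big u) //; apply: uniq_perm => //.
      by apply: filter_uniq; exact: translate_uniq.
    by move=> X; rewrite mem_filter /=; case Xu: (X \in u) => //=; rewrite h2.
  by move: h1; rewrite ler_norml => /andP[]; lra.
have P0 : (0 <= P)%E by apply: esum_ge0 => X _; rewrite lee_fin f0.
have Pfin : P \is a fin_num by rewrite ge0_fin_numE //; apply: le_lt_trans PV (ltry _).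
split=> //; apply: (@cabs_eps _ _ _ 3) => // e e0.
have [L H] := sV _ e0; have h := H _ (leqnn L).
have h' := Re_bound _ _ h.
have : s L <= fine P by rewrite -lee_fin fineK.
have : fine P <= complex.Re V by rewrite -lee_fin fineK.
move=> p1 p2.
have -> : (fine P)%:C - V = (fine P - s L)%:C + ((s L)%:C - V).
  by rewrite rmorphB /=; ring.
apply: le_trans (cabsD _ _) _; rewrite cabs_real ger0_norm ?subr_ge0 //.
by move: h'; rewrite ler_norml => /andP[]; lra.
Qed.
End Assembly.

(** * The determinantal integrand at generic points *)

Section GenericPoints.
Variables (K : realType) (Delta : K) (N : nat) (t : K) (Y : config N) (x : int) (R r : K).
Local Notation C := K[i].
Local Notation D := (Delta%:C : C).
Hypotheses (okR : bethe_radius Delta R) (okr : bethe_radius Delta r) (Rr1 : R * r < 1).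

Let R0 : 0 < R. Proof. by case: okR. Qed.
Let r0 : 0 < r. Proof. by case: okr. Qed.

Lemma cexp_sum I (s : seq I) (f : I -> C) : cexp (\sum_(i <- s) f i) = \prod_(i <- s) cexp (f i).
Proof. by elim/big_rec2: _ => [|i a b _ <-]; rewrite ?cexp0 ?cexpD. Qed.

Lemma scat_denomE (xi zeta : N.-tuple C) :
  scat_denom Delta xi zeta = pair_prod (scat D) (tnth xi) * pair_prod (scat D) (tnth zeta).
Proof.
rewrite /scat_denom /pair_prod -big_split /=; apply: eq_bigr => i _.
by rewrite -big_split.
Qed.

(** The energies of the two families enter with opposite signs, so that the factor
    splits into a function of [xi] and a function of [zeta]. *)
Lemma wave_factorE (xi zeta : N.-tuple C) : on_torus R xi -> on_torus r zeta ->
  wave_factor Delta Y x t xi zeta / scat_denom Delta xi zeta =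
  mode_factor Delta Y x (- 'i%C * t%:C) xi * mode_factor Delta Y x ('i%C * t%:C) zeta.
Proof.
move=> hx hz; rewrite scat_denomE /mode_factor /wave_factor big_split /= -cexp_sum.
set a := pair_prod _ _; set b := pair_prod _ _.
have -> : \sum_(j < N) - 'i%C * t%:C * (energy Delta (tnth xi j) - energy Delta (tnth zeta j)) =
   (- 'i%C * t%:C) * bethe_energy Delta xi + 'i%C * t%:C * bethe_energy Delta zeta.
  rewrite /bethe_energy !big_distrr -big_split /=; apply: eq_bigr => j _.
  by rewrite /energy; ring.
rewrite cexpD; move: (cexp _) (cexp _) => p q.
have -> : \prod_(j < N) (tnth xi j * tnth zeta j) ^ (x - pos Y j - 1) =
   (\prod_j tnth xi j) ^ x * plane (positions Y) xi * ((\prod_j tnth zeta j) ^ x * plane (positions Y) zeta).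
  rewrite !exprz_prod /plane -!big_split /=; apply: eq_bigr => j _.
  have xj := on_torus_neq0 R0 j hx; have zj := on_torus_neq0 r0 j hz.
  rewrite -addrA expfzMl !expfzDr //; move: (_ ^ x) (_ ^ x) => *; ring.
rewrite invfM; move: (plane _ _) (plane _ _) (_ ^ x) (_ ^ x) (a^-1) (b^-1) => *; ring.
Qed.

Lemma ik_detE (xi zeta : N.-tuple C) :
  prod_mix Delta xi zeta * DN Delta xi zeta = ik_det D (tnth xi) (tnth zeta).
Proof.
by rewrite /prod_mix /DN /ik_det; congr (_ * \det _); apply/matrixP => i j; rewrite !mxE.
Qed.

Definition outer_poles : seq C := [:: (2 * D)^-1].
(** The points where [1 - 2 D b] or some [mix a b] with [a] in [xi] vanishes. If [1 - 2
    D a = 0] the point listed for [a] is 0, which does not lie on the torus. *)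
Definition inner_poles (xi : N.-tuple C) : seq C :=
  (2 * D)^-1 :: [seq - a / (1 - 2 * D * a) | a <- xi].

Lemma one_sub_2D_neq0 (a : C) : a != (2 * D)^-1 -> 1 - 2 * D * a != 0.
Proof.
apply: contraNneq => /eqP; rewrite subr_eq0 => /eqP h.
have D0 : 2 * D != 0 by apply: contra_eq_neq h => ->; rewrite mul0r oner_neq0.
by rewrite -[a](mulKf D0) -h mulr1.
Qed.

Definition generic_point (xi zeta : N.-tuple C) : Prop :=
  [/\ uniq xi, uniq zeta, {in xi, forall a, a \notin outer_poles} &
      {in zeta, forall b, b \notin inner_poles xi}].

Lemma generic_mix (xi zeta : N.-tuple C) : generic_point xi zeta ->
  forall i j, tnth xi i + tnth zeta j - 2 * D * tnth xi i * tnth zeta j != 0.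
Proof.
move=> [_ _ hx hz] i j.
have a0 : 1 - 2 * D * tnth xi i != 0.
  apply: one_sub_2D_neq0; have := hx _ (mem_tnth i xi).
  by rewrite inE.
have : tnth zeta j != - tnth xi i / (1 - 2 * D * tnth xi i).
  apply: contraNneq (hz _ (mem_tnth j zeta)) => ->; rewrite in_cons; apply/orP; right.
  by apply/mapP; exists (tnth xi i); first exact: mem_tnth.
apply: contraNneq => h; apply/eqP/(mulIf a0); rewrite mulfVK //.
apply/eqP; rewrite -subr_eq0 -h; apply/eqP; ring.
Qed.

Lemma one_sub_prod_neq0 (xi zeta : N.-tuple C) k (f g : 'I_k.+1 -> 'I_N) :
  on_torus R xi -> on_torus r zeta ->
  1 - (\prod_i tnth xi (f i)) * \prod_i tnth zeta (g i) != 0.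
Proof.
move=> hx hz; apply: (one_sub_neq0 Rr1).
rewrite cabsM (cabs_prod_cst (rho := R)) => [|i]; last exact: hx.
rewrite (cabs_prod_cst (rho := r)) => [|i]; last exact: hz.
have q0 : 0 <= R * r by rewrite mulr_ge0 // ltW.
by rewrite -exprMn exprS -[leRHS]mulr1; apply: ler_wpM2l => //; rewrite exprn_ile1 // ltW.
Qed.

Lemma integrandDE (xi zeta : N.-tuple C) : on_torus R xi -> on_torus r zeta ->
  generic_point xi zeta -> integrandD Delta Y x t xi zeta = pairing_integrand Delta t Y x xi zeta.
Proof.
move=> hx hz gen; have [ux uz px pz] := gen.
rewrite /pairing_integrand pairing_det.
- rewrite -ik_detE -wave_factorE // /integrandD.
  by move: (_^-1) (prod_mix _ _ _) (DN _ _ _) => *; ring.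
- by move=> k f g; exact: one_sub_prod_neq0.
- by move=> i j; exact: generic_mix.
- exact/tuple_uniqP.
- exact/tuple_uniqP.
- by move=> i; exact: (on_torus_neq0 R0).
- by move=> i; exact: (on_torus_neq0 r0).
- move=> i; apply: one_sub_2D_neq0; have := px _ (mem_tnth i xi).
  by rewrite inE.
- move=> i; apply: one_sub_2D_neq0; have := pz _ (mem_tnth i zeta).
  by rewrite in_cons negb_or => /andP[].
Qed.

(** Where two variables coincide or a denominator vanishes, the determinantal integrand
    need not agree with its continuous extension [pairing_integrand]; by
    [multi_circle_int_generic] this does not affect the integrals. *)
Lemma double_contour_generic (F : N.-tuple C -> N.-tuple C -> C) :
  (forall xi zeta, on_torus R xi -> on_torus r zeta -> generic_point xi zeta ->
    F xi zeta = pairing_integrand Delta t Y x xi zeta) ->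
  double_contour R r F = double_contour R r (pairing_integrand Delta t Y x).
Proof.
move=> hF; apply: (multi_circle_int_generic R0 (B := outer_poles)).
  exact: inner_lap.
move=> xi hx ux px; apply: (multi_circle_int_generic r0 (B := inner_poles xi)).
  exact (pairing_integrand_lap t Y x okR okr Rr1 hx).
by move=> zeta hz uz pz; exact: hF.
Qed.

Lemma integrandQE (xi zeta : N.-tuple C) : on_torus R xi -> on_torus r zeta ->
  is_QN Delta (QN Delta N) ->
  generic_point xi zeta -> integrandQ Delta Y x t xi zeta = integrandD Delta Y x t xi zeta.
Proof.
move=> hx hz QP gen; rewrite /integrandQ /integrandD.
have := QP xi zeta; set Q := eval2 _ _ _ => h.
have {}h : prod_mix Delta xi zeta * DN Delta xi zeta =
    vdm xi * vdm zeta / prod_one_minus xi zeta * Q.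
  apply: h; apply/prodf_neq0 => i _; apply/prodf_neq0 => j _; first exact: generic_mix.
  by have := one_sub_prod_neq0 (fun _ : 'I_1 => i) (fun=> j) hx hz; rewrite !big_ord1.
congr (_ * _); rewrite [RHS]mulrAC h.
by move: (scat_denom _ _ _)^-1 (prod_one_minus _ _)^-1 => *; ring.
Qed.
End GenericPoints.

(** * Divisibility by Vandermonde products *)

Section VandermondeDivisibility.
Variables (n : nat) (F : idomainType).
Local Notation P := (mpoly.mpoly n F).
Implicit Types (p q : P) (i j k : 'I_n).

Definition var i : P := @mpolyX n F (mnm1 i).

(** The substitution of the variable [j] for the variable [i]. It is a ring morphism,
    and its kernel is the ideal generated by the difference of the two variables. *)
Definition merge i j : P -> P :=
  comp_mpoly [tuple var (if k == i then j else k) | k < n].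

Lemma merge_var i j k : merge i j (var k) = var (if k == i then j else k).
Proof. by rewrite /merge /var comp_mpolyXU -tnth_nth tnth_mktuple. Qed.

(** The polynomials that satisfy this form a subring which contains the constants and
    the variables. *)
Lemma merge_rest i j p : exists q, p = merge i j p + (var i - var j) * q.
Proof.
pose ok p := exists q, p = merge i j p + (var i - var j) * q.
have okD p1 p2 : ok p1 -> ok p2 -> ok (p1 + p2).
  move=> [q1 e1] [q2 e2]; exists (q1 + q2); rewrite {1}e1 {1}e2 /merge rmorphD /=.
  by move: (comp_mpoly _ _) (comp_mpoly _ _) => *; ring.
have okM p1 p2 : ok p1 -> ok p2 -> ok (p1 * p2).
  move=> [q1 e1] [q2 e2]; rewrite /ok /merge rmorphM /= -!/(merge _ _ _).
  exists (merge i j p1 * q2 + q1 * merge i j p2 + (var i - var j) * q1 * q2).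
  rewrite {1}e1 {1}e2; move: (merge _ _ _) (merge _ _ _) => *; ring.
have okC c : ok (@mpolyC n F c).
  by exists 0; rewrite mulr0 addr0 /merge comp_mpolyC.
have okX k : ok (var k).
  rewrite /ok merge_var; case: (k =P i) => [->|_]; last by exists 0; rewrite mulr0 addr0.
  by exists 1; rewrite mulr1 addrC subrK.
rewrite [p]mpolyE; elim/big_ind: _ => [|p1 p2|m _]; first by rewrite -mpolyC0; exact: okC.
  exact: okD.
rewrite -mul_mpolyC; apply: (okM _ _ (okC _)).
rewrite mpolyXE_id; elim/big_ind: _ => [|p1 p2|k _]; first by rewrite -mpolyC1; exact: okC.
  exact: okM.
elim: (fun_of_multinom m k) => [|d IH]; first by rewrite expr0 -mpolyC1; exact: okC.
by rewrite exprS; exact: (okM _ _ (okX k) IH).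
Qed.

Lemma var_inj : injective var.
Proof.
move=> i j /(congr1 (meval (fun k => (k == i)%:R : F))); rewrite !mevalXU eqxx.
by case: (j =P i) => // _ /eqP; rewrite oner_eq0.
Qed.

Definition pair_diff (e : 'I_n * 'I_n) : P := var e.2 - var e.1.

(** The differences are divided out one after the other. A substitution that kills the
    product of the previous differences with the quotient kills the quotient, because
    the polynomial ring is a domain and only one pair [a < b] is identified by it. *)
Lemma divides_pair_diffs (s : seq ('I_n * 'I_n)) p :
  uniq s -> all (fun e : 'I_n * 'I_n => (e.1 < e.2)%N) s -> {in s, forall e, merge e.1 e.2 p = 0} ->
  exists q, p = (\prod_(e <- s) pair_diff e) * q.
Proof.
elim: s => [|[a b] s IH] /=; first by exists p; rewrite big_nil mul1r.
move=> /andP[abs us] /andP[ab os] h.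
have [|q pE] := IH us os; first by move=> e es; apply: h; rewrite in_cons es orbT.
have := h _ (mem_head _ _); rewrite pE /= /merge rmorphM -/(merge a b) /= => /eqP.
rewrite mulf_eq0 => /orP[|/eqP q0].
  rewrite rmorph_prod /= prodf_seq_eq0 => /hasP[[c d] cds] /=.
  rewrite /pair_diff rmorphB /= -!/(merge a b _) !merge_var subr_eq0 => /eqP/var_inj.
  have cd := allP os _ cds; move: ab cd => /= ab cd.
  case: (d =P a) => [da|_]; case: (c =P a) => [ca|_] e.
  - by move: cd; rewrite da ca ltnn.
  - by move: cd ab; rewrite -e da => h1 h2; have := ltn_trans h1 h2; rewrite ltnn.
  - by move: abs; rewrite -e -ca cds.
  - by move: cd; rewrite e ltnn.
have [q' qE] := merge_rest a b q.
exists (- q'); rewrite big_cons qE.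
have -> : merge a b q = 0 by exact: q0.
by rewrite /pair_diff add0r /=; move: (\prod_(_ <- _) _) => *; ring.
Qed.
End VandermondeDivisibility.

(** Both sides expand to the sum over permutations of the products of all entries off
    the graph of the permutation. *)
Lemma det_deleted (R : comNzRingType) n (a : 'I_n -> 'I_n -> R) :
  \det (\matrix_(i, j) \prod_(k | k != j) a i k) =
  \det (\matrix_(i, j) \prod_(k | k != i) a k j).
Proof.
apply: eq_bigr => s _; congr (_ * _).
under eq_bigr do rewrite mxE.
under [RHS]eq_bigr do rewrite mxE.
rewrite [RHS](exchange_big_dep predT) //=; apply: eq_bigr => i _.
rewrite [LHS](reindex_inj (@perm_inj _ s)) /=; apply: eq_bigl => k.
by rewrite (inj_eq perm_inj) eq_sym.
Qed.

Lemma det_inv_deleted (R : fieldType) n (a : 'I_n -> 'I_n -> R) : (forall i j, a i j != 0) ->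
  (\prod_i \prod_k a i k) * \det (\matrix_(i, j) (a i j)^-1) =
  \det (\matrix_(i, j) \prod_(k | k != j) a i k).
Proof.
(* Clearing the denominators of a row is multiplication by a diagonal matrix. *)
move=> a0; have -> : \prod_i \prod_k a i k = \det (diag_mx (\row_i \prod_k a i k)).
  by rewrite det_diag; apply: eq_bigr => i _; rewrite mxE.
rewrite -det_mulmx mul_diag_mx; congr (\det _); apply/matrixP => i j.
by rewrite !mxE (bigD1 j) //= mulrAC mulfV // mul1r.
Qed.

Section Existence.
Variables (K : realType) (Delta : K) (N : nat).
Local Notation C := K[i].
Local Notation D := (Delta%:C : C).
Local Notation P := (mpoly.mpoly (N + N) C).

Definition entry_poly (i k : 'I_N) : P :=
  (1 - var C (lshift N i) * var C (rshift N k)) *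
  (var C (lshift N i) + var C (rshift N k)
   - mpolyC (N + N) (2 * D) * var C (lshift N i) * var C (rshift N k)).

(** The determinant with entries [(entry_poly i j)^-1], multiplied by the product of all
    entries to clear denominators. *)
Definition det_poly : P := \det (\matrix_(i, j) \prod_(k | k != j) entry_poly i k).

Lemma merge_entry (e : 'I_(N + N) * 'I_(N + N)) i k : merge e.1 e.2 (entry_poly i k) =
  let f l := var C (if l == e.1 then e.2 else l) in
  (1 - f (lshift N i) * f (rshift N k)) *
  (f (lshift N i) + f (rshift N k) - mpolyC (N + N) (2 * D) * f (lshift N i) * f (rshift N k)).
Proof.
rewrite /entry_poly /merge.
by rewrite !(rmorphM, rmorphB, rmorphD, rmorph1) /= comp_mpolyC -!/(merge _ _ _) !merge_var.
Qed.

(** Identifying two of the variables [xi] makes two rows equal. *)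
Lemma merge_det_rows (i i' : 'I_N) : i != i' -> merge (lshift N i) (lshift N i') det_poly = 0.
Proof.
move=> ii'; rewrite /merge /det_poly -det_map_mx; apply: (determinant_alternate ii') => j.
rewrite !mxE !rmorph_prod; apply: eq_bigr => k _ /=; rewrite -!/(merge _ _ _).
rewrite !(merge_entry (lshift N i, lshift N i')) /= eqxx eq_rlshift eq_lshift (eq_sym i').
by rewrite (negPf ii').
Qed.

(** By [det_deleted] the same polynomial is a determinant in which each [zeta] occurs in
    one column only, so that identifying two of them makes two columns equal. *)
Lemma merge_det_cols (i i' : 'I_N) : i != i' -> merge (rshift N i) (rshift N i') det_poly = 0.
Proof.
move=> ii'; rewrite /merge /det_poly det_deleted -det_tr -det_map_mx.
apply: (determinant_alternate ii') => j.
rewrite !mxE !rmorph_prod; apply: eq_bigr => k _ /=; rewrite -!/(merge _ _ _).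
rewrite !(merge_entry (rshift N i, rshift N i')) /= eqxx eq_lrshift eq_rshift (eq_sym i').
by rewrite (negPf ii').
Qed.

Definition increasing_pairs :=
  [seq p : 'I_N * 'I_N <- index_enum ('I_N * 'I_N)%type | (p.1 < p.2)%N].

Definition variable_pairs : seq ('I_(N + N) * 'I_(N + N)) :=
  [seq (lshift N p.1, lshift N p.2) | p : 'I_N * 'I_N <- increasing_pairs] ++
  [seq (rshift N p.1, rshift N p.2) | p : 'I_N * 'I_N <- increasing_pairs].

(** The numerator [det_poly] vanishes when two [xi] or two [zeta] coincide, hence is
    divisible by both Vandermonde products. *)
Lemma exists_QN : exists Q, is_QN (N := N) Delta Q.
Proof.
have [] := @divides_pair_diffs _ _ variable_pairs det_poly.
- rewrite cat_uniq !map_inj_uniq ?filter_uniq ?index_enum_uniq //=; last first.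
  + by move=> [a b] [c d] /= [/ord_inj-> /ord_inj->].
  + by move=> [a b] [c d] /= [/addnI/ord_inj-> /addnI/ord_inj->].
  rewrite andbT; apply/hasPn => _ /mapP[p _ ->] /=; apply/mapP => -[q _ /(congr1 fst) /= /eqP].
  by rewrite eq_rlshift.
- apply/allP => e; rewrite mem_cat => /orP[] /mapP[p]; rewrite mem_filter => /andP[pp _] -> //=.
  by rewrite ltn_add2l.
- have neq (p : 'I_N * 'I_N) : (p.1 < p.2)%N -> p.1 != p.2 by move=> h; rewrite -val_eqE /= ltn_eqF.
  move=> e; rewrite mem_cat => /orP[] /mapP[p]; rewrite mem_filter => /andP[/neq pp _] -> /=.
    exact: merge_det_rows.
  exact: merge_det_cols.
move=> Q detE; exists Q => xi zeta mix0 om0.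
pose ev : P -> C := meval (tnth (cat_tuple xi zeta)).
have evX i : ev (var C (lshift N i)) = tnth xi i by rewrite /ev mevalXU tnth_lshift.
have evZ i : ev (var C (rshift N i)) = tnth zeta i by rewrite /ev mevalXU tnth_rshift.
have evDet : ev det_poly = prod_one_minus xi zeta * prod_mix Delta xi zeta * DN Delta xi zeta.
  pose a i k := (1 - tnth xi i * tnth zeta k) *
    (tnth xi i + tnth zeta k - 2 * D * tnth xi i * tnth zeta k).
  have -> : prod_one_minus xi zeta * prod_mix Delta xi zeta = \prod_i \prod_k a i k.
    by rewrite -big_split /=; apply: eq_bigr => i _; rewrite -big_split.
  have -> : DN Delta xi zeta = \det (\matrix_(i, j) (a i j)^-1).
    by congr (\det _); apply/matrixP => i j; rewrite !mxE.
  rewrite det_inv_deleted => [|i j]; last first.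
    move: mix0 om0 => /prodf_neq0/(_ i isT)/prodf_neq0/(_ j isT) m0.
    move=> /prodf_neq0/(_ i isT)/prodf_neq0/(_ j isT) o0.
    by rewrite mulf_neq0.
  rewrite /ev /det_poly -det_map_mx; congr (\det _); apply/matrixP => i j.
  rewrite !mxE rmorph_prod; apply: eq_bigr => k _.
  rewrite /entry_poly !(rmorphM, rmorphB, rmorphD, rmorph1) /= mevalC.
  by rewrite -!/(ev _) evX evZ.
have evPairs : ev (\prod_(e <- variable_pairs) pair_diff C e) = vdm xi * vdm zeta.
  rewrite /ev rmorph_prod big_cat !big_map !big_filter /= /vdm !pair_big_dep /=.
  by congr (_ * _); apply: eq_bigr => p _; rewrite /pair_diff rmorphB /= -!/(ev _) !(evX, evZ).
rewrite mulrAC -evPairs -[eval2 _ _ _]/(ev Q) -rmorphM /= -detE -/(ev _) evDet.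
by rewrite -mulrA mulrAC mulfV // mul1r.
Qed.

Lemma QN_spec : is_QN Delta (QN Delta N).
Proof. by have [Q hQ] := exists_QN; exact: (@xgetI _ 0 [set Q | is_QN Delta Q] Q hQ). Qed.
End Existence.

(** * The law of the left-most particle *)

Theorem theorem2 (K : realType) (N : nat) (hN : (1 <= N)%N) (Delta : K)
    (Y : config N) (x : int) (t : K) (ht : 0 <= t) (R r : K)
    (R_gt0 : 0 < R) (r_gt0 : 0 < r)
    (hr : forall z w : K[i], `|z| <= r%:C -> `|w| <= r%:C ->
      1 + z * w - 2 * Delta%:C * z != 0)
    (hR : forall z w : K[i], R%:C <= `|z| -> R%:C <= `|w| ->
      1 + z * w - 2 * Delta%:C * z != 0)
    (hRr : R * r < 1) :
  let P := prob_leftmost_ge Delta Y t x in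
  [/\ P \is a fin_num,
      (fine P)%:C = double_contour R r (integrandD Delta Y x t) &
      (fine P)%:C = double_contour R r (integrandQ Delta Y x t)].
Proof.
have okr : bethe_radius Delta r by apply: small_bethe_radius => //; exact: small_radius_bound.
have okR : bethe_radius Delta R by apply: large_bethe_radius => //; exact: large_radius_bound.
move=> P; have [Pfin PE] := prob_pairing t Y x okR okr hRr hN.
split=> //; rewrite PE; apply/esym/double_contour_generic => // xi zeta hx hz gen.
  exact: (integrandDE _ _ _ okR okr hRr).
rewrite (integrandQE _ _ _ okR okr hRr) //; last exact: QN_spec.
exact: (integrandDE _ _ _ okR okr hRr).
Qed.
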